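(* Let $N \geq 2$ be an integer, let $R > 0$ and let $\mathcal{B}_R \subset \mathbb{R}^N$ be the ball of radius $R$ centered at the origin. Let $q: [0, R] \to \mathbb{R}$ be a continuous function such that $q(r_0) > 0$ for some $r_0 \in [0, R]$ and let $g: \mathbb{R} \to \mathbb{R}$ be a locally Lipschitz continuous function for which there exists $\delta > 0$ such that $$ g(u) u > 0 \quad \text{for every } u \in (-\delta, \delta) \setminus \{0\}, $$ and such that $$ \lim_{u \to 0} \frac{g(u)}{u} = 0. $$ Then, for any integer $k \geq 1$, there exists $\lambda^*(k) > 0$ such that, for every $\lambda > \lambda^*(k)$, the problem $$ \left\{ \begin{array}{ll} \displaystyle \mathrm{div} \left( \frac{\nabla u}{\sqrt{1-\vert \nabla u \vert^2}}\right) + \lambda q(\vert x \vert) g(u) = 0, & x \in \mathcal{B}_R, \\ u = 0, & x \in \partial \mathcal{B}_R, \end{array} \right. $$ has at least $4k$ sign-changing radial solutions. More precisely, for every integer $j=1, \ldots, k$ there exist four radial solutions $u_{l, j}^-$, $u_{s, j}^-$, $u_{s, j}^+$, $u_{l, j}^+$ of this problem satisfying $$ u_{l, j}^-(0) < u_{s, j}^-(0) < 0 < u_{s, j}^+(0) < u_{l, j}^+(0) $$ and having exactly $j+1$ nodal domains.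
   Context: A radial solution is a function of the form $u(x) = u(|x|)$ (usual abuse of notation) whose profile $u \in C^1([0,R])$ satisfies: $|u'(r)| < 1$ for every $r \in [0,R]$; the function $r \mapsto r^{N-1}\varphi(u'(r))$, with $\varphi(s) = s/\sqrt{1-s^2}$ for $s \in (-1,1)$, belongs to $C^1([0,R])$; the equation $$(r^{N-1}\varphi(u'))' + \lambda r^{N-1} q(r)g(u) = 0$$ holds pointwise on $[0,R]$; and $u'(0) = 0$, $u(R) = 0$. (Such a profile is automatically of class $C^2([0,R])$.) The nodal domains of $u$ are the connected components of $\{x \in \mathcal{B}_R : u(x) \neq 0\}$. *)

(* Defs.v *)
From HB Require Import structures.
From mathcomp Require Import all_boot all_order all_algebra.
From mathcomp Require Import all_classical all_reals all_analysis.
Set Implicit Arguments.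
Unset Strict Implicit.
Unset Printing Implicit Defensive.
Import Order.TTheory GRing.Theory Num.Theory.
Import numFieldNormedType.Exports.
Local Open Scope classical_set_scope.
Local Open Scope ring_scope.

(* The library norm on ['rV[R]_N] is the sup norm.  Its topology is the usual
   one, so only balls and radial functions need the Euclidean norm. *)
Definition euclidean_norm (R : realType) (N : nat) (x : 'rV[R]_N) : R :=
  Num.sqrt (\sum_(i < N) x ord0 i ^+ 2).

Definition euclidean_ball (R : realType) (N : nat) (rho : R) : set 'rV[R]_N :=
  [set x | euclidean_norm x < rho].

Definition radial (R : realType) (N : nat) (u : R -> R) (x : 'rV[R]_N) : R :=
  u (euclidean_norm x).

(* [f] is of class C^1 on [[a, b]] with derivative [df]; the derivatives at
   [a] and [b] are one-sided, so values outside [[a, b]] are irrelevant. *)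
Definition C1_with (R : realType) (a b : R) (f df : R -> R) : Prop :=
  (forall x, x \in `[a, b] ->
     (f y - f x) / (y - x) @[y --> within `[a, b] x^'] --> df x) /\
  {within `[a, b], continuous df}.

Definition locally_lipschitz (R : realType) (f : R -> R) : Prop :=
  forall x : R, exists2 A : set R, nbhs x A & [lipschitz f y | y in A].

Definition phi (R : realType) (s : R) : R := s / Num.sqrt (1 - s ^+ 2).

(* [u] is a radial solution (given by its profile) of
   div (grad u / sqrt (1 - |grad u|^2)) + lambda q(|x|) g(u) = 0
   in the ball of radius [rho] of R^N, vanishing on the boundary.
   [du] is u' and [dw] is (r^(N-1) phi(u'))'. *)
Definition radial_solution (R : realType) (N : nat) (rho : R) (q g : R -> R)
    (lambda : R) (u : R -> R) : Prop :=
  exists du dw : R -> R,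
  [/\ C1_with 0 rho u du,
      forall r, r \in `[0, rho] -> `|du r| < 1,
      C1_with 0 rho (fun r => r ^+ N.-1 * phi (du r)) dw,
      forall r, r \in `[0, rho] ->
        dw r + lambda * r ^+ N.-1 * q r * g (u r) = 0 &
      du 0 = 0 /\ u rho = 0].

Definition sign_changing (R : realType) (N : nat) (rho : R) (u : R -> R) :
    Prop :=
  exists x y : 'rV[R]_N,
  [/\ euclidean_ball rho x, euclidean_ball rho y, radial u x < 0
    & 0 < radial u y].

Definition nonzero_set (R : realType) (N : nat) (rho : R) (u : R -> R) :
    set 'rV[R]_N :=
  euclidean_ball rho `&` [set x | radial u x != 0].

Definition nodal_domains (R : realType) (N : nat) (rho : R) (u : R -> R) :
    set (set 'rV[R]_N) :=
  [set connected_component (nonzero_set rho u) x | x in nonzero_set rho u].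

Arguments nodal_domains {R} N rho u.

Definition sign_changing_solution (R : realType) (N : nat) (rho : R)
    (q g : R -> R) (lambda : R) (u : R -> R) : Prop :=
  radial_solution N rho q g lambda u /\ sign_changing N rho u.

Definition nodal_solution (R : realType) (N : nat) (rho : R) (q g : R -> R)
    (lambda : R) (n : nat) (u : R -> R) : Prop :=
  sign_changing_solution N rho q g lambda u /\
  (nodal_domains N rho u #= `I_n)%card.

(* Main.v *)
Require Import Defs.
From HB Require Import structures.
From mathcomp Require Import all_boot all_order all_algebra.
From mathcomp Require Import all_classical all_reals all_analysis.
From mathcomp Require Import ring lra.
Import Order.TTheory GRing.Theory Num.Theory.
Import numFieldNormedType.Exports.
Local Open Scope classical_set_scope.
Local Open Scope ring_scope.

Set Implicit Arguments.
Unset Strict Implicit.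
Unset Printing Implicit Defensive.

(** The proof is a shooting argument on the height [d = u(0)].

    Write [n = N - 1], [a = lambda q], and let [w = r^n phi(u')] be the
    momentum.  With [psi] the inverse of [phi], the equation becomes the system
    [u' = psi (w / r^n)], [w' = - r^n a g(u)], started from [u(0) = d],
    [w(0) = 0].  Since [|u'| < 1], trajectories with [|d| <= rho + 1] stay
    in [[- 2 rho - 1, 2 rho + 1]], so [g] may be replaced by a bounded, globally
    Lipschitz function.  The factor [r^(-n)] is harmless because the momentum is
    [O(r^(n + 1))], and Picard iteration gives a trajectory for every height,
    depending on it in a Lipschitz way (lemmas [shot_exists], [shot_lip]).

    For [d != 0] the pair [(u, w)] never reaches the origin ([shot_neq0]), so
    [(u, - w)] has a continuous polar angle [theta] with [theta(0) = 0].  Zeros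
    of [u] are the radii where [theta] is an odd multiple of [pi / 2]; there
    [theta] is increasing, hence every such level is crossed once and upwards
    ([angle_upcrossing]).  Consequently [u(rho) = 0] with exactly [j] zeros
    inside the ball as soon as [theta(rho) = pi / 2 + j pi], and since
    [theta(rho)] is a continuous function of [d > 0] ([angle_lip]) it suffices
    to see where it is small and where it is large.

    It is less than [pi / 2] for small [d], as a superlinear force cannot turn
    a low trajectory around ([shot_low]), and for [d = rho + 1], as the
    trajectory has no time to come down ([shot_high]).  In between, fix a
    window [[r1, r2]] where [q] is positive and a small amplitude [c], and
    choose [d] such that the maximum of [|u|] over the window is [c]
    ([window_max_IVT]).  This choice bounds the amplitude from above whatever
    the sign of [q] before the window.  Starting from the radius where the
    maximum is attained and moving towards the farther end of the window,
    forwards or backwards, each half turn takes time at most [7 c] and keeps a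
    definite part of the amplitude, uniformly for large [lambda] ([half_turn]);
    so there is room for any prescribed number of half turns.  By the
    intermediate value theorem every value [pi / 2 + j pi], [1 <= j <= k], is
    attained by [theta(rho)] both below and above that height
    ([two_heights]).  Negative heights are positive heights for the force
    [- g(- x)].

    Finally, in dimension at least two a ball or a spherical shell is connected
    ([radial_connected]), so the nodal domains are the sets where [theta(|x|)]
    lies strictly between two consecutive levels: there are [j + 1] of them
    ([shot_nodal_domains]). *)

(** * Calculus on the line *)

Lemma is_derive_continuous (R : realType) (f : R -> R) (x df : R) :
  is_derive x 1 f df -> {for x, continuous f}.
Proof.
by move=> [/derivable1_diffP/differentiable_continuous].
Qed.

Lemma is_derive_within (R : realType) (f df : R -> R) (a b : R) :
  (forall x, x \in `[a, b] -> is_derive x 1 f (df x)) ->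
  {within `[a, b], continuous f}.
Proof.
move=> fdf; apply: continuous_in_subspaceT => x; rewrite inE => xab.
exact: is_derive_continuous (fdf x xab).
Qed.

Lemma is_derive_homo (R : realType) (f df : R -> R) (a b : R) :
  (forall x, x \in `[a, b] -> is_derive x 1 f (df x)) ->
  (forall x, x \in `[a, b] -> 0 <= df x) -> a <= b -> f a <= f b.
Proof.
move=> fdf df0 ab.
have fdo x : x \in `]a, b[ -> is_derive x 1 f (df x).
  by move=> xab; apply: fdf; exact: subset_itv_oo_cc xab.
have [c cab fE] := MVT_segment ab fdo (is_derive_within fdf).
by rewrite -subr_ge0 fE mulr_ge0 ?df0 ?subr_ge0.
Qed.

Lemma is_derive_cst_eq (R : realType) (f : R -> R) (a b : R) :
  (forall x, x \in `[a, b] -> is_derive x 1 f 0) -> a <= b -> f a = f b.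
Proof.
move=> fdf ab.
have fdo x : x \in `]a, b[ -> is_derive x 1 f 0.
  by move=> xab; apply: fdf; exact: subset_itv_oo_cc xab.
have [c cab fE] :=
  @MVT_segment R f (fun=> 0) a b ab fdo (is_derive_within fdf).
by apply/eqP; rewrite eq_sym -subr_eq0 fE mul0r.
Qed.

Section derivative_rules.
Variables (R : realType) (f g : R -> R) (x df dg : R).
Hypothesis (fdf : is_derive x 1 f df) (gdg : is_derive x 1 g dg).

Lemma derR_add : is_derive x 1 (fun t => f t + g t) (df + dg).
Proof. exact: is_deriveD. Qed.

Lemma derR_sub : is_derive x 1 (fun t => f t - g t) (df - dg).
Proof. exact: is_deriveB. Qed.

Lemma derR_opp : is_derive x 1 (fun t => - f t) (- df).
Proof. exact: is_deriveN. Qed.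

Lemma derR_mul : is_derive x 1 (fun t => f t * g t) (df * g x + f x * dg).
Proof.
apply: (is_derive_eq (is_deriveM fdf gdg)).
by rewrite /GRing.scale /= addrC mulrC.
Qed.

Lemma derR_scale (c : R) : is_derive x 1 (fun t => c * f t) (c * df).
Proof. exact: is_deriveZ. Qed.

End derivative_rules.

Lemma derR_cst (R : realType) (x c : R) : is_derive x 1 (fun=> c) 0.
Proof. exact: is_derive_cst. Qed.

Lemma derR_id (R : realType) (x : R) : is_derive x 1 (fun t => t) 1.
Proof. exact: is_derive_id. Qed.

Lemma derR_comp (R : realType) (f g : R -> R) (x df dg : R) :
  is_derive x 1 g dg -> is_derive (g x) 1 f df ->
  is_derive x 1 (fun t => f (g t)) (df * dg).
Proof. by move=> gdg fdf; exact: is_derive1_comp. Qed.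

Lemma derR_inv (R : realType) (f : R -> R) (x df : R) :
  is_derive x 1 f df -> f x != 0 ->
  is_derive x 1 (fun t => (f t)^-1) (- (f x) ^- 2 * df).
Proof. by move=> fdf fx0; exact: is_deriveV. Qed.

Lemma is_derive_norm_le (R : realType) (f df g dg : R -> R) (a b : R) :
  (forall x, x \in `[a, b] -> is_derive x 1 f (df x)) ->
  (forall x, x \in `[a, b] -> is_derive x 1 g (dg x)) ->
  (forall x, x \in `[a, b] -> `|df x| <= dg x) -> a <= b ->
  `|f b - f a| <= g b - g a.
Proof.
move=> fdf gdg dfg ab; rewrite ler_norml; apply/andP; split.
  have H x : x \in `[a, b] -> 0 <= dg x + df x.
    by move=> /dfg; rewrite ler_norml => /andP[? _]; lra.
  have := is_derive_homo (fun x xab => derR_add (gdg x xab) (fdf x xab)) H ab.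
  by move=> ?; lra.
have H x : x \in `[a, b] -> 0 <= dg x - df x.
  by move=> /dfg; rewrite ler_norml => /andP[_ ?]; lra.
have := is_derive_homo (fun x xab => derR_sub (gdg x xab) (fdf x xab)) H ab.
by move=> ?; lra.
Qed.

Lemma is_derive_lip (R : realType) (f df : R -> R) (M a b : R) :
  (forall x, x \in `[a, b] -> is_derive x 1 f (df x)) ->
  (forall x, x \in `[a, b] -> `|df x| <= M) -> a <= b ->
  `|f b - f a| <= M * (b - a).
Proof.
move=> fdf dfM ab; rewrite mulrBr.
have gdg x : x \in `[a, b] -> is_derive x 1 ( *%R M) (M * 1).
  by move=> _; apply: derR_scale; exact: derR_id.
by apply: (is_derive_norm_le fdf gdg) ab => x /dfM; rewrite mulr1.
Qed.

(** The base point lies to the left of both [0] and [x], and the difference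
    does not depend on it; this gives one primitive on the whole line. *)
Definition primitive (R : realType) (f : R -> R) (x : R) : R :=
  let b := - (`|x| + 1) in
  parameterized_integral lebesgue_measure b x f -
  parameterized_integral lebesgue_measure b 0 f.

Section primitive.
Variables (R : realType) (f : R -> R).
Hypothesis cf : continuous f.

Let I (b x : R) : R := parameterized_integral (@lebesgue_measure R) b x f.

Let derI (b x : R) : b < x -> is_derive x 1 (I b) (f x).
Proof.
move=> bx.
have xx1 : x < x + 1 by rewrite ltrDl.
have fi : (@lebesgue_measure R).-integrable `[b, x + 1] (EFin \o f).
  by apply: continuous_compact_integrable;
    [exact: segment_compact | exact: continuous_subspaceT].
have [dI <-] := continuous_FTC1_closed xx1 fi bx (@cf x).
by rewrite derive1E; exact: derivableP.
Qed.

Let I_indep (b b' x : R) : b < x -> b < 0 -> b' < x -> b' < 0 ->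
  I b x - I b 0 = I b' x - I b' 0.
Proof.
move=> bx b0 b'x b'0.
have H y z : y <= z -> b < y -> b' < y -> (I b - I b') y = (I b - I b') z.
  move=> yz b_y b'y; apply: is_derive_cst_eq yz => t.
  rewrite in_itv/= => /andP[yt _].
  rewrite -(subrr (f t)).
  by apply: is_deriveB; apply: derI; apply: lt_le_trans yt.
have [x0|x0] := leP 0 x.
  by have := H _ _ x0 b0 b'0; rewrite !fctE; lra.
by have := H _ _ (ltW x0) bx b'x; rewrite !fctE; lra.
Qed.

Lemma primitive0 : primitive f 0 = 0.
Proof. by rewrite /primitive subrr. Qed.

Lemma is_derive_primitive (x : R) : is_derive x 1 (primitive f) (f x).
Proof.
pose b := - (`|x| + 2).
have bx : b < x by rewrite /b; have := ler_norm (- x); rewrite normrN; lra.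
have dE : is_derive x 1 (I b - cst (I b 0)) (f x).
  by rewrite -[f x]subr0; apply: is_deriveB; exact: derI.
apply: (near_eq_is_derive _ dE).
near=> y.
rewrite !fctE /primitive -/(I _ _) -/(I _ _).
have yx : `|y| < `|x| + 1.
  near: y.
  have : `|y| @[y --> x] --> `|x| by exact: (@norm_continuous _ R).
  by move=> /cvgr_lt; apply; rewrite ltrDl.
apply: I_indep.
- by rewrite /b; have := ler_norm (- y); rewrite normrN; lra.
- by rewrite /b; have := normr_ge0 x; lra.
- by have := ler_norm (- y); rewrite normrN; lra.
- by have := normr_ge0 y; lra.
Unshelve. all: by end_near. Qed.

End primitive.

Section continuity_rules.
Variables (R : realType) (f g : R -> R) (x : R).
Hypothesis (cf : {for x, continuous f}) (cg : {for x, continuous g}).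

Lemma ctsR_add : {for x, continuous (fun t => f t + g t)}.
Proof. exact: continuousD. Qed.

Lemma ctsR_opp : {for x, continuous (fun t => - f t)}.
Proof. exact: continuousN. Qed.

Lemma ctsR_mul : {for x, continuous (fun t => f t * g t)}.
Proof. exact: continuousM. Qed.

Lemma ctsR_inv : f x != 0 -> {for x, continuous (fun t => (f t)^-1)}.
Proof. by move=> fx0; exact: continuousV. Qed.

End continuity_rules.

Lemma ctsR_comp (R : realType) (f g : R -> R) (x : R) :
  {for x, continuous g} -> {for g x, continuous f} ->
  {for x, continuous (fun t => f (g t))}.
Proof. exact: continuous_comp. Qed.

Lemma ctsR_exp (R : realType) (n : nat) (f : R -> R) (x : R) :
  {for x, continuous f} -> {for x, continuous (fun t => f t ^+ n)}.
Proof.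
move=> cf.
exact: (@continuous_comp _ _ _ f (fun t => t ^+ n) x cf (@exprn_continuous R n _)).
Qed.
Arguments ctsR_exp {R} n {f x}.

(** * Velocity and momentum *)

Lemma continuous_lip (R : realType) (f : R -> R) (K x : R) :
  (forall y, `|f y - f x| <= K * `|y - x|) -> {for x, continuous f}.
Proof.
move=> fK; apply/cvgrPdist_lt => e e0.
near=> y; rewrite distrC; apply: le_lt_trans (fK y) _.
have K0 : 0 < `|K| + 1 by have := normr_ge0 K; lra.
have : `|y - x| < e / (`|K| + 1).
  rewrite distrC; near: y; apply: (@cvgr_dist_lt _ _ _ (nbhs x) _ id) => //.
  by rewrite divr_gt0.
rewrite ltr_pdivlMr // => yx.
apply: le_lt_trans yx; rewrite mulrC ler_wpM2l //.
by apply: (le_trans (ler_norm K)); rewrite lerDl.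
Unshelve. all: by end_near. Qed.

Definition clamp (R : realType) (a b x : R) : R := Num.max a (Num.min x b).

Section clamp.
Variables (R : realType) (a b : R).
Hypothesis ab : a <= b.

Lemma clamp_itv x : clamp a b x \in `[a, b].
Proof. by rewrite in_itv/= /clamp le_max lexx ge_max ge_min ab lexx orbT. Qed.

Lemma clamp_id x : x \in `[a, b] -> clamp a b x = x.
Proof. by rewrite in_itv/= /clamp => /andP[ax xb]; rewrite min_l ?max_r. Qed.

Lemma clamp_lip x y : `|clamp a b x - clamp a b y| <= `|x - y|.
Proof.
rewrite /clamp /Num.max /Num.min.
by do !case: ifPn; rewrite -?leNgt => *; rewrite ler_norml;
  have := ler_norm (x - y); have := ler_norm (- (x - y)); rewrite normrN;
  move=> *; apply/andP; split; lra.
Qed.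

Lemma continuous_clamp : continuous (clamp a b).
Proof.
by move=> x; apply: (@continuous_lip _ _ 1) => y; rewrite mul1r clamp_lip.
Qed.

Lemma continuous_comp_clamp (f : R -> R) :
  {within `[a, b], continuous f} -> continuous (fun x => f (clamp a b x)).
Proof.
move=> /subspace_continuousP cf x.
move=> B /(cf _ (clamp_itv x)) [e /= e0 HB].
change (nbhs x (fun y => B (f (clamp a b y)))).
near=> y; apply: (HB (clamp a b y)); last exact: clamp_itv.
near: y; apply: (@continuous_clamp x).
exact: (@nbhsx_ballx _ _ (clamp a b x) e e0).
Unshelve. all: by end_near. Qed.

End clamp.

(** The inverse of [phi]: the velocity as a function of the momentum. *)
Definition psi (R : realType) (s : R) : R := s / Num.sqrt (1 + s ^+ 2).

Section psi.
Variable R : realType.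
Implicit Types s t : R.

Lemma onesqr_gt0 s : 0 < 1 + s ^+ 2.
Proof. by have := sqr_ge0 s; lra. Qed.

Lemma psi_den_gt0 s : 0 < Num.sqrt (1 + s ^+ 2).
Proof. by rewrite sqrtr_gt0 onesqr_gt0. Qed.

Lemma psi_sqr s : psi s ^+ 2 = s ^+ 2 / (1 + s ^+ 2).
Proof. by rewrite /psi expr_div_n sqr_sqrtr // ltW ?onesqr_gt0. Qed.

Lemma psiN s : psi (- s) = - psi s.
Proof. by rewrite /psi sqrrN mulNr. Qed.

Lemma psi0 : psi 0 = 0 :> R.
Proof. by rewrite /psi mul0r. Qed.

Lemma psi_gt0 s : 0 < s -> 0 < psi s.
Proof. by move=> s0; rewrite /psi divr_gt0 ?psi_den_gt0. Qed.

Lemma psi_norm_lt1 s : `|psi s| < 1.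
Proof.
rewrite -(@ltr_pXn2r _ 2) ?nnegrE // expr1n.
rewrite real_normK ?num_real // psi_sqr ltr_pdivrMr ?onesqr_gt0 //; lra.
Qed.

Lemma phi_psi s : phi (psi s) = s.
Proof.
have s0 := psi_den_gt0 s.
rewrite /phi psi_sqr.
have -> : 1 - s ^+ 2 / (1 + s ^+ 2) = (1 + s ^+ 2)^-1.
  by field; rewrite gt_eqF ?onesqr_gt0.
by rewrite sqrtrV ?ltW ?onesqr_gt0 // invrK /psi divfK ?gt_eqF.
Qed.

Lemma is_derive_psi s :
  is_derive s 1 (@psi R) ((Num.sqrt (1 + s ^+ 2))^-1 ^+ 3).
Proof.
have d1 := derR_add (derR_cst s 1) (derR_mul (derR_id s) (derR_id s)).
have d2 := derR_comp d1 (is_derive1_sqrt (onesqr_gt0 s)).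
have s0 : Num.sqrt (1 + s ^+ 2) != 0 by rewrite gt_eqF ?psi_den_gt0.
have d3 := derR_mul (derR_id s) (derR_inv d2 s0).
apply: (is_derive_eq d3); rewrite -expr2 /=.
have : Num.sqrt (1 + s ^+ 2) ^+ 2 = 1 + s ^+ 2.
  by rewrite sqr_sqrtr // ltW ?onesqr_gt0.
move: (Num.sqrt _) s0 => D D0 DE.
have -> : D^-1 ^+ 3 = (D ^+ 2 - s ^+ 2) * D^-1 ^+ 3 by rewrite DE; ring.
by field.
Qed.

Lemma psi_den_ge1 s : 1 <= Num.sqrt (1 + s ^+ 2).
Proof. by rewrite -[leLHS]sqrtr1 ler_wsqrtr // lerDl sqr_ge0. Qed.

Lemma psi_lip s t : `|psi s - psi t| <= `|s - t|.
Proof.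
wlog ts : s t / t <= s.
  move=> H; have [/H//|/ltW/H] := leP t s.
  by rewrite [leLHS]distrC [leRHS]distrC.
rewrite [leRHS]ger0_norm ?subr_ge0 // -[leRHS]mul1r.
apply: (is_derive_lip (fun x _ => is_derive_psi x)) ts => x _.
rewrite ger0_norm ?exprn_ge0 ?invr_ge0 ?sqrtr_ge0 //.
rewrite exprn_ile1 ?invr_ge0 ?sqrtr_ge0 // invf_le1 ?psi_den_gt0 //.
exact: psi_den_ge1.
Qed.

Lemma psi_homo s t : s <= t -> psi s <= psi t.
Proof.
apply: (is_derive_homo (fun x _ => is_derive_psi x)) => x _.
by rewrite exprn_ge0 // invr_ge0 sqrtr_ge0.
Qed.

Lemma psi_ge_half s : 1 <= s -> 2^-1 <= psi s.
Proof.
move=> s1; apply: le_trans (psi_homo s1).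
have p1 : 0 < psi 1 :> R by exact: psi_gt0.
have h0 : 0 <= 2^-1 :> R by rewrite invr_ge0.
rewrite -(@ler_pXn2r _ 2) ?nnegrE ?(ltW p1) // psi_sqr expr1n exprVn.
by rewrite div1r lef_pV2 ?posrE //; lra.
Qed.

Lemma continuous_psi : continuous (@psi R).
Proof. by move=> x; apply: (@continuous_lip _ _ 1) => y; rewrite mul1r psi_lip. Qed.

End psi.

(** * The radial equation as a shooting problem *)

(** [w] is the momentum [r^n phi(u')] driven by the source [h]; outside
    [[0, rho]] everything is frozen so that [u] and [w] are C^1 on the line. *)
Record driven (R : realType) (n : nat) (rho : R) (a g h u w : R -> R) : Prop :=
  Driven {
    driven_w0 : w 0 = 0;
    driven_du : forall r : R, is_derive r 1 u
      (psi (w (clamp 0 rho r) / clamp 0 rho r ^+ n));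
    driven_dw : forall r : R, is_derive r 1 w
      (- (clamp 0 rho r ^+ n * a r * g (h (clamp 0 rho r)))) }.

Section driven.
Variables (R : realType) (n : nat) (rho : R) (a g : R -> R) (A K : R).
Hypothesis rho_gt0 : 0 < rho.
Hypothesis (aA : forall r, `|a r| <= A).
Hypothesis (gK : forall x y, `|g x - g y| <= K * `|x - y|).

Local Notation c := (clamp 0 rho).
Let rho_ge0 : 0 <= rho := ltW rho_gt0.

Let A_ge0 : 0 <= A.
Proof. exact: le_trans (aA 0). Qed.

Let K_ge0 : 0 <= K.
Proof.
have := gK 1 0; rewrite subr0 normr1 mulr1.
exact: le_trans (normr_ge0 _).
Qed.

Lemma driven_u_lip h u w x y : driven n rho a g h u w ->
  `|u x - u y| <= `|x - y|.
Proof.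
move=> [_ du _]; wlog yx : x y / y <= x.
  move=> H; have [/H//|/ltW/H] := leP y x.
  by rewrite [leLHS]distrC [leRHS]distrC.
rewrite [leRHS]ger0_norm ?subr_ge0 // -[leRHS]mul1r.
apply: (is_derive_lip (fun x _ => du x)) yx => z _.
exact/ltW/psi_norm_lt1.
Qed.

(** Each of the two integrations of an error [S e^(L t)] gains a factor
    [1 / L], so in this weighted norm the map from sources to trajectories
    contracts on the whole interval once [L] is large. *)
Lemma driven_contraction (L S : R) h1 h2 u1 u2 w1 w2 :
  0 < L -> A * K <= L ^+ 2 / 2 ->
  driven n rho a g h1 u1 w1 -> driven n rho a g h2 u2 w2 ->
  (forall r, r \in `[0, rho] -> `|h1 r - h2 r| <= S * expR (L * r)) ->
  forall r, r \in `[0, rho] ->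
    `|w1 r - w2 r| <= A * K * S / L * r ^+ n * expR (L * r) /\
    `|u1 r - u2 r| <= `|u1 0 - u2 0| + S / 2 * expR (L * r).
Proof.
move=> L0 AKL [w10 du1 dw1] [w20 du2 dw2] hS.
have dE (k t : R) : is_derive t 1 (fun r => k * expR (L * r)) (k * L * expR (L * t)).
  have d1 := derR_comp (derR_scale (derR_id t) L) (is_derive_expR (L * t)).
  apply: (is_derive_eq (derR_scale d1 k)); ring.
have S0 : 0 <= S.
  have := hS 0; rewrite in_itv/= lexx rho_ge0 mulr0 expR0 mulr1 => /(_ isT).
  exact: le_trans.
have AKS0 : 0 <= A * K * S / L by rewrite divr_ge0 ?mulr_ge0 // ltW.
have wle r : r \in `[0, rho] ->
    `|w1 r - w2 r| <= A * K * S / L * r ^+ n * expR (L * r).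
  rewrite in_itv/= => /andP[r0 rrho].
  have dw t (_ : t \in `[0, r]) := derR_sub (dw1 t) (dw2 t).
  have dG t (_ : t \in `[0, r]) := dE (A * K * S / L * r ^+ n) t.
  have /(_ _ r0) := is_derive_norm_le dw dG.
  rewrite w10 w20 !subr0 => H.
  apply: le_trans (H _) _; last first.
    by rewrite gerBl !mulr_ge0 ?expR_ge0 ?exprn_ge0 ?invr_ge0 // ltW.
  move=> t; rewrite in_itv/= => /andP[t0 tr].
  have tin : t \in `[0, rho] by rewrite in_itv/= t0 (le_trans tr).
  rewrite (clamp_id tin) opprK addrC -mulrBr normrM normrM.
  rewrite [X in X * _ * _]ger0_norm ?exprn_ge0 //.
  have -> : A * K * S / L * r ^+ n * L * expR (L * t) =
    r ^+ n * A * (K * (S * expR (L * t))) by field; rewrite gt_eqF.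
  apply: ler_pM => //; first by rewrite mulr_ge0 ?exprn_ge0.
    by apply: ler_pM; rewrite ?exprn_ge0 // lerXn2r ?nnegrE.
  apply: le_trans (gK _ _) _; apply: ler_wpM2l => //.
  rewrite distrC; exact: hS.
move=> r rin; split; first exact: wle.
move: rin; rewrite in_itv/= => /andP[r0 rrho].
have du t (_ : t \in `[0, r]) := derR_sub (du1 t) (du2 t).
have dG t (_ : t \in `[0, r]) := dE (A * K * S / L ^+ 2) t.
have /(_ _ r0) := is_derive_norm_le du dG.
have -> : u1 r - u2 r - (u1 0 - u2 0) = (u1 r - u2 r) - (u1 0 - u2 0) by [].
move=> H.
have {}H : `|u1 r - u2 r - (u1 0 - u2 0)| <= S / 2 * expR (L * r).
  apply: le_trans (H _) _; last first.
    rewrite mulr0 expR0 mulr1.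
    have k0 : 0 <= A * K * S / L ^+ 2.
      by rewrite !mulr_ge0 ?invr_ge0 ?exprn_ge0 // ltW.
    have kS : A * K * S / L ^+ 2 <= S / 2.
      rewrite ler_pdivrMr ?exprn_gt0 //.
      by have := ler_wpM2r S0 AKL; lra.
    by have := ler_wpM2r (expR_ge0 (L * r)) kS; lra.
  move=> t; rewrite in_itv/= => /andP[t0 tr].
  have tin : t \in `[0, rho] by rewrite in_itv/= t0 (le_trans tr).
  rewrite (clamp_id tin); apply: le_trans (psi_lip _ _) _.
  have -> : A * K * S / L ^+ 2 * L * expR (L * t) =
     A * K * S / L * expR (L * t) by field; rewrite gt_eqF.
  have := t0; rewrite le_eqVlt => /predU1P[<-|t_gt0].
    rewrite w10 w20 !mul0r subrr normr0 mulr0 expR0 mulr1.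
    by rewrite divr_ge0 ?mulr_ge0 // ltW.
  rewrite -mulrBl normrM normfV [X in _ / X]ger0_norm ?exprn_ge0 //.
  rewrite ler_pdivrMr ?exprn_gt0 // [leRHS]mulrAC; exact: wle.
have -> : u1 r - u2 r = (u1 0 - u2 0) + (u1 r - u2 r - (u1 0 - u2 0)) by ring.
by apply: le_trans (ler_normD _ _) _; rewrite lerD2l.
Qed.

End driven.

Section driven_existence.
Variables (R : realType) (n : nat) (rho : R) (a g : R -> R).
Hypothesis (n_gt0 : (0 < n)%N) (rho_gt0 : 0 < rho).

Local Notation c := (clamp 0 rho).
Let rho_ge0 : 0 <= rho := ltW rho_gt0.

Lemma driven_w_le (B : R) (h w : R -> R) :
  (forall r : R, is_derive r 1 w (- (c r ^+ n * a r * g (h (c r))))) ->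
  w 0 = 0 ->
  (forall r, r \in `[0, rho] -> `|a r * g (h r)| <= B) ->
  forall r, r \in `[0, rho] -> `|w r| <= r ^+ n * B * r.
Proof.
move=> dw w0 hB r; rewrite in_itv/= => /andP[r0 rrho].
have := is_derive_lip (fun t (_ : t \in `[0, r]) => dw t) _ r0.
rewrite w0 !subr0; apply => t; rewrite in_itv/= => /andP[t0 tr].
have tin : t \in `[0, rho] by rewrite in_itv/= t0 (le_trans tr).
rewrite (clamp_id tin) normrN -mulrA normrM.
rewrite [X in X * _]ger0_norm ?exprn_ge0 // ler_pM ?exprn_ge0 ?hB //.
by rewrite lerXn2r ?nnegrE.
Qed.

(** The centre is the only singular radius, and the momentum vanishes there to
    a higher order than [r^n]. *)
Lemma continuous_velocity (B : R) (w : R -> R) :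
  {in `[0, rho], continuous w} ->
  (forall r, r \in `[0, rho] -> `|w r| <= r ^+ n * B * r) ->
  continuous (fun r => w (c r) / c r ^+ n).
Proof.
move=> cw wB x.
have cin := clamp_itv rho_ge0 x.
have := cin; rewrite in_itv/= => /andP[]; rewrite le_eqVlt => /predU1P[cx0|cx0] _.
  apply: (@continuous_lip _ _ B) => y.
  have n0 : 0 ^+ n = 0 :> R by rewrite expr0n gtn_eqF.
  rewrite -cx0 n0 invr0 mulr0 subr0.
  have yin := clamp_itv rho_ge0 y; have yB := wB _ yin.
  have y0 : 0 <= c y by move: yin; rewrite in_itv/= => /andP[].
  have := clamp_lip 0 rho y x; rewrite -cx0 subr0 ger0_norm // => yx.
  have B0 : 0 <= B.
    have : rho \in `[0, rho] by rewrite in_itv/= rho_ge0 lexx.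
    move=> /wB/(le_trans (normr_ge0 _)).
    by rewrite pmulr_lge0 // pmulr_rge0 // exprn_gt0.
  have := y0; rewrite le_eqVlt => /predU1P[<-|y_gt0].
    by rewrite n0 invr0 mulr0 normr0 mulr_ge0.
  rewrite normrM normfV [X in _ / X]ger0_norm ?exprn_ge0 //.
  rewrite ler_pdivrMr ?exprn_gt0 //; apply: le_trans yB _.
  rewrite -mulrA mulrC; apply: ler_wpM2r; first exact: exprn_ge0.
  exact: ler_wpM2l.
have cc := @continuous_clamp R 0 rho x.
have cx0' : c x ^+ n != 0 by rewrite expf_neq0 // gt_eqF.
have c1 := ctsR_comp cc (cw _ cin).
exact (ctsR_mul c1 (ctsR_inv (ctsR_exp n cc) cx0')).
Qed.

Hypothesis (ca : continuous a) (cg : continuous g).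

Lemma driven_exists (d : R) (h : R -> R) : continuous h ->
  exists u w, driven n rho a g h u w /\ u 0 = d.
Proof.
move=> ch.
pose s (r : R) : R := - (c r ^+ n * a r * g (h (c r))).
have cc := @continuous_clamp R 0 rho.
have cs : continuous s.
  move=> x; have cgh := ctsR_comp (ctsR_comp (cc x) (ch _)) (@cg _).
  exact (ctsR_opp (ctsR_mul (ctsR_mul (ctsR_exp n (cc x)) (@ca x)) cgh)).
have dw := is_derive_primitive cs.
have w0 := primitive0 s.
have [t tin tmax] : exists2 t, t \in `[0, rho] &
    forall r, r \in `[0, rho] -> `|a r * g (h r)| <= `|a t * g (h t)|.
  apply: EVT_max => //; apply: continuous_subspaceT => x.
  have cn := @norm_continuous _ R (a x * g (h x)).
  exact: ctsR_comp (ctsR_mul (@ca x) (ctsR_comp (ch x) (@cg _))) cn.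
have wB := driven_w_le dw w0 tmax.
have cv : continuous (fun r => psi (primitive s (c r) / c r ^+ n)).
  have cw := in1W (fun z => is_derive_continuous (dw z)).
  have cv := continuous_velocity (cw _) wB.
  by move=> x; exact (ctsR_comp (cv x) (@continuous_psi R _)).
exists (fun r => d + primitive (fun r => psi (primitive s (c r) / c r ^+ n)) r).
exists (primitive s); split; last by rewrite primitive0 addr0.
split => // r.
by have := derR_add (derR_cst r d) (is_derive_primitive cv r); rewrite add0r.
Qed.

End driven_existence.

(** The intervals of centre [x m] and radius [2 C / 2 ^ m] are nested; the limit
    is the supremum of their left ends. *)
Lemma geometric_limit (R : realType) (x : R ^nat) (C : R) :
  (forall m, `|x m.+1 - x m| <= C / 2 ^+ m) ->
  exists l, forall m, `|x m - l| <= 2 * C / 2 ^+ m.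
Proof.
move=> xC.
have C0 : 0 <= C by have := le_trans (normr_ge0 _) (xC 0); rewrite expr0 divr1.
pose e m : R := 2 * C / 2 ^+ m.
have eS m : e m.+1 = C / 2 ^+ m.
  by rewrite /e exprS; field; rewrite expf_neq0.
have eSS m : e m = 2 * e m.+1 by rewrite eS /e; ring.
have step m k : x m - e m <= x (m + k)%N - e (m + k)%N /\
                x (m + k)%N + e (m + k)%N <= x m + e m.
  elim: k => [|k [IH1 IH2]]; first by rewrite addn0.
  have := xC (m + k)%N; rewrite addnS -eS ler_norml => /andP[? ?].
  by have := eSS (m + k)%N; split; lra.
have e0 m : 0 <= e m by rewrite /e !mulr_ge0 // invr_ge0 exprn_ge0.
pose E := [set x m - e m | m in [set: nat]].
have ub m : ubound E (x m + e m).
  move=> _ [k _ <-].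
  have [H1 _] := step k m; have [_ H2] := step m k.
  rewrite addnC in H1; have := e0 (m + k)%N; lra.
have supE : has_sup E by split; [exists (x 0%N - e 0%N), 0%N | exists (x 0%N + e 0%N)].
exists (sup E) => m; rewrite ler_norml; apply/andP; split.
  have : sup E <= x m + e m by apply: ge_sup => //; case: supE.
  by rewrite /e; lra.
have : x m - e m <= sup E by apply: ub_le_sup; [case: supE | exists m].
by rewrite /e; lra.
Qed.

Lemma geometric_le0 (R : realType) (x C : R) :
  (forall m, x <= C / 2 ^+ m) -> x <= 0.
Proof.
move=> xC; apply/ler_addgt0Pr => e e0; rewrite add0r.
have C0 : 0 < `|C| + 1 by have := normr_ge0 C; lra.
pose m := Num.truncn ((`|C| + 1) / e).
apply: le_trans (xC m) _; rewrite ler_pdivrMr ?exprn_gt0 //.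
have H : (`|C| + 1) / e < m.+1%:R by rewrite /m truncnS_gt.
have H2 : m.+1%:R <= 2 ^+ m :> R by rewrite -natrX ler_nat ltn_expl.
have := lt_le_trans H H2; rewrite ltr_pdivrMr // mulrC => H3.
by have := ler_norm C; lra.
Qed.

Definition shot (R : realType) (n : nat) (rho : R) (a g u w : R -> R) : Prop :=
  driven n rho a g u u w.

Section shooting.
Variables (R : realType) (n : nat) (rho : R) (a g : R -> R) (A K L : R).
Hypothesis (n_gt0 : (0 < n)%N) (rho_gt0 : 0 < rho).
Hypothesis (aA : forall r, `|a r| <= A).
Hypothesis (gK : forall x y, `|g x - g y| <= K * `|x - y|).
Hypothesis (L_gt0 : 0 < L) (AKL : A * K <= L ^+ 2 / 2).

Local Notation c := (clamp 0 rho).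
Let rho_ge0 : 0 <= rho := ltW rho_gt0.

(** Trajectories stay within [|d1 - d2| + 2 rho] of each other; every
    application of the contraction estimate halves the part of this bound that
    exceeds [2 |d1 - d2|]. *)
Lemma shot_lip u1 u2 w1 w2 :
  shot n rho a g u1 w1 -> shot n rho a g u2 w2 ->
  forall r, r \in `[0, rho] ->
    `|u1 r - u2 r| <= 2 * `|u1 0 - u2 0| * expR (L * r) /\
    `|w1 r - w2 r| <=
      A * K * (2 * `|u1 0 - u2 0|) / L * r ^+ n * expR (L * r).
Proof.
move=> s1 s2; pose D : R := `|u1 0 - u2 0|; rewrite -/D.
have D0 : 0 <= D by exact: normr_ge0.
have e1 r : r \in `[0, rho] -> 1 <= expR (L * r).
  rewrite in_itv/= => /andP[r0 _].
  by rewrite -[leLHS]expR0 ler_expR mulr_ge0 // ltW.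
pose S m : R := 2 * D + 2 * rho / 2 ^+ m.
have H m r : r \in `[0, rho] -> `|u1 r - u2 r| <= S m * expR (L * r).
  elim: m r => [|m IH] r rin.
    have r0 := rin; rewrite in_itv/= in r0; have {r0}/andP[r0 rrho] := r0.
    have H1 := driven_u_lip r 0 s1; have H2 := driven_u_lip r 0 s2.
    rewrite subr0 (ger0_norm r0) in H1; rewrite subr0 (ger0_norm r0) in H2.
    have -> : u1 r - u2 r = (u1 r - u1 0) + (u1 0 - u2 0) - (u2 r - u2 0).
      by ring.
    apply: le_trans (ler_normB _ _) _.
    apply: le_trans (lerD (ler_normD _ _) (lexx _)) _; rewrite -/D.
    have S0 : 0 <= S 0%N by rewrite /S expr0 divr1; lra.
    apply: le_trans (ler_peMr S0 (e1 _ rin)).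
    rewrite /S expr0 divr1; lra.
  have [_ ] := driven_contraction rho_gt0 aA gK L_gt0 AKL s1 s2 IH rin.
  move=> /le_trans; apply; rewrite -/D.
  have -> : S m.+1 * expR (L * r) = D * expR (L * r) + S m / 2 * expR (L * r).
    by rewrite /S exprS; field; rewrite expf_neq0.
  by rewrite lerD2r ler_peMr ?e1.
have HD r : r \in `[0, rho] -> `|u1 r - u2 r| <= 2 * D * expR (L * r).
  move=> rin; rewrite -subr_le0.
  apply: (@geometric_le0 _ _ (2 * rho * expR (L * r))) => m.
  have := H m r rin; rewrite /S; move: (2 ^+ m)^-1 => z ?; lra.
move=> r rin; split; first exact: HD.
by have [] := driven_contraction rho_gt0 aA gK L_gt0 AKL s1 s2 HD rin.
Qed.

(** Picard iteration.  All iterates are 1-Lipschitz because the speed is below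
    [1], hence so is their pointwise limit. *)
Lemma shot_exists (d : R) : continuous a ->
  exists u w, shot n rho a g u w /\ u 0 = d.
Proof.
move=> ca.
have cg : continuous g by move=> x; apply: (continuous_lip (gK^~ x)).
have /choice[T TP] : forall h : R -> R, exists u : R -> R, continuous h ->
    exists w, driven n rho a g h u w /\ u 0 = d.
  move=> h; have [ch|] := pselect (continuous h); last by exists h.
  have [u [w uw]] := driven_exists n_gt0 rho_gt0 ca cg d ch.
  by exists u => _; exists w.
pose x m := iter m T (fun=> d).
have cT h : continuous h -> continuous (T h).
  move=> /TP[w [dw _]] y; exact: is_derive_continuous (driven_du dw y).
have cx m : continuous (x m).
  by elim: m => [|m IH]; [move=> ?; exact: cst_continuous | exact: cT].
have e0 r : 0 < expR (L * r) by exact: expR_gt0.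
have xS m r : r \in `[0, rho] ->
    `|x m.+1 r - x m r| <= rho * expR (L * r) / 2 ^+ m.
  move=> rin; rewrite mulrAC; elim: m r rin => [|m IH] r rin.
    have r0 := rin; rewrite in_itv/= in r0; have {r0}/andP[r0 rrho] := r0.
    have [w [dw T0]] := TP _ (cx 0%N).
    rewrite -[X in _ - X]T0; apply: le_trans (driven_u_lip _ _ dw) _.
    rewrite subr0 (ger0_norm r0) expr0 divr1.
    apply: le_trans rrho _; rewrite ler_peMr //.
    by rewrite -[leLHS]expR0 ler_expR mulr_ge0 // ltW.
  have [w [dw T0]] := TP _ (cx m.+1); have [w' [dw' T0']] := TP _ (cx m).
  have [_] := driven_contraction rho_gt0 aA gK L_gt0 AKL dw dw' IH rin.
  rewrite T0 T0' subrr normr0 add0r => /le_trans; apply.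
  by rewrite exprS [2 * _]mulrC invfM mulrA.
have /choice[l lP] : forall r, exists l, r \in `[0, rho] -> forall m,
    `|x m r - l| <= 2 * (rho * expR (L * r)) / 2 ^+ m.
  move=> r; case rin : (r \in `[0, rho]); last by exists 0.
  by have [l lP] := geometric_limit (fun m => xS m r rin); exists l => _.
have x_lip m r s : `|x m r - x m s| <= `|r - s|.
  case: m => [|m]; first by rewrite subrr normr0.
  by have [w [dw _]] := TP _ (cx m); exact: driven_u_lip dw.
have l_lip r s : r \in `[0, rho] -> s \in `[0, rho] -> `|l r - l s| <= `|r - s|.
  move=> rin sin; rewrite -subr_le0.
  apply: (@geometric_le0 _ _
    (2 * (rho * expR (L * r)) + 2 * (rho * expR (L * s)))) => m.
  have := lP r rin m; have := lP s sin m; have := x_lip m r s.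
  rewrite lerBlDr => H1 H2 H3.
  have -> : l r - l s = (x m r - x m s) - (x m r - l r) + (x m s - l s).
    by ring.
  apply: le_trans (ler_normD _ _) _.
  apply: le_trans (lerD (ler_normB _ _) (lexx _)) _.
  lra.
have ch : continuous (fun r => l (c r)).
  move=> r; apply: (@continuous_lip _ _ 1) => s; rewrite mul1r.
  apply: le_trans (clamp_lip 0 rho s r).
  by apply: l_lip; exact: clamp_itv.
have [w [dw T0]] := TP _ ch.
exists (T (fun r => l (c r))), w; split => //.
set u := T _ in dw T0 *.
have ul r : r \in `[0, rho] -> u r = l r.
  move=> rin; apply/eqP; rewrite -subr_eq0 -normr_eq0 eq_le normr_ge0 andbT.
  apply: (@geometric_le0 _ _ (2 * (rho * expR (L * r)))) => m.
  have [w' [dw' T0']] := TP _ (cx m).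
  have lx s : s \in `[0, rho] ->
      `|l (c s) - x m s| <= 2 * rho / 2 ^+ m * expR (L * s).
    move=> sin; rewrite clamp_id // distrC; apply: le_trans (lP _ sin m) _.
    lra.
  have [_] := driven_contraction rho_gt0 aA gK L_gt0 AKL dw dw' lx rin.
  rewrite T0 T0' subrr normr0 add0r => H1.
  have := lP r rin m.+1; rewrite exprS invfM => H2.
  have -> : u r - l r = (u r - x m.+1 r) + (x m.+1 r - l r) by ring.
  apply: le_trans (ler_normD _ _) _.
  have xE : x m.+1 = T (x m) by [].
  by move: H1 H2; rewrite xE; move: (2 ^+ m)^-1 => z H1 H2; lra.
case: dw => w0 du dw; split => // r.
by rewrite ul ?clamp_itv // -[X in l X](clamp_id (clamp_itv rho_ge0 r)).
Qed.

End shooting.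

(** * The polar angle of a trajectory *)

Lemma is_derive_gt0_near (R : realType) (f : R -> R) (x d : R) :
  is_derive x 1 f d -> 0 < d ->
  exists2 e, 0 < e & forall y, `|y - x| < e -> y != x ->
    0 < (f y - f x) * (y - x).
Proof.
move=> /is_derive1_caratheodory[h [fE ch hx]] d0.
have : \forall y \near x, 0 < h y.
  by apply: (cvgr_gt _ ch); rewrite hx.
move=> /nbhs_ballP[e /= e0 he]; exists e => // y yx yNx.
have /he hy : ball x e y by rewrite /ball /= distrC.
rewrite fE -mulrA pmulr_rgt0 //.
by rewrite -expr2 exprn_even_gt0 //= subr_eq0.
Qed.

Lemma continuous_near_lt (R : realType) (f : R -> R) (x L : R) :
  {for x, continuous f} -> f x < L ->
  exists2 e, 0 < e & forall y, `|y - x| < e -> f y < L.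
Proof.
move=> cf fxL; have : \forall y \near x, f y < L by exact: (cvgr_lt _ cf).
move=> /nbhs_ballP[e /= e0 he]; exists e => // y yx.
by have /he : ball x e y by rewrite /ball /= distrC.
Qed.

Lemma continuous_near_gt (R : realType) (f : R -> R) (x L : R) :
  {for x, continuous f} -> L < f x ->
  exists2 e, 0 < e & forall y, `|y - x| < e -> L < f y.
Proof.
move=> cf fxL; have : \forall y \near x, L < f y by exact: (cvgr_gt _ cf).
move=> /nbhs_ballP[e /= e0 he]; exists e => // y yx.
by have /he : ball x e y by rewrite /ball /= distrC.
Qed.

(** Before a return to or below [L], consider the last point where [L <= f]:
    there [f = L], and the positive derivative makes [f] larger than [L] just
    after it. *)
Lemma upcrossing (R : realType) (f df : R -> R) (L a b : R) :
  (forall x, x \in `[a, b] -> is_derive x 1 f (df x)) ->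
  (forall x, x \in `[a, b] -> f x = L -> 0 < df x) ->
  L <= f a -> forall r, a < r -> r <= b -> L < f r.
Proof.
move=> fdf df0 La r ar rb; rewrite ltNge; apply/negP => frL.
have [r' [ar' r'b fr']] : exists r', [/\ a < r', r' <= b & f r' < L].
  move: frL; rewrite le_eqVlt => /predU1P[frL|frL]; last by exists r.
  have rin : r \in `[a, b] by rewrite in_itv/= (ltW ar) rb.
  have [e e0 he] := is_derive_gt0_near (fdf r rin) (df0 r rin frL).
  pose m := Num.min e (r - a); pose y := r - m / 2.
  have m0 : 0 < m by rewrite lt_min e0 subr_gt0 ar.
  have [me mra] : m <= e /\ m <= r - a by rewrite !ge_min !lexx orbT.
  have yr : y < r by rewrite /y; lra.
  have yre : `|y - r| < e by rewrite ltr0_norm ?subr_lt0 // /y; lra.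
  exists y; split; [by rewrite /y; lra | by rewrite (le_trans (ltW yr)) |].
  have := he y yre (negbT (lt_eqF yr)).
  by rewrite nmulr_lgt0 ?subr_lt0 // frL.
pose E := [set t | a <= t <= r' /\ L <= f t].
have Ea : E a by rewrite /E /= lexx (ltW ar').
have supE : has_sup E.
  by split; [exists a | exists r' => t [/andP[]]].
have [s sE] : exists s, s = sup E by exists (sup E).
have as_ : a <= s by rewrite sE; apply: ub_le_sup; [case: supE | ].
have sr' : s <= r' by rewrite sE; apply: ge_sup; [exists a | move=> t [/andP[]]].
have sin : s \in `[a, b] by rewrite in_itv/= as_ (le_trans sr').
have cs := is_derive_continuous (fdf s sin).
have Ls : L <= f s.
  rewrite leNgt; apply/negP => fsL.
  have [e e0 he] := continuous_near_lt cs fsL.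
  have [t [[/andP[at_ tr'] Lt] st]] := sup_adherent e0 supE.
  have ts : t <= s.
    by rewrite sE; apply: ub_le_sup; [case: supE | rewrite /E /= at_ tr'].
  have tse : `|t - s| < e.
    by rewrite -sE in st; rewrite ltr_norml; apply/andP; split; lra.
  by have := he t tse; rewrite ltNge Lt.
have s_lt : s < r'.
  rewrite lt_neqAle sr' andbT; apply/eqP => sr'E.
  by move: Ls; rewrite sr'E leNgt fr'.
have [y [sy yr' Ly]] : exists y, [/\ s < y, y <= r' & L <= f y].
  have [e e0 he] : exists2 e, 0 < e & forall y, s < y -> y < s + e -> L <= f y.
    move: Ls; rewrite le_eqVlt => /predU1P[Ls|Ls].
      have [e e0 he] := is_derive_gt0_near (fdf s sin) (df0 s sin (esym Ls)).
      exists e => // y sy ys.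
      have yse : `|y - s| < e by rewrite gtr0_norm ?subr_gt0 //; lra.
      have := he y yse (negbT (gt_eqF sy)).
      by rewrite pmulr_lgt0 ?subr_gt0 // -Ls => /ltW.
    have [e e0 he] := continuous_near_gt cs Ls.
    exists e => // y sy ys; apply/ltW/he.
    by rewrite gtr0_norm ?subr_gt0 //; lra.
  pose m := Num.min e (r' - s).
  have m0 : 0 < m by rewrite lt_min e0 subr_gt0 s_lt.
  have [me mra] : m <= e /\ m <= r' - s by rewrite !ge_min !lexx orbT.
  exists (s + m / 2); split; [lra|lra|apply: he; lra].
have : y <= s.
  rewrite sE; apply: ub_le_sup; first by case: supE.
  by rewrite /E /= yr' Ly (le_trans as_ (ltW sy)).
by rewrite leNgt sy.
Qed.

Section angle.
Variables (R : realType) (n : nat) (rho : R) (a g : R -> R) (A K : R).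
Hypothesis (n_gt0 : (0 < n)%N) (rho_gt0 : 0 < rho).
Hypothesis (aA : forall r, `|a r| <= A).
Hypothesis (gK : forall x y, `|g x - g y| <= K * `|x - y|) (g0 : g 0 = 0).

Local Notation c := (clamp 0 rho).
Let rho_ge0 : 0 <= rho := ltW rho_gt0.

Let A_ge0 : 0 <= A.
Proof. exact: le_trans (aA 0). Qed.

Let gK0 x : `|g x| <= K * `|x|.
Proof. by have := gK x 0; rewrite g0 !subr0. Qed.

Let K_ge0 : 0 <= K.
Proof. by have := gK0 1; rewrite normr1 mulr1; exact: le_trans (normr_ge0 _). Qed.

(** Away from the centre [u^2 + w^2] decays at most exponentially.  If it
    vanished at some radius it would vanish at all smaller positive ones, hence
    by continuity at the centre. *)
Lemma shot_neq0 u w : shot n rho a g u w -> u 0 != 0 ->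
  forall r, r \in `[0, rho] -> 0 < u r ^+ 2 + w r ^+ 2.
Proof.
move=> s u0 r rin; rewrite lt_neqAle addr_ge0 ?sqr_ge0 // andbT.
apply/eqP => /esym Pr0.
have := rin; rewrite in_itv/= => /andP[r_ge0 rrho].
have := r_ge0; rewrite le_eqVlt => /predU1P[r0|r_gt0].
  move: Pr0; rewrite -r0 (driven_w0 s) expr0n addr0 => /eqP.
  by rewrite sqrf_eq0 (negbTE u0).
have ue (e : R) : 0 < e -> e <= r -> u e = 0.
  move=> e_gt0 er.
  pose C : R := (e ^+ n)^-1 + rho ^+ n * A * K.
  have en : 0 < e ^+ n by rewrite exprn_gt0.
  have dP t (_ : t \in `[e, r]) :=
    let du := driven_du s t in let dw := driven_dw s t in
    derR_mul (derR_add (derR_mul du du) (derR_mul dw dw))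
      (derR_comp (derR_scale (derR_id t) C) (is_derive_expR (C * t))).
  have /(_ _ er) := is_derive_homo dP.
  rewrite -!expr2 Pr0 mul0r => H.
  have : u e ^+ 2 + w e ^+ 2 <= 0.
    rewrite -(pmulr_lle0 _ (expR_gt0 (C * e))); apply: H => t.
    rewrite in_itv/= => /andP[et tr].
    have t0 : 0 < t by exact: lt_le_trans et.
    have tin : t \in `[0, rho] by rewrite in_itv/= (ltW t0) (le_trans tr).
    rewrite (clamp_id tin).
    set U := u t; set W := w t; set E := expR (C * t).
    set p := psi _; set f := - _.
    have tn : 0 < t ^+ n by rewrite exprn_gt0.
    have pW : `|p| <= (e ^+ n)^-1 * `|W|.
      have := psi_lip (W / t ^+ n) 0; rewrite psi0 !subr0 => /le_trans; apply.
      rewrite normrM mulrC ler_wpM2r // normfV gtr0_norm // lef_pV2 ?posrE //.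
      by rewrite lerXn2r // nnegrE // ltW.
    have fU : `|f| <= rho ^+ n * A * K * `|U|.
      rewrite /f normrN normrM -[leRHS]mulrA.
      apply: (ler_pM _ _ _ (gK0 U)) => //.
      rewrite normrM; apply: (ler_pM _ _ _ (aA t)) => //.
      by rewrite (gtr0_norm tn) lerXn2r ?nnegrE ?(ltW t0) // (le_trans tr).
    have -> : (p * U + U * p + (f * W + W * f)) * E +
       (U * U + W * W) * (E * (C * 1)) =
       (2 * (U * p + W * f) + C * (U ^+ 2 + W ^+ 2)) * E by ring.
    rewrite mulr_ge0 ?expR_ge0 //.
    have C0 : 0 <= C.
      by rewrite /C addr_ge0 ?invr_ge0 ?(ltW en) // !mulr_ge0 // exprn_ge0.
    have H1 : `|U * p + W * f| <= C * (`|U| * `|W|).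
      apply: le_trans (ler_normD _ _) _; rewrite (normrM U) (normrM W) /C mulrDl.
      apply: lerD.
        rewrite [leRHS]mulrCA. exact: ler_wpM2l.
      by rewrite [leRHS]mulrA [leRHS]mulrC ler_wpM2l.
    have H2 : 2 * (`|U| * `|W|) <= U ^+ 2 + W ^+ 2.
      rewrite -(real_normK (num_real U)) -(real_normK (num_real W)).
      by have := sqr_ge0 (`|U| - `|W|); rewrite sqrrB => ?; lra.
    have H3 := ler_wpM2l C0 H2.
    by move: H1; rewrite ler_norml => /andP[H1 _]; lra.
  move=> H4; apply/eqP; rewrite -sqrf_eq0 eq_le sqr_ge0 andbT.
  by apply: le_trans H4; rewrite lerDl sqr_ge0.
move/negP: u0; apply; rewrite -normr_eq0 eq_le normr_ge0 andbT.
apply/ler_addgt0Pr => e e0; rewrite add0r.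
pose m := Num.min e r.
have m0 : 0 < m by rewrite lt_min e0.
have [me mr] : m <= e /\ m <= r by rewrite !ge_min !lexx orbT.
have := driven_u_lip 0 m s; rewrite (ue m) // !(subr0, sub0r) normrN.
by rewrite (gtr0_norm m0) => /le_trans; apply.
Qed.

(** This is [(w u' - u w') / (u^2 + w^2)], frozen outside [[0, rho]]. *)
Definition angle_rate (u w : R -> R) (r : R) : R :=
  (w (c r) * psi (w (c r) / c r ^+ n) +
   c r ^+ n * a r * g (u (c r)) * u (c r)) / (u (c r) ^+ 2 + w (c r) ^+ 2).

(** The polar angle of [(u, - w)], lifted continuously from [0] at the
    centre. *)
Definition angle (u w : R -> R) : R -> R := primitive (angle_rate u w).

Lemma shot_w_le u w : shot n rho a g u w ->
  forall r, r \in `[0, rho] ->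
  `|w r| <= r ^+ n * (A * (K * (`|u 0| + rho))) * r.
Proof.
move=> s; apply: (driven_w_le (h := u) (driven_dw s) (driven_w0 s)) => r rin.
rewrite normrM; apply: (ler_pM _ _ (aA r)) => //.
apply: le_trans (gK0 _) _; apply: ler_wpM2l => //.
have := driven_u_lip r 0 s; move: rin; rewrite in_itv/= => /andP[r0 rrho].
rewrite subr0 (ger0_norm r0) => H.
have -> : u r = u 0 + (u r - u 0) by ring.
by apply: le_trans (ler_normD _ _) _; rewrite lerD2l (le_trans H).
Qed.

Hypothesis ca : continuous a.

Section one_shot.
Variables (u w : R -> R).
Hypothesis (s : shot n rho a g u w) (u0 : u 0 != 0).

Local Notation theta := (angle u w).

Let P_gt0 := shot_neq0 s u0.

Lemma continuous_angle_rate : continuous (angle_rate u w).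
Proof.
have cg : continuous g by move=> x; apply: (continuous_lip (gK^~ x)).
have cc := @continuous_clamp R 0 rho.
have cu x := ctsR_comp (cc x) (is_derive_continuous (driven_du s _)).
have cw x := ctsR_comp (cc x) (is_derive_continuous (driven_dw s _)).
have cv := continuous_velocity n_gt0 rho_gt0
  (in1W (fun x => is_derive_continuous (driven_dw s x))) (shot_w_le s).
move=> x.
have cp := ctsR_comp (cv x) (@continuous_psi R _).
have cgu := ctsR_comp (cu x) (@cg _).
have cnum := ctsR_add (ctsR_mul (cw x) cp)
  (ctsR_mul (ctsR_mul (ctsR_mul (ctsR_exp n (cc x)) (@ca x)) cgu) (cu x)).
have cden := ctsR_add (ctsR_exp 2 (cu x)) (ctsR_exp 2 (cw x)).
apply: ctsR_mul cnum (ctsR_inv cden _).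
by rewrite gt_eqF // P_gt0 // clamp_itv.
Qed.

Lemma is_derive_angle (r : R) : is_derive r 1 theta (angle_rate u w r).
Proof. exact: is_derive_primitive continuous_angle_rate r. Qed.

Lemma angle0 : theta 0 = 0.
Proof. exact: primitive0. Qed.

(** The component of [(u, - w)] orthogonal to the direction [theta], squared and
    divided by [u^2 + w^2], has zero derivative, and it vanishes at the
    centre. *)
Lemma angle_orthogonal r : r \in `[0, rho] ->
  u r * sin (theta r) + w r * cos (theta r) = 0.
Proof.
rewrite in_itv/= => /andP[r0 rrho].
pose B t := u t * sin (theta t) + w t * cos (theta t).
pose P t := u t ^+ 2 + w t ^+ 2.
have P0 t : t \in `[0, r] -> P t != 0.
  rewrite in_itv/= => /andP[t0 tr].
  by rewrite gt_eqF // P_gt0 // in_itv/= t0 (le_trans tr).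
have dB t (tin : t \in `[0, r]) : is_derive t 1 (fun t => B t * B t * (P t)^-1) 0.
  have du := driven_du s t; have dw := driven_dw s t.
  have dth := is_derive_angle t.
  have ds := derR_comp dth (is_derive_sin _).
  have dc := derR_comp dth (is_derive_cos _).
  have dB := derR_add (derR_mul du ds) (derR_mul dw dc).
  have dP := derR_add (derR_mul du du) (derR_mul dw dw).
  have d := derR_mul (derR_mul dB dB) (derR_inv dP (P0 t tin)).
  apply: (is_derive_eq d).
  have {}tin : t \in `[0, rho].
    move: tin; rewrite !in_itv/= => /andP[t0 tr].
    by rewrite t0 (le_trans tr).
  have := P_gt0 tin; rewrite /angle_rate (clamp_id tin) !expr2.
  move: (u t) (w t) (psi _) (sin _) (cos _) (t ^+ n * a t * g _).
  move=> U W p si co f P_pos; field.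
  by rewrite gt_eqF.
have := is_derive_cst_eq dB r0.
rewrite [in LHS]/B angle0 sin0 cos0 (driven_w0 s) mulr0 mul0r addr0 !mul0r.
move=> /esym/eqP; rewrite mulf_eq0 invr_eq0 (negbTE (P0 r _)) ?orbF; last first.
  by rewrite in_itv/= r0 lexx.
by rewrite mulf_eq0 orbb => /eqP.
Qed.

Lemma shot_eq0P r : r \in `[0, rho] -> (u r == 0) = (cos (theta r) == 0).
Proof.
move=> rin; have P0 := P_gt0 rin; have H := angle_orthogonal rin.
have cs := cos2Dsin2 (theta r).
apply/eqP/eqP => E0.
  move/eqP: H; rewrite E0 mul0r add0r mulf_eq0 => /orP[/eqP w0|/eqP//].
  by move: P0; rewrite E0 w0 expr0n addr0 ltxx.
move/eqP: H; rewrite E0 mulr0 addr0 mulf_eq0 => /orP[/eqP//|/eqP s0].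
by move/eqP: cs; rewrite E0 s0 expr0n addr0 eq_sym oner_eq0.
Qed.

(** At a zero of [u] the rate is [psi (w / r^n) / w]. *)
Lemma angle_rate_gt0 r : r \in `[0, rho] -> u r = 0 -> 0 < angle_rate u w r.
Proof.
move=> rin ur0; have := P_gt0 rin.
have r_gt0 : 0 < r.
  move: (rin); rewrite in_itv/= lt_neqAle => /andP[-> _]; rewrite andbT.
  by apply/eqP => r0; move: ur0 u0; rewrite -r0 => ->; rewrite eqxx.
rewrite /angle_rate (clamp_id rin) ur0 expr0n add0r mulr0 addr0 => w2.
apply: divr_gt0 => //.
have w0 : w r != 0 by rewrite -sqrf_eq0 gt_eqF.
have rn : 0 < r ^+ n by rewrite exprn_gt0.
have [wp|wm|w00] := ltrgt0P (w r).
- by rewrite mulr_gt0 // psi_gt0 // divr_gt0.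
- rewrite nmulr_rgt0 // -oppr_gt0 -psiN psi_gt0 // -mulNr divr_gt0 //.
  by rewrite oppr_gt0.
- by rewrite w00 eqxx in w0.
Qed.

(** The component [u cos theta - w sin theta] of [(u, - w)] along the direction
    [theta] has the modulus as absolute value.  It never vanishes, so it keeps
    the sign of [u 0], while [cos theta] has become [- 1]. *)
Lemma shot_angle_pi r : r \in `[0, rho] -> theta r = pi -> u 0 * u r < 0.
Proof.
move=> rin thr; move: (rin); rewrite in_itv/= => /andP[r0 rrho].
pose M t := u t * cos (theta t) - w t * sin (theta t).
have M2 t : t \in `[0, rho] -> M t ^+ 2 = u t ^+ 2 + w t ^+ 2.
  move=> tin; have := angle_orthogonal tin; have := cos2Dsin2 (theta t).
  rewrite /M; move: (u t) (w t) (sin _) (cos _) => U W si co H1 H2.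
  have -> : (U * co - W * si) ^+ 2 =
    (U ^+ 2 + W ^+ 2) * (co ^+ 2 + si ^+ 2) - (U * si + W * co) ^+ 2 by ring.
  by rewrite H1 H2 expr0n subr0 mulr1.
have M0 : M 0 = u 0 by rewrite /M angle0 sin0 cos0 mulr0 subr0 mulr1.
have Mr : M r = - u r by rewrite /M thr sinpi cospi mulr0 subr0 mulrN1.
have -> : u r = - M r by rewrite Mr opprK.
rewrite -M0 mulrN oppr_lt0 ltNge; apply/negP => M0r.
have cM : {within `[0, r], continuous M}.
  apply: continuous_subspaceT => t.
  have cth := is_derive_continuous (is_derive_angle t).
  have cs := ctsR_comp cth (@continuous_sin R _).
  have cco := ctsR_comp cth (@continuous_cos R _).
  have cu := is_derive_continuous (driven_du s t).
  have cw := is_derive_continuous (driven_dw s t).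
  exact (ctsR_add (ctsR_mul cu cco) (ctsR_opp (ctsR_mul cw cs))).
have [|t tin Mt] := @IVT _ M 0 r 0 r0 cM.
  rewrite ge_min le_max; move: M0r.
  have [M0p|M0m|M0z] := ltrgt0P (M 0).
  - by rewrite pmulr_rle0 // => ->; rewrite orbT.
  - by rewrite nmulr_rle0 // => ->; rewrite orbT.
  - by move: u0; rewrite -M0 M0z eqxx.
have tin' : t \in `[0, rho].
  by move: tin; rewrite !in_itv/= => /andP[-> /le_trans->].
by have := P_gt0 tin'; rewrite -M2 // Mt expr0n ltxx.
Qed.

End one_shot.
End angle.

Lemma normM_diff (R : realType) (x1 x2 y1 y2 X Y dx dy : R) :
  `|x2| <= X -> `|y1| <= Y -> `|x1 - x2| <= dx -> `|y1 - y2| <= dy ->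
  `|x1 * y1 - x2 * y2| <= X * dy + Y * dx.
Proof.
move=> hX hY hdx hdy.
have -> : x1 * y1 - x2 * y2 = x2 * (y1 - y2) + y1 * (x1 - x2) by ring.
apply: le_trans (ler_normD _ _) _; rewrite !normrM.
by apply: lerD; apply: ler_pM.
Qed.

Section angle_dependence.
Variables (R : realType) (n : nat) (rho : R) (a g : R -> R) (A K : R).
Hypothesis (n_gt0 : (0 < n)%N) (rho_gt0 : 0 < rho).
Hypothesis (aA : forall r, `|a r| <= A).
Hypothesis (gK : forall x y, `|g x - g y| <= K * `|x - y|) (g0 : g 0 = 0).
Hypothesis ca : continuous a.

Local Notation c := (clamp 0 rho).
Local Notation theta := (angle n rho a g).
Let rho_ge0 : 0 <= rho := ltW rho_gt0.

Let A_ge0 : 0 <= A.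
Proof. exact: le_trans (aA 0). Qed.

Let gK0 x : `|g x| <= K * `|x|.
Proof. by have := gK x 0; rewrite g0 !subr0. Qed.

Let K_ge0 : 0 <= K.
Proof. by have := gK0 1; rewrite normr1 mulr1; exact: le_trans (normr_ge0 _). Qed.

(** The angular velocity is a quotient of expressions that are Lipschitz in the
    height, and its denominator [u1^2 + w1^2] has a positive minimum.  The
    constants below bound ([C]) each factor and its variation ([D]). *)
Lemma angle_lip u1 w1 : shot n rho a g u1 w1 -> u1 0 != 0 ->
  exists eta C : R, 0 < eta /\ forall u2 w2, shot n rho a g u2 w2 ->
    u2 0 != 0 -> `|u2 0 - u1 0| <= eta ->
    `|theta u2 w2 rho - theta u1 w1 rho| <= C * `|u2 0 - u1 0|.
Proof.
move=> s1 u10.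
pose L : R := 2 * (A * K) + 1.
have AK0 : 0 <= A * K by exact: mulr_ge0.
have L0 : 0 < L by rewrite /L; lra.
have AKL : A * K <= L ^+ 2 / 2.
  by rewrite /L; move: (A * K) AK0 => x x0; have := mulr_ge0 x0 x0; lra.
pose E : R := expR (L * rho).
have E0 : 0 <= E by exact: expR_ge0.
have rn0 : 0 <= rho ^+ n by rewrite exprn_ge0.
pose Cu : R := `|u1 0| + 1 + rho.
have Cu0 : 0 <= Cu by rewrite /Cu !addr_ge0.
pose Cg : R := K * Cu; have Cg0 : 0 <= Cg by exact: mulr_ge0.
pose Cw : R := rho ^+ n * (A * Cg) * rho.
have Cw0 : 0 <= Cw by rewrite !mulr_ge0.
pose Ca : R := rho ^+ n * A; have Ca0 : 0 <= Ca by exact: mulr_ge0.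
pose Du : R := 2 * E; have Du0 : 0 <= Du by exact: mulr_ge0.
pose Dv : R := A * K * 2 / L * E.
have Dv0 : 0 <= Dv by rewrite !mulr_ge0 // invr_ge0 ltW.
pose Dw : R := rho ^+ n * Dv; have Dw0 : 0 <= Dw by exact: mulr_ge0.
pose Dg : R := K * Du; have Dg0 : 0 <= Dg by exact: mulr_ge0.
pose P1 r := u1 r ^+ 2 + w1 r ^+ 2.
have [t tin tmin] : exists2 t, t \in `[0, rho] &
    forall r, r \in `[0, rho] -> P1 t <= P1 r.
  apply: EVT_min => //; apply: continuous_subspaceT => x.
  have cu := is_derive_continuous (driven_du s1 x).
  have cw := is_derive_continuous (driven_dw s1 x).
  exact (ctsR_add (ctsR_exp 2 cu) (ctsR_exp 2 cw)).
pose m : R := P1 t.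
have m0 : 0 < m by exact: (shot_neq0 rho_gt0 aA gK g0 s1).
pose CN : R := Cw * Dv + Dw + Ca * (Cg * Du + Cu * Dg).
have CN0 : 0 <= CN by rewrite /CN; do ![assumption|apply: addr_ge0|apply: mulr_ge0].
pose MN : R := Cw + Ca * (Cg * Cu).
have MN0 : 0 <= MN by rewrite /MN; do ![assumption|apply: addr_ge0|apply: mulr_ge0].
pose CP : R := (Cu * Du + Cu * Du) + (Cw * Dw + Cw * Dw).
have CP0 : 0 <= CP by rewrite /CP; do ![assumption|apply: addr_ge0|apply: mulr_ge0].
pose MP : R := Cu ^+ 2 + Cw ^+ 2.
have MP0 : 0 <= MP by rewrite /MP addr_ge0 // exprn_ge0.
pose eta : R := Num.min 1 (m / 2 / (CP + 1)).
exists eta, ((MN * CP + MP * CN) / (m * (m / 2)) * rho); split.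
  by rewrite lt_min ltr01 /= !divr_gt0 // ltr_wpDl.
move=> u2 w2 s2 u20 d_eta; pose D : R := `|u2 0 - u1 0|; rewrite -/D.
have D0 : 0 <= D by exact: normr_ge0.
have D1 : D <= 1 by apply: le_trans d_eta _; rewrite ge_min lexx.
have CPD : CP * D <= m / 2.
  have : D <= m / 2 / (CP + 1) by apply: le_trans d_eta _; rewrite ge_min lexx orbT.
  by rewrite ler_pdivlMr ?ltr_wpDl // => ?; lra.
have rate_le r : r \in `[0, rho] ->
    `|angle_rate n rho a g u2 w2 r - angle_rate n rho a g u1 w1 r| <=
    (MN * CP + MP * CN) / (m * (m / 2)) * D.
  move=> rin; have := rin; rewrite in_itv/= => /andP[r0 rrho].
  rewrite /angle_rate (clamp_id rin).
  have rnr : r ^+ n <= rho ^+ n by rewrite lerXn2r ?nnegrE.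
  have Er : expR (L * r) <= E by rewrite ler_expR ler_wpM2l // ltW.
  have [hu hw] := shot_lip rho_gt0 aA gK L0 AKL s2 s1 rin.
  rewrite -/D in hu hw.
  have uD : `|u2 r - u1 r| <= Du * D.
    apply: le_trans hu _; rewrite /Du -mulrA [D * _]mulrC mulrA.
    by rewrite ler_wpM2r // ler_wpM2l.
  have k0 : 0 <= A * K * (2 * D) / L by rewrite !mulr_ge0 // invr_ge0 ltW.
  have DvE : A * K * (2 * D) / L * E = Dv * D by rewrite /Dv; ring.
  have wDr : `|w2 r - w1 r| <= r ^+ n * (Dv * D).
    apply: le_trans hw _; rewrite -DvE [_ * r ^+ n]mulrC -[leLHS]mulrA.
    by apply: ler_wpM2l; [exact: exprn_ge0 | exact: ler_wpM2l].
  have wD : `|w2 r - w1 r| <= Dw * D.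
    by apply: le_trans wDr _; rewrite /Dw -mulrA ler_wpM2r // mulr_ge0.
  have pD : `|psi (w2 r / r ^+ n) - psi (w1 r / r ^+ n)| <= Dv * D.
    apply: le_trans (psi_lip _ _) _.
    have := r0; rewrite le_eqVlt => /predU1P[r00|r_gt0].
      rewrite -r00 (driven_w0 s1) (driven_w0 s2) !mul0r subrr normr0.
      exact: mulr_ge0.
    have rn : 0 < r ^+ n by rewrite exprn_gt0.
    by rewrite -mulrBl normrM normfV (gtr0_norm rn) ler_pdivrMr // mulrC.
  have ub u w : shot n rho a g u w -> `|u 0| <= `|u1 0| + 1 -> `|u r| <= Cu.
    move=> s u0; have := driven_u_lip r 0 s; rewrite subr0 (ger0_norm r0) => H.
    have -> : u r = u 0 + (u r - u 0) by ring.
    apply: le_trans (ler_normD _ _) _; rewrite /Cu; lra.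
  have wb u w : shot n rho a g u w -> `|u 0| <= `|u1 0| + 1 -> `|w r| <= Cw.
    move=> s u0; have := shot_w_le aA gK g0 s rin => /le_trans; apply.
    rewrite /Cw; apply: ler_pM => //.
      by rewrite !mulr_ge0 ?exprn_ge0 ?addr_ge0.
    apply: ler_pM => //; rewrite ?exprn_ge0 ?mulr_ge0 ?addr_ge0 //.
    by rewrite ler_wpM2l // /Cg ler_wpM2l // /Cu lerD2r.
  have u10_le : `|u1 0| <= `|u1 0| + 1 by rewrite lerDl.
  have u20_le : `|u2 0| <= `|u1 0| + 1.
    have -> : u2 0 = u1 0 + (u2 0 - u1 0) by ring.
    by apply: le_trans (ler_normD _ _) _; rewrite lerD2l.
  have u1b := ub _ _ s1 u10_le; have u2b := ub _ _ s2 u20_le.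
  have w1b := wb _ _ s1 u10_le; have w2b := wb _ _ s2 u20_le.
  have gb x : `|x| <= Cu -> `|g x| <= Cg.
    by move=> xC; apply: le_trans (gK0 _) _; rewrite ler_wpM2l.
  have gD : `|g (u2 r) - g (u1 r)| <= Dg * D.
    by apply: le_trans (gK _ _) _; rewrite /Dg -mulrA ler_wpM2l.
  have ab : `|r ^+ n * a r| <= Ca.
    by rewrite normrM ger0_norm ?exprn_ge0 // ler_pM ?exprn_ge0.
  have psi1 x : `|psi x| <= (1 : R) by exact/ltW/psi_norm_lt1.
  have H1 := normM_diff w1b (psi1 (w2 r / r ^+ n)) wD pD.
  have H2 := normM_diff (gb _ u1b) u2b gD uD.
  have PD := normM_diff u1b u2b uD uD.
  have PD' := normM_diff w1b w2b wD wD.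
  have Pm := tmin r rin; rewrite -/m /P1 in Pm.
  have PM : u1 r ^+ 2 + w1 r ^+ 2 <= MP.
    rewrite -(real_normK (num_real (u1 r))) -(real_normK (num_real (w1 r))).
    by rewrite lerD // lerXn2r ?nnegrE.
  have N1b : `|w1 r * psi (w1 r / r ^+ n) + r ^+ n * a r * g (u1 r) * u1 r| <= MN.
    apply: le_trans (ler_normD _ _) _; apply: lerD.
      by rewrite normrM -[leRHS]mulr1 ler_pM.
    rewrite -[_ * g _ * _]mulrA normrM; apply: ler_pM => //.
    by rewrite normrM ler_pM // gb.
  have ND : `|(w2 r * psi (w2 r / r ^+ n) + r ^+ n * a r * g (u2 r) * u2 r) -
      (w1 r * psi (w1 r / r ^+ n) + r ^+ n * a r * g (u1 r) * u1 r)| <= CN * D.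
    move: H1 H2 ab; move: (w1 r * _) (w2 r * _) (r ^+ n * a r) => x1 x2 b H1 H2 ab.
    have -> : x2 + b * g (u2 r) * u2 r - (x1 + b * g (u1 r) * u1 r) =
      (x2 - x1) + b * (g (u2 r) * u2 r - g (u1 r) * u1 r) by ring.
    apply: le_trans (ler_normD _ _) _; rewrite normrM.
    have := ler_pM (normr_ge0 _) (normr_ge0 _) ab H2.
    by rewrite /CN; lra.
  have PDb : `|(u2 r ^+ 2 + w2 r ^+ 2) - (u1 r ^+ 2 + w1 r ^+ 2)| <= CP * D.
    have -> : u2 r ^+ 2 + w2 r ^+ 2 - (u1 r ^+ 2 + w1 r ^+ 2) =
      (u2 r * u2 r - u1 r * u1 r) + (w2 r * w2 r - w1 r * w1 r) by ring.
    apply: le_trans (ler_normD _ _) _; rewrite /CP; lra.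
  move: N1b ND PDb Pm PM.
  move: (_ + _ * g (u1 r) * _) (_ + _ * g (u2 r) * _).
  move: (u1 r ^+ 2 + _) (u2 r ^+ 2 + _) => p1 p2 N1 N2 N1b ND PDb Pm PM.
  have p2m : m / 2 <= p2.
    by move: PDb; rewrite ler_norml => /andP[? _]; lra.
  have p1_gt0 : 0 < p1 by exact: lt_le_trans Pm.
  have p2_gt0 : 0 < p2 by apply: lt_le_trans p2m; rewrite divr_gt0.
  have -> : N2 / p2 - N1 / p1 = (p1 * (N2 - N1) - N1 * (p2 - p1)) / (p1 * p2).
    by field; rewrite !gt_eqF.
  rewrite normrM normfV (gtr0_norm (mulr_gt0 p1_gt0 p2_gt0)).
  have -> : (MN * CP + MP * CN) / (m * (m / 2)) * D =
    (MN * (CP * D) + MP * (CN * D)) / (m * (m / 2)) by ring.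
  apply: ler_pM => //.
  - by rewrite invr_ge0 mulr_ge0 // ltW.
  - apply: le_trans (ler_normB _ _) _; rewrite !normrM (gtr0_norm p1_gt0) addrC.
    by apply: lerD; apply: ler_pM => //; exact: ltW.
  - rewrite lef_pV2 ?posrE ?mulr_gt0 ?divr_gt0 //.
    by apply: ler_pM => //; [exact: ltW | rewrite divr_ge0 // ltW].
have d1 r := is_derive_angle n_gt0 rho_gt0 aA gK g0 ca s1 u10 r.
have d2 r := is_derive_angle n_gt0 rho_gt0 aA gK g0 ca s2 u20 r.
have := is_derive_lip (fun r (_ : r \in `[0, rho]) => derR_sub (d2 r) (d1 r))
  rate_le rho_ge0.
by rewrite !angle0 subrr !subr0 => /le_trans; apply; rewrite mulrAC.
Qed.

End angle_dependence.

(** The zeros of [cos] from [- pi / 2] on, in increasing order. *)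
Definition cos_zero (R : realType) (m : nat) : R := m%:R * pi - pi / 2.

Section cos_zero.
Variable R : realType.

Lemma cos_zeroS m : cos_zero R m.+1 = cos_zero R m + pi.
Proof. by rewrite /cos_zero -natr1; ring. Qed.

Lemma cosDpi (x : R) : cos (x + pi) = - cos x.
Proof. by rewrite cosD cospi sinpi mulr0 subr0 mulrN1. Qed.

Lemma cos_cos_zero m : cos (cos_zero R m) = 0.
Proof.
elim: m => [|m IH]; last by rewrite cos_zeroS cosDpi IH oppr0.
by rewrite /cos_zero mul0r sub0r cosN cos_pihalf.
Qed.

Lemma cos_zero_le m m' : (m <= m')%N -> cos_zero R m <= cos_zero R m'.
Proof. by move=> mm'; rewrite /cos_zero lerD2r ler_wpM2r ?pi_ge0 // ler_nat. Qed.

Lemma cos_neq0_between m (x : R) :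
  cos_zero R m < x < cos_zero R m.+1 -> cos x != 0.
Proof.
elim: m x => [|m IH] x.
  move=> xI; rewrite gt_eqF // cos_gt0_pihalf //.
  by move: xI; rewrite /cos_zero mul0r sub0r mul1r => /andP[-> ?]; lra.
rewrite !cos_zeroS => xI.
have -> : x = x - pi + pi by ring.
rewrite cosDpi oppr_eq0; apply: IH; rewrite cos_zeroS.
by case/andP: xI => ? ?; apply/andP; split; lra.
Qed.

Lemma between_cos_zero (x : R) : cos_zero R 0 < x -> cos x != 0 ->
  exists m, cos_zero R m < x < cos_zero R m.+1.
Proof.
rewrite /cos_zero mul0r sub0r => x0 cx.
have y0 : 0 <= (x + pi / 2) / pi by rewrite divr_ge0 ?pi_ge0 //; lra.
have := truncn_itv y0; set m := Num.truncn _ => /andP[my ym].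
exists m; rewrite -/(cos_zero R m.+1).
move: my ym; rewrite ler_pdivlMr ?pi_gt0 // ltr_pdivrMr ?pi_gt0 // => my ym.
apply/andP; split; last by rewrite /cos_zero; lra.
rewrite lt_neqAle; apply/andP; split; last lra.
by apply: contraNneq cx => <-; rewrite cos_cos_zero.
Qed.

End cos_zero.

Section angle_levels.
Variables (R : realType) (n : nat) (rho : R) (a g : R -> R) (A K : R).
Hypothesis (n_gt0 : (0 < n)%N) (rho_gt0 : 0 < rho).
Hypothesis (aA : forall r, `|a r| <= A).
Hypothesis (gK : forall x y, `|g x - g y| <= K * `|x - y|) (g0 : g 0 = 0).
Hypothesis ca : continuous a.
Variables (u w : R -> R).
Hypothesis (s : shot n rho a g u w) (u0 : u 0 != 0).

Local Notation theta := (angle n rho a g u w).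
Let rho_ge0 : 0 <= rho := ltW rho_gt0.
Let dtheta := is_derive_angle n_gt0 rho_gt0 aA gK g0 ca s u0.
Let eq0P := shot_eq0P n_gt0 rho_gt0 aA gK g0 ca s u0.

Lemma continuous_angle : continuous theta.
Proof. by move=> r; exact: is_derive_continuous (dtheta r). Qed.

Lemma angle_upcrossing m r r' : 0 <= r -> r < r' -> r' <= rho ->
  cos_zero R m <= theta r -> cos_zero R m < theta r'.
Proof.
move=> r0 rr' r'rho mr.
have sub x : x \in `[r, rho] -> x \in `[0, rho].
  by rewrite !in_itv/= => /andP[rx ->]; rewrite (le_trans r0).
apply: (upcrossing (fun x _ => dtheta x) _ mr rr' r'rho) => x /sub xin xm.
apply: (angle_rate_gt0 rho_gt0 aA gK g0 s u0 xin).
by apply/eqP; rewrite eq0P // xm cos_cos_zero.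
Qed.

Lemma angle_gt_level0 r : r \in `[0, rho] -> cos_zero R 0 < theta r.
Proof.
have H : cos_zero R 0 < theta 0.
  by rewrite angle0 /cos_zero mul0r sub0r oppr_lt0 divr_gt0 // pi_gt0.
rewrite in_itv/= le_eqVlt => /andP[/predU1P[<-//|r0 rrho]].
exact: angle_upcrossing r0 rrho (ltW H).
Qed.

Lemma angle_IVT (L x y : R) : x <= y -> theta x <= L -> L <= theta y ->
  exists2 z, z \in `[x, y] & theta z = L.
Proof.
move=> xy xL Ly; apply: IVT => //.
  by apply: continuous_subspaceT; exact: continuous_angle.
by rewrite ge_min le_max xL Ly orbT.
Qed.

(** Each sign change of [u] pushes the angle through one more zero of
    [cos]. *)
Lemma angle_alternating (x : nat -> R) N :
  (forall i, (i <= N)%N -> x i \in `[0, rho]) ->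
  (forall i, (i < N)%N -> x i < x i.+1) ->
  (forall i, (i < N)%N -> u (x i) * u (x i.+1) < 0) ->
  cos_zero R N < theta (x N).
Proof.
elim: N => [|N IH] xin xS xalt; first by apply: angle_gt_level0; exact: xin.
have lo : cos_zero R N < theta (x N).
  apply: IH => i iN; [apply: xin|apply: xS|apply: xalt]; exact: ltnW.
have := xin N (leqnSn N); rewrite in_itv/= => /andP[xN0 _].
have := xin N.+1 (leqnn _); rewrite in_itv/= => /andP[_ xSrho].
have xx := xS N (ltnSn N); have uu := xalt N (ltnSn N).
have cu : {within `[x N, x N.+1], continuous u}.
  apply: continuous_subspaceT => z.
  exact: is_derive_continuous (driven_du s z).
have [|z zin uz] := @IVT _ u _ _ 0 (ltW xx) cu.
  rewrite ge_min le_max; move: uu.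
  have [up|um|uz] := ltrgt0P (u (x N)).
  - by rewrite pmulr_rlt0 // => /ltW ->; rewrite orbT.
  - by rewrite nmulr_rlt0 // => /ltW ->; rewrite orbT.
  - by rewrite uz mul0r ltxx.
have uN0 i : (i == N) || (i == N.+1) -> u (x i) != 0.
  by move=> /orP[]/eqP->; apply/eqP => ui; move: uu; rewrite ui ?mul0r ?mulr0 ltxx.
have zN : x N < z.
  move: zin; rewrite in_itv/= lt_neqAle => /andP[-> _]; rewrite andbT.
  by apply: contraNneq (uN0 N _) => [->|]; rewrite ?uz ?eqxx.
have zS : z < x N.+1.
  move: zin; rewrite in_itv/= [_ < _]lt_neqAle => /andP[_ ->]; rewrite andbT.
  by apply: contraNneq (uN0 N.+1 _) => [<-|]; rewrite ?uz ?eqxx ?orbT.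
have z_rho : z <= rho by exact: le_trans (ltW zS) xSrho.
have zin' : z \in `[0, rho] by rewrite in_itv/= (le_trans xN0 (ltW zN)).
have cz : cos (theta z) = 0 by apply/eqP; rewrite -eq0P // uz.
have z_lo : cos_zero R N < theta z by exact: angle_upcrossing xN0 zN z_rho (ltW lo).
have z_hi : cos_zero R N.+1 <= theta z.
  rewrite leNgt; apply/negP => z_hi.
  by have := @cos_neq0_between _ N (theta z); rewrite z_lo z_hi cz eqxx => /(_ isT).
exact: angle_upcrossing (le_trans xN0 (ltW zN)) zS xSrho z_hi.
Qed.

(** Reaching [pi / 2] would produce a zero of [u]. *)
Lemma angle_small : (forall r, r \in `[0, rho] -> u r != 0) ->
  theta rho < cos_zero R 1.
Proof.
move=> uN0; rewrite ltNge; apply/negP => H.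
have H0 : theta 0 <= cos_zero R 1.
  by rewrite angle0 /cos_zero mul1r; have := pi_gt0 R; lra.
have [z zin zE] := angle_IVT rho_ge0 H0 H.
by have := uN0 z zin; rewrite eq0P // zE cos_cos_zero eqxx.
Qed.

End angle_levels.

(** * Many turns where the weight is positive *)

Lemma is_derive_upper (R : realType) (f df : R -> R) (M a b : R) :
  (forall x, x \in `[a, b] -> is_derive x 1 f (df x)) ->
  (forall x, x \in `[a, b] -> df x <= M) -> a <= b ->
  f b <= f a + M * (b - a).
Proof.
move=> fdf dfM ab.
have fdo x : x \in `]a, b[ -> is_derive x 1 f (df x).
  by move=> xab; apply: fdf; exact: subset_itv_oo_cc xab.
have [z zab fE] := MVT_segment ab fdo (is_derive_within fdf).
by rewrite -lerBlDl fE ler_wpM2r ?subr_ge0 ?dfM.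
Qed.

Lemma is_derive_lower (R : realType) (f df : R -> R) (M a b : R) :
  (forall x, x \in `[a, b] -> is_derive x 1 f (df x)) ->
  (forall x, x \in `[a, b] -> M <= df x) -> a <= b ->
  f a + M * (b - a) <= f b.
Proof.
move=> fdf dfM ab.
have H x : x \in `[a, b] -> - df x <= - M by move=> /dfM; rewrite lerN2.
have := is_derive_upper (fun x xab => derR_opp (fdf x xab)) H ab; lra.
Qed.

Lemma first_zero (R : realType) (f : R -> R) (a b : R) :
  (forall x, x \in `[a, b] -> {for x, continuous f}) -> 0 < f a -> f b <= 0 ->
  a <= b ->
  exists t, [/\ a < t, t <= b, f t = 0 & forall x, a <= x -> x < t -> 0 < f x].
Proof.
move=> cf fa fb ab.
pose E := [set x | a <= x <= b /\ f x <= 0].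
have infE : has_inf E.
  split; first by exists b; rewrite /E /= ab lexx fb.
  by exists a => x [/andP[]].
have [t tE] : exists t, t = inf E by exists (inf E).
have at_ : a <= t.
  by rewrite tE; apply: lb_le_inf; [case: infE | move=> x [/andP[]]].
have tb : t <= b.
  rewrite tE; apply: ge_inf; first by case: infE.
  by rewrite /E /= ab lexx fb.
have before x : a <= x -> x < t -> 0 < f x.
  move=> ax xt; rewrite ltNge; apply/negP => fx.
  have : t <= x.
    rewrite tE; apply: ge_inf; first by case: infE.
    by rewrite /E /= ax fx (le_trans (ltW xt)).
  by rewrite leNgt xt.
have tin : t \in `[a, b] by rewrite in_itv/= at_.
have ft0 : f t <= 0.
  rewrite leNgt; apply/negP => ft.
  have [e e0 he] := continuous_near_gt (cf t tin) ft.
  have [x [[/andP[ax xb] fx] xt]] := inf_adherent e0 infE.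
  have tx : t <= x.
    by rewrite tE; apply: ge_inf; [case: infE | rewrite /E /= ax xb].
  rewrite -tE in xt.
  have /he : `|x - t| < e by rewrite ger0_norm ?subr_ge0 //; lra.
  by rewrite ltNge fx.
have a_lt : a < t.
  rewrite lt_neqAle at_ andbT; apply/eqP => atE.
  by move: ft0; rewrite -atE leNgt fa.
exists t; split => //; apply/eqP; rewrite eq_le ft0 /= leNgt; apply/negP => ft.
have [e e0 he] := continuous_near_lt (cf t tin) ft.
pose m : R := Num.min e (t - a).
have m0 : 0 < m by rewrite lt_min e0 subr_gt0.
have [me mt] : m <= e /\ m <= t - a by rewrite !ge_min !lexx orbT.
have h : `|t - m / 2 - t| < e.
  have -> : t - m / 2 - t = - (m / 2) by ring.
  by rewrite normrN gtr0_norm ?divr_gt0 //; lra.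
have H : 0 < f (t - m / 2) by apply: before; lra.
by have := lt_trans H (he _ h); rewrite ltxx.
Qed.

(** The system on a window where the weight is positive, with the powers of the
    radius absorbed in [al] and [be].  In this form it is invariant under the
    change of sign of [u] and under time reversal. *)
Record oscillation (R : realType) (a0 a1 b0 c lam : R) (al be g : R -> R)
    (s t : R) (u w : R -> R) : Prop := Oscillation {
  osc_le : forall r, r \in `[s, t] -> `|u r| <= c;
  osc_al : forall r, r \in `[s, t] -> a0 <= al r <= a1;
  osc_be : forall r, r \in `[s, t] -> b0 <= be r;
  osc_du : forall r : R, r \in `[s, t] -> is_derive r 1 u (psi (be r * w r));
  osc_dw : forall r : R, r \in `[s, t] ->
    is_derive r 1 w (- (lam * al r * g (u r))) }.

Section oscillation_symmetries.
Variables (R : realType) (a0 a1 b0 c lam : R).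

Lemma oscillation_sub al be (g : R -> R) s t s' t' u w :
  s <= s' -> t' <= t ->
  oscillation a0 a1 b0 c lam al be g s t u w ->
  oscillation a0 a1 b0 c lam al be g s' t' u w.
Proof.
move=> ss' t't [H1 H2 H3 H4 H5].
have sub r : r \in `[s', t'] -> r \in `[s, t].
  rewrite !in_itv/= => /andP[s'r rt'].
  by rewrite (le_trans ss' s'r) (le_trans rt' t't).
by split => r /sub; [exact: H1|exact: H2|exact: H3|exact: H4|exact: H5].
Qed.

Lemma oscillation_opp al be (g : R -> R) s t u w :
  oscillation a0 a1 b0 c lam al be g s t u w ->
  oscillation a0 a1 b0 c lam al be (fun x => - g (- x)) s t
    (fun r => - u r) (fun r => - w r).
Proof.
move=> [H1 H2 H3 H4 H5]; split => //.
- by move=> r rin; rewrite normrN; exact: H1.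
- move=> r rin; rewrite mulrN psiN; exact: derR_opp (H4 r rin).
- move=> r rin; rewrite opprK mulrN; exact: derR_opp (H5 r rin).
Qed.

Lemma oscillation_rev al be (g : R -> R) s t u w :
  oscillation a0 a1 b0 c lam al be g s t u w ->
  oscillation a0 a1 b0 c lam (fun r => al (- r)) (fun r => be (- r)) g
    (- t) (- s) (fun r => u (- r)) (fun r => - w (- r)).
Proof.
move=> [H1 H2 H3 H4 H5].
have opp r : r \in `[- t, - s] -> - r \in `[s, t].
  by rewrite !in_itv/= => /andP[? ?]; apply/andP; split; lra.
split.
- by move=> r /opp/H1.
- by move=> r /opp/H2.
- by move=> r /opp/H3.
- move=> r /opp/H4 d; rewrite mulrN psiN -[_ (psi _)]mulrN1.
  exact: derR_comp (derR_opp (derR_id r)) d.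
- move=> r /opp/H5 d.
  apply: (is_derive_eq (derR_opp (derR_comp (derR_opp (derR_id r)) d))).
  by ring.
Qed.

End oscillation_symmetries.

Section half_turn.
Variables (R : realType) (a0 a1 b0 c : R).
Hypothesis (a0_gt0 : 0 < a0) (a01 : a0 <= a1) (b0_gt0 : 0 < b0) (c_gt0 : 0 < c).

Let a1_gt0 : 0 < a1 := lt_le_trans a0_gt0 a01.

Variable g : R -> R.
Hypothesis cg : forall x : R, {for x, continuous g}.
Hypothesis g_sign : forall x, `|x| <= c -> x != 0 -> 0 < g x * x.

Let G := primitive g.

Let dG (x : R) : is_derive x 1 G (g x).
Proof. by apply: is_derive_primitive => y; exact: cg. Qed.

Let g_gt0 x : 0 < x -> x <= c -> 0 < g x.
Proof.
move=> x0 xc; rewrite -(pmulr_lgt0 _ x0).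
by apply: g_sign; rewrite ?gt_eqF // gtr0_norm.
Qed.

Let g_lt0 x : x < 0 -> - c <= x -> g x < 0.
Proof.
move=> x0 xc; rewrite -(nmulr_lgt0 _ x0).
by apply: g_sign; rewrite ?lt_eqF // ltr0_norm //; lra.
Qed.

Let g_ge0 x : 0 <= x -> x <= c -> 0 <= g x.
Proof.
rewrite le_eqVlt => /predU1P[<- _|x0 xc]; last exact/ltW/g_gt0.
rewrite leNgt; apply/negP => g00.
have [e e0 he] := continuous_near_lt (@cg 0) g00.
pose m : R := Num.min e c.
have m0 : 0 < m by rewrite lt_min e0.
have [me mc] : m <= e /\ m <= c by rewrite !ge_min !lexx orbT.
have /he : `|m / 2 - 0| < e by rewrite subr0 gtr0_norm ?divr_gt0 //; lra.
by rewrite ltNge ltW // g_gt0 ?divr_gt0 //; lra.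
Qed.

Let g_le0 x : x <= 0 -> - c <= x -> g x <= 0.
Proof.
rewrite le_eqVlt => /predU1P[-> _|x0 xc]; last exact/ltW/g_lt0.
rewrite leNgt; apply/negP => g00.
have [e e0 he] := continuous_near_gt (@cg 0) g00.
pose m : R := Num.min e c.
have m0 : 0 < m by rewrite lt_min e0.
have [me mc] : m <= e /\ m <= c by rewrite !ge_min !lexx orbT.
have /he : `|- (m / 2) - 0| < e.
  by rewrite subr0 normrN gtr0_norm ?divr_gt0 //; lra.
by rewrite ltNge ltW // g_lt0 ?oppr_lt0 ?divr_gt0 //; lra.
Qed.

Let G_incr x y : 0 <= x -> x < y -> y <= c -> G x < G y.
Proof.
move=> x0 xy yc; have fdo z (_ : z \in `]x, y[) := dG z.
have cG : {within `[x, y], continuous G} by exact: is_derive_within (fun z _ => dG z).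
have [z zxy E] := MVT xy fdo cG.
move: zxy; rewrite in_itv/= => /andP[xz zy].
by rewrite -subr_gt0 E mulr_gt0 ?subr_gt0 // g_gt0 //; lra.
Qed.

Let G_decr x y : - c <= x -> x < y -> y <= 0 -> G y < G x.
Proof.
move=> xc xy y0; have fdo z (_ : z \in `]x, y[) := dG z.
have cG : {within `[x, y], continuous G} by exact: is_derive_within (fun z _ => dG z).
have [z zxy E] := MVT xy fdo cG.
move: zxy; rewrite in_itv/= => /andP[xz zy].
by rewrite -subr_lt0 E nmulr_rlt0 ?subr_gt0 // g_lt0 //; lra.
Qed.

Let G0 : G 0 = 0.
Proof. exact: primitive0. Qed.

Let B := b0^-1.
Let B_gt0 : 0 < B.
Proof. by rewrite invr_gt0. Qed.

Let psi_le0 (x : R) : x <= 0 -> psi x <= 0.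
Proof. by move=> /psi_homo; rewrite psi0. Qed.

Let psi_le_half (be W : R) : b0 <= be -> W <= - B -> psi (be * W) <= - 2^-1.
Proof.
move=> b0be WB; rewrite -lerN2 opprK -psiN; apply: psi_ge_half.
have -> : 1 = b0 * B by rewrite divff ?gt_eqF.
rewrite -mulrN; apply: ler_pM => //; [exact: ltW | exact: ltW | lra].
Qed.

Section one_oscillation.
Variables (lam : R) (al be : R -> R) (s t : R) (u w : R -> R).
Hypothesis lam_gt0 : 0 < lam.
Hypothesis osc : oscillation a0 a1 b0 c lam al be g s t u w.

Let uc r : r \in `[s, t] -> - c <= u r <= c.
Proof. by move=> /(osc_le osc); rewrite ler_norml. Qed.

Let sub (x y r : R) : s <= x -> y <= t -> r \in `[x, y] -> r \in `[s, t].
Proof.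
move=> sx yt; rewrite !in_itv/= => /andP[xr ry].
by rewrite (le_trans sx xr) (le_trans ry yt).
Qed.

(** The function [w - lam a0 G(u)] is nonincreasing while [0 <= u], because the
    speed is at most [1]: losing potential energy creates momentum. *)
Lemma descent_momentum r : s <= r -> r <= t ->
  (forall x, x \in `[s, r] -> 0 <= u x) ->
  w r <= w s + lam * a0 * (G (u r) - G (u s)).
Proof.
move=> sr rt u0.
have dJ x (xin : x \in `[s, r]) := let xin' := sub (lexx s) rt xin in
  derR_sub (osc_dw osc xin')
    (derR_scale (derR_comp (osc_du osc xin') (dG (u x))) (lam * a0)).
have dJ0 x : x \in `[s, r] -> - (lam * al x * g (u x)) -
    lam * a0 * (g (u x) * psi (be x * w x)) <= 0.
  move=> xin; have xin' := sub (lexx s) rt xin.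
  have := u0 x xin; have /andP[_ ux] := uc xin'; move=> /g_ge0/(_ ux) gx.
  have /andP[al_ge _] := osc_al osc xin'.
  have := psi_norm_lt1 (be x * w x); rewrite ltr_norml => /andP[p1 _].
  have -> : - (lam * al x * g (u x)) - lam * a0 * (g (u x) * psi (be x * w x)) =
    - (lam * g (u x) * (al x + a0 * psi (be x * w x))) by ring.
  rewrite oppr_le0 !mulr_ge0 //; first exact: ltW.
  have : 0 < a0 * (psi (be x * w x) + 1) by rewrite mulr_gt0 //; lra.
  by rewrite mulrDr mulr1; lra.
have := is_derive_upper dJ dJ0 sr; rewrite mul0r addr0; lra.
Qed.

Lemma falling_monotone tau r : s <= tau -> r <= t -> u tau = 0 ->
  (forall x, x \in `[tau, r] -> w x <= 0) ->
  forall x y, tau <= x -> x <= y -> y <= r ->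
    [/\ u x <= 0, u y <= u x & w x <= w y].
Proof.
move=> stau rt u0 w0.
have um x y : tau <= x -> x <= y -> y <= r -> u y <= u x.
  move=> tx xy yr.
  have xyin z : z \in `[x, y] -> z \in `[tau, r].
    rewrite !in_itv/= => /andP[xz zy].
    by rewrite (le_trans tx xz) (le_trans zy yr).
  have du z (zin : z \in `[x, y]) := osc_du osc (sub stau rt (xyin z zin)).
  have du0 z : z \in `[x, y] -> psi (be z * w z) <= 0.
    move=> /xyin zin; apply/psi_le0; rewrite mulr_ge0_le0 ?w0 //.
    exact/ltW/(lt_le_trans b0_gt0)/(osc_be osc)/(sub stau rt zin).
  by have := is_derive_upper du du0 xy; rewrite mul0r addr0.
have u_le0 x : tau <= x -> x <= r -> u x <= 0.
  by move=> tx xr; rewrite -u0; exact: um.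
move=> x y tx xy yr; split; [exact: u_le0 (le_trans xy yr)|exact: um|].
have xyin z : z \in `[x, y] -> z \in `[tau, r].
  rewrite !in_itv/= => /andP[xz zy].
  by rewrite (le_trans tx xz) (le_trans zy yr).
have dw z (zin : z \in `[x, y]) := osc_dw osc (sub stau rt (xyin z zin)).
have dw0 z : z \in `[x, y] -> 0 <= - (lam * al z * g (u z)).
  move=> /xyin zin; have zst := sub stau rt zin.
  move: zin; rewrite in_itv/= => /andP[tz zr].
  have /andP[uz _] := uc zst; have /andP[al_ge _] := osc_al osc zst.
  rewrite oppr_ge0 mulr_ge0_le0 //; last exact: g_le0 (u_le0 z tz zr) uz.
  by rewrite mulr_ge0 // ltW // (lt_le_trans a0_gt0).
exact: is_derive_homo dw dw0 xy.
Qed.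

(** While the momentum stays below [- B] the speed is at least [1 / 2], so
    losing the momentum costs depth. *)
Lemma turning_depth (eta' tau r : R) : s <= tau -> tau <= r -> r <= t ->
  u tau = 0 -> (forall x, x \in `[tau, r] -> w x <= 0) ->
  w tau <= - B -> - B <= w r -> eta' <= c ->
  2 * lam * a1 * G (- eta') <= - w tau - B -> u r <= - eta'.
Proof.
move=> stau taur rt u0 w0 wtau wr eta'c HG.
have mono := falling_monotone stau rt u0 w0.
have cw : {within `[tau, r], continuous w}.
  exact: (is_derive_within (fun z (zin : z \in `[tau, r]) =>
    osc_dw osc (sub stau rt zin))).
have [|r' r'in wr'] := @IVT _ w _ _ (- B) taur cw.
  by rewrite ge_min le_max wtau wr orbT.
move: r'in; rewrite in_itv/= => /andP[tr' r'r].
have r't := le_trans r'r rt.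
have dJ x (xin : x \in `[tau, r']) := let xin' := sub stau r't xin in
  derR_sub (osc_dw osc xin')
    (derR_scale (derR_comp (osc_du osc xin') (dG (u x))) (2 * lam * a1)).
have dJ0 x : x \in `[tau, r'] -> - (lam * al x * g (u x)) -
    2 * lam * a1 * (g (u x) * psi (be x * w x)) <= 0.
  move=> xin; have xin' := sub stau r't xin.
  have /andP[ux _] := uc xin'.
  move: xin; rewrite in_itv/= => /andP[tx xr'].
  have [ux0 _ wxr'] := mono _ _ tx xr' r'r.
  have gx := g_le0 ux0 ux.
  have /andP[_ al_le] := osc_al osc xin'.
  have p1 : psi (be x * w x) <= - 2^-1.
    by apply: psi_le_half; [exact (osc_be osc xin') | rewrite -wr'].
  have -> : - (lam * al x * g (u x)) - 2 * lam * a1 * (g (u x) * psi (be x * w x)) =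
    lam * (- g (u x)) * (al x + a1 * (2 * psi (be x * w x))) by ring.
  rewrite mulr_ge0_le0 //; first by rewrite mulr_ge0 ?oppr_ge0 // ltW.
  have : 0 <= a1 * (- 1 - 2 * psi (be x * w x)) by apply: mulr_ge0; [exact: ltW|lra].
  by rewrite mulrBr; lra.
have := is_derive_upper dJ dJ0 tr'; rewrite mul0r addr0 wr' u0 G0 mulr0 => HJ.
have [ur' ur _] := mono _ _ tr' r'r (lexx r).
apply: le_trans ur _; rewrite leNgt; apply/negP => eta'u.
have eta'c' : - c <= - eta' by rewrite lerN2.
have := G_decr eta'c' eta'u ur'.
rewrite -(@ltr_pM2l _ (2 * lam * a1)) ?mulr_gt0 //; lra.
Qed.

End one_oscillation.

(** One half turn, with constants independent of [lam].  The descent from [eta]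
    to [0] takes a time at most [3 c]: after a time [c] the momentum has become
    so negative that the speed is at least [1 / 2].  It then creates a momentum
    of order [lam], which has to be spent against the force before the motion
    reverses, and this is only possible at some definite depth [eta'].  The
    bound [|u| <= c] prevents the second phase from lasting longer than
    [4 c]. *)
Lemma half_turn (eta : R) : 0 < eta -> eta <= c ->
  exists eta' Lam : R, [/\ 0 < eta', eta' <= c, 0 < Lam &
    forall lam al be s t u w, Lam <= lam -> s + 7 * c <= t ->
      oscillation a0 a1 b0 c lam al be g s t u w -> eta <= u s -> w s <= 0 ->
      exists r, [/\ s < r, r <= s + 7 * c, u r <= - eta' & 0 <= w r]].
Proof.
move=> eta0 etac.
have eta2 : 0 < eta / 2 by rewrite divr_gt0.
have min_g x y : x <= y -> exists2 z, z \in `[x, y] &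
    forall r, r \in `[x, y] -> g z <= g r.
  by move=> xy; apply: EVT_min xy _; apply: continuous_subspaceT => z; exact: cg.
have max_g x y : x <= y -> exists2 z, z \in `[x, y] &
    forall r, r \in `[x, y] -> g r <= g z.
  by move=> xy; apply: EVT_max xy _; apply: continuous_subspaceT => z; exact: cg.
have eta2c : eta / 2 <= c by lra.
have [z1 z1in m1P] := min_g _ _ eta2c.
pose m1 : R := g z1.
have m1_gt0 : 0 < m1.
  by move: z1in; rewrite in_itv/= => /andP[? ?]; apply: g_gt0 => //; lra.
pose Gam : R := G eta - G (eta / 2).
have Gam_gt0 : 0 < Gam by rewrite subr_gt0 G_incr //; lra.
have Geta_gt0 : 0 < G eta by rewrite -G0 G_incr.
have [eta' [eta'0 eta'c G_eta']] : exists eta', [/\ 0 < eta', eta' <= c &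
    G (- eta') < a0 * G eta / (4 * a1)].
  have H : G 0 < a0 * G eta / (4 * a1) by rewrite G0 divr_gt0 ?mulr_gt0.
  have [e e0 he] := continuous_near_lt (is_derive_continuous (dG 0)) H.
  pose m : R := Num.min e c.
  have m0 : 0 < m by rewrite lt_min e0.
  have [me mc] : m <= e /\ m <= c by rewrite !ge_min !lexx orbT.
  exists (m / 2); split; [by rewrite divr_gt0 | lra | apply: he].
  by rewrite subr0 normrN gtr0_norm ?divr_gt0 //; lra.
have eta'c' : - c <= - eta' by rewrite lerN2.
have [z2 z2in m2P] := max_g _ _ eta'c'.
pose m2 : R := - g z2.
have m2_gt0 : 0 < m2.
  rewrite oppr_gt0; move: z2in; rewrite in_itv/= => /andP[? ?].
  by apply: g_lt0 => //; lra.
(* For [lam >= Lam], each of these four quantities times [lam a0] is at least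
   [2 B]: the momentum created in either phase exceeds the threshold [B] above
   which the speed is at least [1 / 2]. *)
pose kap : R := Num.min (Num.min (m1 * c) Gam) (Num.min (G eta / 2) (m2 * c)).
have kap_gt0 : 0 < kap by rewrite !lt_min !mulr_gt0 ?invr_gt0 // Gam_gt0.
have [k1 k2 k3 k4] : [/\ kap <= m1 * c, kap <= Gam, kap <= G eta / 2 &
    kap <= m2 * c].
  by rewrite /kap; split; rewrite !ge_min lexx ?orbT.
exists eta', (2 * B / (a0 * kap)); split => //.
  by rewrite !mulr_gt0 // invr_gt0 mulr_gt0.
move=> lam al be s t u w Lam_lam st osc us ws.
have lam_gt0 : 0 < lam.
  by apply: lt_le_trans Lam_lam; rewrite !mulr_gt0 // invr_gt0 mulr_gt0.
have lam_kap x : kap <= x -> 2 * B <= lam * a0 * x.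
  move=> kx; move: Lam_lam; rewrite ler_pdivrMr ?mulr_gt0 // => /le_trans.
  by apply; rewrite mulrA ler_wpM2l // mulr_ge0 // ltW.
have la0 : 0 <= lam * a0 by apply: mulr_ge0; exact: ltW.
have {lam_kap}[l1 l2 l3 l4] := And4 (lam_kap _ k1) (lam_kap _ k2) (lam_kap _ k3)
  (lam_kap _ k4).
have c0 := c_gt0; have B0 := B_gt0.
have ucT r : s <= r -> r <= t -> - c <= u r <= c.
  by move=> sr rt; rewrite -ler_norml; apply: (osc_le osc); rewrite in_itv/= sr.
have usc : u s <= c by have /andP[] := ucT s (lexx s) ltac:(lra).
have sub (x y r : R) : s <= x -> y <= t -> r \in `[x, y] -> r \in `[s, t].
  move=> sx yt; rewrite !in_itv/= => /andP[xr ry].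
  by rewrite (le_trans sx xr) (le_trans ry yt).
(* Phase 1: [u] reaches [0] within time [3 c]. *)
have [r1 [sr1 r1c ur1]] : exists r, [/\ s <= r, r <= s + 3 * c & u r <= 0].
  apply: contrapT => H.
  have u_gt0 r : s <= r -> r <= s + 3 * c -> 0 < u r.
    by move=> sr rc; rewrite ltNge; apply/negP => ur; apply: H; exists r.
  have wm x y : s <= x -> x <= y -> y <= s + 3 * c -> w y <= w x.
    move=> sx xy yc; have yt : y <= t by lra.
    have dw z (zin : z \in `[x, y]) := osc_dw osc (sub _ _ _ sx yt zin).
    have dw0 z : z \in `[x, y] -> - (lam * al z * g (u z)) <= 0.
      move=> zin; have zst := sub _ _ _ sx yt zin.
      move: zin; rewrite in_itv/= => /andP[xz zy].
      have /andP[_ uz] := ucT z (le_trans sx xz) (le_trans zy yt).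
      have /andP[al_ge _] := osc_al osc zst.
      have uz0 := u_gt0 z (le_trans sx xz) (le_trans zy yc).
      rewrite oppr_le0 !mulr_ge0 // ?(ltW lam_gt0) ?(ltW (g_gt0 uz0 uz)) //.
      exact/ltW/(lt_le_trans a0_gt0).
    by have := is_derive_upper dw dw0 xy; rewrite mul0r addr0.
  have w_le0 x : s <= x -> x <= s + 3 * c -> w x <= 0.
    by move=> sx xc; apply: le_trans ws; exact: wm.
  have um x y : s <= x -> x <= y -> y <= s + 3 * c -> u y <= u x.
    move=> sx xy yc; have yt : y <= t by lra.
    have du z (zin : z \in `[x, y]) := osc_du osc (sub _ _ _ sx yt zin).
    have du0 z : z \in `[x, y] -> psi (be z * w z) <= 0.
      move=> zin; have zst := sub _ _ _ sx yt zin.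
      move: zin; rewrite in_itv/= => /andP[xz zy].
      apply/psi_le0; rewrite mulr_ge0_le0 //.
        exact/ltW/(lt_le_trans b0_gt0)/(osc_be osc).
      exact: w_le0 (le_trans sx xz) (le_trans zy yc).
    by have := is_derive_upper du du0 xy; rewrite mul0r addr0.
  have wB : w (s + c) <= - B.
    have [u_hi|u_lo] := leP (eta / 2) (u (s + c)).
      have sct : s + c <= t by lra.
      have dw z (zin : z \in `[s, s + c]) := osc_dw osc (sub _ _ _ (lexx s) sct zin).
      have dwB z : z \in `[s, s + c] -> - (lam * al z * g (u z)) <= - (lam * a0 * m1).
        move=> zin; have zst := sub _ _ _ (lexx s) sct zin.
        move: zin; rewrite in_itv/= => /andP[sz zc].
        have /andP[al_ge _] := osc_al osc zst.
        have /andP[_ uz] := ucT z sz (le_trans zc sct).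
        have uz2 : eta / 2 <= u z by apply: le_trans u_hi _; apply: um; lra.
        have gm : m1 <= g (u z) by apply: m1P; rewrite in_itv/= uz2.
        rewrite lerN2 ler_pM ?mulr_ge0 ?(ltW lam_gt0) ?(ltW a0_gt0) ?(ltW m1_gt0) //.
        by rewrite ler_wpM2l // ltW.
      have ssc : s <= s + c by lra.
      by have := is_derive_upper dw dwB ssc; lra.
    have H1 : w (s + c) <= w s + lam * a0 * (G (u (s + c)) - G (u s)).
      apply: (descent_momentum lam_gt0 osc); [lra|lra|].
      move=> x; rewrite in_itv/= => /andP[sx xc].
      by apply/ltW/u_gt0; lra.
    have Gu1 : G (u (s + c)) <= G (eta / 2).
      by apply/ltW/G_incr => //; apply/ltW/u_gt0; lra.
    have Gu2 : G eta <= G (u s).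
      have := us; rewrite le_eqVlt => /predU1P[->//|us'].
      by apply/ltW/G_incr => //; exact: ltW.
    have : lam * a0 * (G (u (s + c)) - G (u s)) <= - (lam * a0 * Gam).
      by rewrite -mulrN; apply: ler_wpM2l => //; rewrite /Gam; lra.
    by lra.
  have s3t : s + 3 * c <= t by lra.
  have ssc : s <= s + c by lra.
  have du z (zin : z \in `[s + c, s + 3 * c]) := osc_du osc (sub _ _ _ ssc s3t zin).
  have duB z : z \in `[s + c, s + 3 * c] -> psi (be z * w z) <= - 2^-1.
    move=> zin; have zst := sub _ _ _ ssc s3t zin.
    move: zin; rewrite in_itv/= => /andP[sz zc].
    apply: psi_le_half; first exact (osc_be osc zst).
    by apply: le_trans wB; exact: wm.
  have := is_derive_upper du duB ltac:(lra).
  have := u_gt0 (s + 3 * c) ltac:(lra) (lexx _).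
  have /andP[_ usc'] := ucT (s + c) ltac:(lra) ltac:(lra).
  by lra.
have us_gt0 : 0 < u s by exact: lt_le_trans us.
have r1t : r1 <= t by lra.
have cu x : x \in `[s, r1] -> {for x, continuous u}.
  by move=> /(sub _ _ _ (lexx s) r1t)/(osc_du osc)/is_derive_continuous.
have [tau [stau taur1 utau u_before]] := first_zero cu us_gt0 ur1 sr1.
have wtau : w tau <= - (lam * a0 * G eta).
  have H : w tau <= w s + lam * a0 * (G (u tau) - G (u s)).
    apply: (descent_momentum lam_gt0 osc); [exact: ltW|lra|].
    move=> x; rewrite in_itv/= => /andP[sx].
    by rewrite le_eqVlt => /predU1P[->|xt]; [rewrite utau | exact/ltW/u_before].
  have Gu2 : G eta <= G (u s).
    have := us; rewrite le_eqVlt => /predU1P[->//|us'].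
    by apply/ltW/G_incr => //; exact: ltW.
  have : lam * a0 * (G (u tau) - G (u s)) <= - (lam * a0 * G eta).
    by rewrite -mulrN; apply: ler_wpM2l => //; rewrite utau G0; lra.
  by lra.
have wtauB : w tau <= - B by have := B_gt0; lra.
have HG : 2 * lam * a1 * G (- eta') <= - w tau - B.
  have H := ltW G_eta'; rewrite ler_pdivlMr ?mulr_gt0 // in H.
  have := ler_wpM2l (ltW lam_gt0) H; have := B_gt0; lra.
have depth r : tau <= r -> r <= t -> (forall x, x \in `[tau, r] -> w x <= 0) ->
    - B <= w r -> u r <= - eta'.
  move=> tr rt w0 wr.
  by apply: (turning_depth lam_gt0 osc (ltW stau) tr rt utau w0 wtauB wr).
(* Phase 2: [w] becomes nonnegative within a further time [4 c]. *)
have [r2 [tr2 r2c wr2]] : exists r, [/\ tau <= r, r <= tau + 4 * c & 0 <= w r].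
  apply: contrapT => H.
  have w_lt0 r : tau <= r -> r <= tau + 4 * c -> w r < 0.
    by move=> sr rc; rewrite ltNge; apply/negP => wr; apply: H; exists r.
  have t4 : tau + 4 * c <= t by lra.
  have w_le0 x : x \in `[tau, tau + 4 * c] -> w x <= 0.
    by rewrite in_itv/= => /andP[tx xc]; exact/ltW/w_lt0.
  have mono := falling_monotone lam_gt0 osc (ltW stau) t4 utau w_le0.
  (* At speed [1 / 2] a time [5 / 2 c] is enough to violate [- c <= u]. *)
  pose h := tau + 5 / 2 * c.
  have [th h4] : tau <= h /\ h <= tau + 4 * c by rewrite /h; split; lra.
  have ht : h <= t by lra.
  have [whB|whB] := leP (w h) (- B).
    have du z (zin : z \in `[tau, h]) := osc_du osc (sub _ _ _ (ltW stau) ht zin).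
    have duB z : z \in `[tau, h] -> psi (be z * w z) <= - 2^-1.
      move=> zin; have zst := sub _ _ _ (ltW stau) ht zin.
      move: zin; rewrite in_itv/= => /andP[tz zh].
      have [_ _ wzh] := mono _ _ tz zh h4.
      by apply: psi_le_half; [exact (osc_be osc zst) | exact: le_trans wzh whB].
    have := is_derive_upper du duB th.
    have /andP[uh _] := ucT h (le_trans (ltW stau) th) ht.
    by move: uh; rewrite /h utau; lra.
  have uh : u h <= - eta'.
    apply: depth => //; last exact: ltW.
    move=> x; rewrite in_itv/= => /andP[tx xh]; apply: w_le0.
    by rewrite in_itv/= tx (le_trans xh).
  have sh : s <= h by exact: le_trans (ltW stau) th.
  have dw z (zin : z \in `[h, tau + 4 * c]) := osc_dw osc (sub _ _ _ sh t4 zin).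
  have dwB z : z \in `[h, tau + 4 * c] -> lam * a0 * m2 <= - (lam * al z * g (u z)).
    move=> zin; have zst := sub _ _ _ sh t4 zin.
    move: zin; rewrite in_itv/= => /andP[hz zc].
    have /andP[al_ge _] := osc_al osc zst.
    have /andP[uz _] := ucT z (le_trans sh hz) (le_trans zc t4).
    have [_ uzh _] := mono _ _ th hz zc.
    have gm : m2 <= - g (u z).
      by rewrite lerN2; apply: m2P; rewrite in_itv/= uz (le_trans uzh).
    rewrite -mulrN ler_pM ?mulr_ge0 ?(ltW lam_gt0) ?(ltW a0_gt0) ?(ltW m2_gt0) //.
    by rewrite ler_wpM2l // ltW.
  have := is_derive_lower dw dwB h4.
  have := w_lt0 _ (le_trans th h4) (lexx _).
  have m2c : 0 < lam * a0 * m2 * c by rewrite !mulr_gt0.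
  by have := B_gt0; rewrite /h; lra.
have r2t : r2 <= t by lra.
have cNw x : x \in `[tau, r2] -> {for x, continuous (fun r => - w r)}.
  move=> /(sub _ _ _ (ltW stau) r2t)/(osc_dw osc)/is_derive_continuous.
  exact: ctsR_opp.
have [||r [tr rr2 wr w_before]] := first_zero cNw _ _ tr2.
- by rewrite oppr_gt0; have := B_gt0; lra.
- by rewrite oppr_le0.
have wr0 : w r = 0 by rewrite -[LHS]opprK wr oppr0.
exists r; split; [lra|lra| |by rewrite wr0].
apply: depth; [exact: ltW|lra| |by rewrite wr0 oppr_le0 ltW].
move=> x; rewrite in_itv/= => /andP[tx].
rewrite le_eqVlt => /predU1P[->|xr]; first by rewrite wr0.
by have := w_before x tx xr; rewrite oppr_gt0 => /ltW.
Qed.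

End half_turn.

Definition alternates (R : realType) (u : R -> R) (s t : R) (n : nat) : Prop :=
  exists x : nat -> R, (forall i, (i <= n)%N -> x i \in `[s, t]) /\
    (forall i, (i < n)%N -> x i < x i.+1 /\ u (x i) * u (x i.+1) < 0).

Section alternates.
Variables (R : realType) (u : R -> R) (n : nat).

Lemma alternates_sub s t s' t' : s' <= s -> t <= t' ->
  alternates u s t n -> alternates u s' t' n.
Proof.
move=> s's tt' [x [xin xalt]]; exists x; split => // i /xin.
rewrite !in_itv/= => /andP[sx xt].
by rewrite (le_trans s's sx) (le_trans xt tt').
Qed.

Lemma alternates_opp s t :
  alternates (fun r => - u r) s t n -> alternates u s t n.
Proof.
move=> [x [xin xalt]]; exists x; split => // i /xalt.
by rewrite mulrNN.
Qed.

Lemma alternates_rev s t :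
  alternates (fun r => u (- r)) (- t) (- s) n -> alternates u s t n.
Proof.
move=> [x [xin xalt]]; exists (fun i => - x (n - i)%N); split => i iN.
  have := xin (n - i)%N (leq_subr _ _); rewrite !in_itv/= => /andP[? ?].
  by apply/andP; split; lra.
have lt : (n - i.+1 < n)%N by rewrite ltn_subrL /= (leq_ltn_trans _ iN).
have := xalt _ lt; rewrite subnSK // => -[xx uu].
by split; [rewrite ltrN2 | rewrite mulrC].
Qed.

End alternates.

Section many_turns.
Variables (R : realType) (a0 a1 b0 c : R).
Hypothesis (a0_gt0 : 0 < a0) (a01 : a0 <= a1) (b0_gt0 : 0 < b0) (c_gt0 : 0 < c).

Definition restoring (g : R -> R) : Prop :=
  (forall x : R, {for x, continuous g}) /\
  (forall x, `|x| <= c -> x != 0 -> 0 < g x * x).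

Lemma restoring_opp g : restoring g -> restoring (fun x => - g (- x)).
Proof.
move=> [cg gs]; split=> x.
  have cN : {for x, continuous (fun t : R => - t)} by exact: opp_continuous.
  exact: ctsR_opp (ctsR_comp cN (cg _)).
by move=> xc x0; rewrite mulNr -mulrN gs ?normrN ?oppr_eq0.
Qed.

Lemma many_turns n : forall g eta, restoring g -> 0 < eta -> eta <= c ->
  exists2 Lam : R, 0 < Lam & forall lam al be s t u w, Lam <= lam ->
    s + 7 * c * n%:R <= t -> oscillation a0 a1 b0 c lam al be g s t u w ->
    eta <= u s -> w s <= 0 ->
    exists x : nat -> R, [/\ x 0%N = s, forall i, (i <= n)%N -> x i \in `[s, t] &
      forall i, (i < n)%N -> x i < x i.+1 /\ u (x i) * u (x i.+1) < 0].
Proof.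
elim: n => [|n IH] g eta gP eta0 etac.
  exists 1 => // lam al be s t u w _; rewrite mulr0 addr0 => st _ _ _.
  by exists (fun=> s); split => // i _; rewrite in_itv/= lexx.
have [cg gs] := gP.
have [eta' [Lam1 [eta'0 eta'c Lam10 H1]]] :=
  half_turn a0_gt0 a01 b0_gt0 c_gt0 cg gs eta0 etac.
have [Lam2 Lam20 H2] := IH _ _ (restoring_opp gP) eta'0 eta'c.
exists (Lam1 + Lam2); first exact: addr_gt0.
move=> lam al be s t u w Llam st osc us ws.
have nc : 0 <= 7 * c * n%:R by rewrite !mulr_ge0 // ltW.
have st7 : s + 7 * c <= t by move: st; rewrite -natr1; lra.
have L1 : Lam1 <= lam by lra.
have [r [sr r7 ur wr]] := H1 _ _ _ _ _ _ _ L1 st7 osc us ws.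
have osc' := oscillation_opp (oscillation_sub (ltW sr) (lexx t) osc).
have L2 : Lam2 <= lam by lra.
have rt : r + 7 * c * n%:R <= t by move: st; rewrite -natr1; lra.
have ur' : eta' <= - u r by rewrite lerNr.
have wr' : - w r <= 0 by rewrite oppr_le0.
have [x [x0 xin xalt]] := H2 _ _ _ _ _ _ _ L2 rt osc' ur' wr'.
exists (fun i => if i is i'.+1 then x i' else s); split => //.
  move=> [_|i]; first by rewrite in_itv/= lexx (le_trans _ st7) //
    lerDl mulr_ge0 // ltW.
  rewrite ltnS => /xin; rewrite !in_itv/= => /andP[rx ->].
  by rewrite (le_trans (ltW sr) rx).
move=> [_|i]; last by rewrite ltnS => /xalt; rewrite mulrNN.
rewrite x0; split => //; rewrite pmulr_rlt0 ?(lt_le_trans eta0) //.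
by apply: le_lt_trans ur _; rewrite oppr_lt0.
Qed.

(** Otherwise [u] would exceed [c] just after [s]. *)
Lemma peak_momentum lam al be g s t u w : s < t ->
  oscillation a0 a1 b0 c lam al be g s t u w -> u s = c -> w s <= 0.
Proof.
move=> st osc us; rewrite leNgt; apply/negP => ws.
have sin : s \in `[s, t] by rewrite in_itv/= lexx ltW.
have p0 : 0 < psi (be s * w s).
  by apply/psi_gt0/mulr_gt0 => //; exact: lt_le_trans (osc_be osc sin).
have [e e0 he] := is_derive_gt0_near (osc_du osc sin) p0.
pose m : R := Num.min e (t - s).
have m0 : 0 < m by rewrite lt_min e0 subr_gt0.
have [me mt] : m <= e /\ m <= t - s by rewrite !ge_min !lexx orbT.
have sy : s < s + m / 2 by rewrite ltrDl divr_gt0.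
have yse : `|s + m / 2 - s| < e by rewrite gtr0_norm ?subr_gt0 //; lra.
have := he _ yse (negbT (gt_eqF sy)).
rewrite us pmulr_lgt0 ?subr_gt0 // => cu.
have yin : s + m / 2 \in `[s, t] by rewrite in_itv/= (ltW sy) /=; lra.
by have := osc_le osc yin; rewrite ler_norml => /andP[_]; rewrite leNgt cu.
Qed.

Lemma forward_turns n g : restoring g ->
  exists2 Lam : R, 0 < Lam & forall lam al be s t u w, Lam <= lam ->
    s < t -> s + 7 * c * n%:R <= t ->
    oscillation a0 a1 b0 c lam al be g s t u w -> `|u s| = c ->
    alternates u s t n.
Proof.
move=> gP; have [Lam1 L10 H1] := many_turns n gP c_gt0 (lexx c).
have [Lam2 L20 H2] := many_turns n (restoring_opp gP) c_gt0 (lexx c).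
exists (Lam1 + Lam2); first exact: addr_gt0.
move=> lam al be s t u w Llam s_t st osc us.
have [u0|u0] := leP 0 (u s).
  rewrite (ger0_norm u0) in us.
  have [||x [_ xin xalt]] := H1 lam al be s t u w _ st osc _ (peak_momentum s_t osc us).
  - lra.
  - by rewrite us.
  - by exists x.
rewrite (ltr0_norm u0) in us; have osc' := oscillation_opp osc.
apply: alternates_opp.
have [||x [_ xin xalt]] := H2 lam al be s t _ _ _ st osc' _ (peak_momentum s_t osc' us).
- lra.
- by rewrite us.
- by exists x.
Qed.

(** From a point where the bound [c] is reached, go towards the farther end
    of the window. *)
Lemma window_turns n g (s t : R) : restoring g -> s < t ->
  7 * c * n%:R <= (t - s) / 2 ->
  exists2 Lam : R, 0 < Lam & forall lam al be r u w, Lam <= lam ->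
    oscillation a0 a1 b0 c lam al be g s t u w -> r \in `[s, t] -> `|u r| = c ->
    alternates u s t n.
Proof.
move=> gP s_t nst; have [Lam L0 H] := forward_turns n gP.
exists Lam => // lam al be r u w Llam osc; rewrite in_itv/= => /andP[sr rt] ur.
have [rmid|rmid] := leP r ((s + t) / 2).
  apply: (alternates_sub sr (lexx t)).
  by apply: (H _ _ _ _ _ _ _ Llam _ _ (oscillation_sub sr (lexx t) osc) ur); lra.
apply: (alternates_sub (lexx s) rt); apply: alternates_rev.
apply: (H _ _ _ _ _ _ _ Llam _ _
  (oscillation_rev (oscillation_sub (lexx s) rt osc))).
- lra.
- lra.
- by rewrite opprK.
Qed.

End many_turns.

(** * Choosing the initial height *)

Definition superlinear (R : realType) (g : R -> R) : Prop :=
  forall e : R, 0 < e -> exists2 tau : R, 0 < tau &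
    forall x, `|x| <= tau -> `|g x| <= e * `|x|.

Definition shooting_family (R : realType) (n : nat) (rho : R) (a g : R -> R)
    (U W : R -> R -> R) : Prop :=
  forall d, shot n rho a g (U d) (W d) /\ U d 0 = d.

Section initial_height.
Variables (R : realType) (n : nat) (rho : R) (a g : R -> R) (A K : R).
Hypothesis (n_gt0 : (0 < n)%N) (rho_gt0 : 0 < rho).
Hypothesis (aA : forall r, `|a r| <= A).
Hypothesis (gK : forall x y, `|g x - g y| <= K * `|x - y|) (g0 : g 0 = 0).
Hypothesis ca : continuous a.

Let rho_ge0 : 0 <= rho := ltW rho_gt0.

Let A_ge0 : 0 <= A.
Proof. exact: le_trans (aA 0). Qed.

Let K_ge0 : 0 <= K.
Proof. by have := gK 1 0; rewrite subr0 normr1 mulr1; exact: le_trans (normr_ge0 _). Qed.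

Let L : R := 2 * (A * K) + 1.

Let L_gt0 : 0 < L.
Proof. by rewrite ltr_wpDl // mulr_ge0 // mulr_ge0. Qed.

Let AKL : A * K <= L ^+ 2 / 2.
Proof.
have AK0 : 0 <= A * K by exact: mulr_ge0.
rewrite /L; move: (A * K) AK0 => x x0; have := mulr_ge0 x0 x0; lra.
Qed.

Lemma shooting_family_exists : exists U W, shooting_family n rho a g U W.
Proof.
have /choice[U /choice[W H]] :=
  fun d => shot_exists n_gt0 rho_gt0 aA gK L_gt0 AKL d ca.
by exists U, W.
Qed.

Let E : R := expR (L * rho).

Let E_gt0 : 0 < E.
Proof. exact: expR_gt0. Qed.

Lemma shot_lip_unif u1 w1 u2 w2 : shot n rho a g u1 w1 -> shot n rho a g u2 w2 ->
  forall r, r \in `[0, rho] -> `|u1 r - u2 r| <= 2 * E * `|u1 0 - u2 0|.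
Proof.
move=> s1 s2 r rin; have [H _] := shot_lip rho_gt0 aA gK L_gt0 AKL s1 s2 rin.
apply: le_trans H _; rewrite mulrAC ler_wpM2r // ler_wpM2l // ler_expR.
by move: rin; rewrite in_itv/= => /andP[_ rrho]; rewrite ler_wpM2l // ltW.
Qed.

Lemma shot_zero : shot n rho a g (fun=> 0) (fun=> 0).
Proof.
split => // r; first by rewrite mul0r psi0; exact: derR_cst.
by rewrite g0 mulr0 oppr0; exact: derR_cst.
Qed.

Lemma shot_le u w : shot n rho a g u w ->
  forall r, r \in `[0, rho] -> `|u r| <= 2 * E * `|u 0|.
Proof.
by move=> s r rin; have := shot_lip_unif s shot_zero rin; rewrite !subr0.
Qed.

Lemma shot_dist u w : shot n rho a g u w ->
  forall r, r \in `[0, rho] -> `|u r - u 0| <= rho.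
Proof.
move=> s r; rewrite in_itv/= => /andP[r0 rrho].
by apply: le_trans (driven_u_lip _ _ s) _; rewrite subr0 ger0_norm.
Qed.

(** Speed is below [1]: a trajectory starting high enough has no time to
    come down. *)
Lemma shot_high u w : shot n rho a g u w -> u 0 = rho + 1 ->
  forall r, r \in `[0, rho] -> 1 <= u r.
Proof.
move=> s u0 r /(shot_dist s); rewrite u0 ler_norml => /andP[H _]; lra.
Qed.

(** On a trajectory of height [d] both [|u|] and the force are controlled by
    [|d|]; the force is [o(d)], hence so are the momentum and the
    displacement. *)
Lemma shot_low : superlinear g ->
  exists2 d0 : R, 0 < d0 & forall u w, shot n rho a g u w -> u 0 != 0 ->
    `|u 0| <= d0 -> forall r, r \in `[0, rho] -> u r != 0.
Proof.
move=> gsup; pose X : R := A * (2 * E) * rho * rho.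
have X0 : 0 <= X by rewrite !mulr_ge0 // ltW.
pose e : R := (2 * (X + 1))^-1.
have e0 : 0 < e by rewrite invr_gt0 mulr_gt0 // ltr_wpDl.
have eX : e * X <= 2^-1.
  rewrite /e invfM -mulrA ler_piMr ?invr_ge0 //.
  by rewrite mulrC ler_pdivrMr ?ltr_wpDl // mul1r lerDl.
have [tau tau0 gtau] := gsup e e0.
exists (tau / (2 * E)); first by rewrite divr_gt0 // mulr_gt0.
move=> u w s u0 ud r rin; move: ud; rewrite ler_pdivlMr ?mulr_gt0 // => ud.
pose B : R := A * (e * (2 * E * `|u 0|)).
have B0 : 0 <= B by rewrite !mulr_ge0 ?(ltW E_gt0) ?(ltW e0).
have fB x : x \in `[0, rho] -> `|a x * g (u x)| <= B.
  move=> xin; have ux := shot_le s xin.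
  rewrite normrM; apply: (ler_pM _ _ (aA x)) => //.
  apply: le_trans (gtau _ _) _; first by apply: le_trans ux _; rewrite mulrC.
  by rewrite ler_wpM2l // ltW.
have wB := driven_w_le (h := u) (driven_dw s) (driven_w0 s) fB.
have vB x : x \in `[0, r] ->
    `|psi (w (clamp 0 rho x) / clamp 0 rho x ^+ n)| <= B * rho.
  move: rin; rewrite !in_itv/= => /andP[_ rrho] /andP[x0 xr].
  have xin : x \in `[0, rho] by rewrite in_itv/= x0 (le_trans xr).
  rewrite (clamp_id xin).
  have := psi_lip (w x / x ^+ n) 0; rewrite psi0 !subr0 => /le_trans; apply.
  have := x0; rewrite le_eqVlt => /predU1P[<-|x_gt0].
    by rewrite (driven_w0 s) mul0r normr0 mulr_ge0.
  have xn : 0 < x ^+ n by rewrite exprn_gt0.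
  rewrite normrM normfV (gtr0_norm xn) ler_pdivrMr //.
  apply: le_trans (wB x xin) _; rewrite -[leLHS]mulrA [leLHS]mulrC.
  apply: ler_wpM2r; first exact: ltW.
  by rewrite ler_wpM2l // (le_trans xr).
move: rin; rewrite in_itv/= => /andP[r0 rrho].
have := is_derive_lip (fun x (_ : x \in `[0, r]) => driven_du s x) vB r0.
rewrite subr0 => H; apply/eqP => ur.
have u0_gt0 : 0 < `|u 0| by rewrite normr_gt0.
have : `|u 0| <= 2^-1 * `|u 0|.
  move: H; rewrite ur sub0r normrN => /le_trans; apply.
  apply: (@le_trans _ _ (B * rho * rho)); first by rewrite ler_wpM2l // mulr_ge0.
  have -> : B * rho * rho = e * X * `|u 0| by rewrite /B /X; ring.
  by rewrite ler_wpM2r.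
lra.
Qed.

Variables U W : R -> R -> R.
Hypothesis fam : shooting_family n rho a g U W.

Local Notation final d := (angle n rho a g (U d) (W d) rho).

Let fam_shot d : shot n rho a g (U d) (W d) := (fam d).1.
Let fam0 d : U d 0 = d := (fam d).2.

Lemma final_angle_IVT (x y v : R) : 0 < x -> x <= y ->
  Num.min (final x) (final y) <= v <= Num.max (final x) (final y) ->
  exists2 d, d \in `[x, y] & final d = v.
Proof.
move=> x0 xy vI; apply: (@IVT _ (fun d => final d) x y v xy _ vI).
apply: continuous_in_subspaceT => d; rewrite inE/= in_itv/= => /andP[xd _].
have d0 : 0 < d by exact: lt_le_trans xd.
have [|eta [C [eta0 H]]] := angle_lip n_gt0 rho_gt0 aA gK g0 ca (fam_shot d).
  by rewrite fam0 gt_eqF.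
apply/cvgrPdist_lt => e e0.
have C0 : 0 < `|C| + 1 by rewrite ltr_wpDl.
near=> d'.
have dd' : `|d - d'| < Num.min eta (Num.min d (e / (`|C| + 1))).
  near: d'; apply: (@cvgr_dist_lt _ _ _ (nbhs d) _ id) => //.
  by rewrite !lt_min eta0 d0 divr_gt0.
move: dd'; rewrite !lt_min => /and3P[d_eta d_d d_e].
have d'0 : 0 < d' by move: d_d; rewrite ltr_norml => /andP[_]; lra.
have := H (U d') (W d') (fam_shot d').
rewrite !fam0 distrC => /(_ (negbT (gt_eqF d'0)) (ltW d_eta)) H'.
rewrite distrC; apply: le_lt_trans H' _.
move: d_e; rewrite ltr_pdivlMr // => /le_lt_trans; apply.
by rewrite mulrC ler_wpM2l // (le_trans (ler_norm C)) // lerDl.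
Unshelve. all: by end_near. Qed.

(** The maximum over the window is a Lipschitz function of the height, equal to
    [0] at height [0] and at least [1] at height [rho + 1]. *)
Lemma window_max_IVT (r1 r2 v : R) : 0 <= r1 -> r1 <= r2 -> r2 <= rho ->
  0 < v -> v < 1 ->
  exists d r, [/\ 0 < d, d < rho + 1, r \in `[r1, r2], `|U d r| = v &
    forall x, x \in `[r1, r2] -> `|U d x| <= v].
Proof.
move=> r10 r12 r2rho v0 v1.
have sub x : x \in `[r1, r2] -> x \in `[0, rho].
  rewrite !in_itv/= => /andP[r1x xr2].
  by rewrite (le_trans r10 r1x) (le_trans xr2 r2rho).
have /choice[T TP] : forall d, exists t, t \in `[r1, r2] /\
    forall x, x \in `[r1, r2] -> `|U d x| <= `|U d t|.
  move=> d; have [|t tin tP] := @EVT_max _ (fun x => `|U d x|) _ _ r12; last by exists t.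
  apply: continuous_subspaceT => x.
  exact: ctsR_comp (is_derive_continuous (driven_du (fam_shot d) x))
    (@norm_continuous _ R _).
pose M d := `|U d (T d)|.
have ML d d' : M d <= M d' + 2 * E * `|d - d'|.
  have [tin _] := TP d; have [_ tP'] := TP d'.
  have := shot_lip_unif (fam_shot d) (fam_shot d') (sub _ tin); rewrite !fam0 => H.
  have -> : M d = `|U d' (T d) + (U d (T d) - U d' (T d))| by rewrite addrC subrK.
  by apply: le_trans (ler_normD _ _) _; apply: lerD => //; exact: tP'.
have M_lip d d' : `|M d' - M d| <= 2 * E * `|d' - d|.
  rewrite ler_norml; have := ML d d'; have := ML d' d.
  by rewrite (distrC d d') => ? ?; apply/andP; split; lra.
have M0 : M 0 = 0.
  have := shot_le (fam_shot 0) (sub _ (TP 0).1).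
  by rewrite fam0 normr0 mulr0 normr_le0 => /eqP U0; rewrite /M U0 normr0.
have M1 : 1 <= M (rho + 1).
  have := shot_high (fam_shot _) (fam0 _) (sub _ (TP (rho + 1)).1).
  by move=> /le_trans; apply; exact: ler_norm.
have rho1 : 0 <= rho + 1 by rewrite addr_ge0.
have [||d din dv] := @IVT _ M 0 (rho + 1) v rho1.
- apply: continuous_subspaceT => x; apply: (@continuous_lip _ _ (2 * E)) => y.
  exact: M_lip.
- by rewrite M0 ge_min le_max (ltW v0) /= (le_trans (ltW v1) M1) orbT.
have [tin tP] := TP d.
move: din; rewrite in_itv/= => /andP[d0 d1].
exists d, (T d); split => //.
- rewrite lt_neqAle d0 andbT; apply/eqP => d_0.
  by move: v0; rewrite -dv -d_0 M0 ltxx.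
- rewrite lt_neqAle d1 andbT; apply/eqP => d_1.
  by move: v1; rewrite -dv d_1 ltNge M1.
- by move=> x /tP; rewrite -/(M d) dv.
Qed.

End initial_height.

Section many_solutions.
Variables (R : realType) (n : nat) (rho : R) (Q g : R -> R) (Qb K delta : R).
Variables (r1 r2 q0 : R).
Hypothesis (n_gt0 : (0 < n)%N) (rho_gt0 : 0 < rho).
Hypothesis (QQb : forall r, `|Q r| <= Qb).
Hypothesis (gK : forall x y, `|g x - g y| <= K * `|x - y|) (g0 : g 0 = 0).
Hypothesis cQ : continuous Q.
Hypothesis (r1_gt0 : 0 < r1) (r12 : r1 < r2) (r2_rho : r2 <= rho) (q0_gt0 : 0 < q0).
Hypothesis (Qq0 : forall r, r \in `[r1, r2] -> q0 <= Q r).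
Hypothesis (delta_gt0 : 0 < delta).
Hypothesis (g_sign : forall x, `|x| < delta -> x != 0 -> 0 < g x * x).

Let weight (lam : R) (r : R) : R := lam * Q r.

Let weight_le lam r : 0 < lam -> `|weight lam r| <= lam * Qb.
Proof. by move=> lam0; rewrite normrM gtr0_norm // ler_wpM2l // ltW. Qed.

Let continuous_weight lam : continuous (weight lam).
Proof.
move=> r; have c1 : {for r, continuous (fun _ : R => lam)} by exact: cst_continuous.
exact (ctsR_mul c1 (@cQ r)).
Qed.

(** The amplitude [c] is so small that [2 m] half turns of duration [7 c] fit in
    the window. *)
Lemma oscillating_height m : exists2 Lam : R, 0 < Lam &
  forall lam, Lam <= lam -> forall U W,
    shooting_family n rho (weight lam) g U W ->
    exists d, [/\ 0 < d, d < rho + 1 & alternates (U d) 0 rho m].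
Proof.
pose c : R := Num.min (delta / 2) (Num.min 2^-1 ((r2 - r1) / (14 * m.+1%:R))).
have c_gt0 : 0 < c.
  by rewrite !lt_min !divr_gt0 ?invr_gt0 ?subr_gt0 ?mulr_gt0 // ltr0n.
have [c1 c2 c3] : [/\ c <= delta / 2, c <= 2^-1 & c <= (r2 - r1) / (14 * m.+1%:R)].
  by rewrite /c; split; rewrite !ge_min lexx ?orbT.
have rpos r : r \in `[r1, r2] -> 0 < r.
  by rewrite in_itv/= => /andP[? _]; exact: lt_le_trans r1_gt0 _.
have rrho r : r \in `[r1, r2] -> r <= rho.
  by rewrite in_itv/= => /andP[_ rr2]; exact: le_trans rr2 r2_rho.
have r1n : 0 < r1 ^+ n by rewrite exprn_gt0.
have rhon : 0 < rho ^+ n by rewrite exprn_gt0.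
have Qb0 : 0 < Qb.
  have r1in : r1 \in `[r1, r2] by rewrite in_itv/= lexx ltW.
  apply: lt_le_trans (QQb r1); apply: lt_le_trans q0_gt0 _.
  exact: le_trans (Qq0 r1in) (ler_norm _).
pose a0 : R := r1 ^+ n * q0; pose a1 : R := rho ^+ n * Qb; pose b0 : R := (rho ^+ n)^-1.
have a0_gt0 : 0 < a0 by exact: mulr_gt0.
have b0_gt0 : 0 < b0 by rewrite invr_gt0.
have alE r : r \in `[r1, r2] -> a0 <= r ^+ n * Q r <= a1.
  move=> rin; have r0 := rpos r rin; have rle := rrho r rin; have Qr := Qq0 rin.
  have r1r : r1 <= r by move: rin; rewrite in_itv/= => /andP[].
  apply/andP; split.
    apply: ler_pM => //; [exact: ltW|exact: ltW|].
    by rewrite lerXn2r ?nnegrE // ltW.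
  apply: ler_pM => //; first by rewrite exprn_ge0 // ltW.
  - exact: le_trans (ltW q0_gt0) Qr.
  - by rewrite lerXn2r ?nnegrE // ltW.
  - exact: le_trans (ler_norm _) (QQb r).
have a01 : a0 <= a1.
  have /alE/andP[] : r1 \in `[r1, r2] by rewrite in_itv/= lexx ltW.
  exact: le_trans.
have gP : restoring c g.
  split=> x; first by apply: continuous_lip (gK^~ x).
  by move=> xc; apply: g_sign; apply: le_lt_trans xc _; lra.
have cm : 7 * c * m%:R <= (r2 - r1) / 2.
  move: c3; rewrite ler_pdivlMr ?mulr_gt0 ?ltr0n // -natr1 => c3.
  have : 0 <= c * m%:R by rewrite mulr_ge0 // ltW.
  by lra.
have [Lam Lam0 H] := window_turns a0_gt0 a01 b0_gt0 c_gt0 gP r12 cm.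
exists Lam => // lam Llam U W fam.
have lam0 : 0 < lam by exact: lt_le_trans Llam.
have c_lt1 : c < 1 by lra.
have [d [r [d0 d1 rin Ur Ux]]] := window_max_IVT rho_gt0
  (fun r => weight_le r lam0) gK g0 fam (ltW r1_gt0) (ltW r12) r2_rho c_gt0 c_lt1.
exists d; split => //; apply: (alternates_sub (ltW r1_gt0) r2_rho).
have [s _] := fam d.
apply: (H lam (fun r => r ^+ n * Q r) (fun r => (r ^+ n)^-1) r _ (W d)) => //.
split => // x xin.
- have x0 := rpos x xin; have xn : 0 < x ^+ n by rewrite exprn_gt0.
  rewrite /b0 lef_pV2 ?posrE //.
  by apply: (lerXn2r _ _ _ (rrho x xin)); rewrite nnegrE; exact: ltW.
- have xin' : x \in `[0, rho] by rewrite in_itv/= (ltW (rpos _ xin)) rrho.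
  by have := driven_du s x; rewrite (clamp_id xin') mulrC.
- have xin' : x \in `[0, rho] by rewrite in_itv/= (ltW (rpos _ xin)) rrho.
  have := driven_dw s x; rewrite (clamp_id xin') /weight.
  by rewrite (_ : x ^+ n * (lam * Q x) = lam * (x ^+ n * Q x)) //; ring.
Qed.

Hypothesis g_super : superlinear g.

(** Low and high trajectories do not turn, some intermediate one turns more
    than [k] times: each quantized final angle is hit on both sides. *)
Lemma two_heights (k : nat) : exists2 Lam : R, 0 < Lam &
  forall lam, Lam <= lam -> forall j, (1 <= j <= k)%N ->
    exists us ws ul wl : R -> R,
      [/\ shot n rho (weight lam) g us ws, shot n rho (weight lam) g ul wl,
          0 < us 0, us 0 < ul 0 & ul 0 <= rho + 1] /\
      angle n rho (weight lam) g us ws rho = cos_zero R j.+1 /\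
      angle n rho (weight lam) g ul wl rho = cos_zero R j.+1.
Proof.
have [Lam Lam0 H] := oscillating_height k.+1.
exists Lam => // lam Llam j /andP[j1 jk].
have lam0 : 0 < lam by exact: lt_le_trans Llam.
have aA r := weight_le r lam0.
have ca := @continuous_weight lam.
have [U [W fam]] := shooting_family_exists n_gt0 rho_gt0 aA gK ca.
have [d [d0 d1 alt]] := H lam Llam U W fam.
have [e0 e0_gt0 low] := shot_low n rho_gt0 aA gK g0 g_super.
pose e : R := Num.min e0 (d / 2).
have e_gt0 : 0 < e by rewrite lt_min e0_gt0 divr_gt0.
have [ee0 ed] : e <= e0 /\ e <= d / 2 by rewrite !ge_min !lexx orbT.
pose final x := angle n rho (weight lam) g (U x) (W x) rho.
have small x : 0 < x -> (forall r, r \in `[0, rho] -> U x r != 0) ->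
    final x < cos_zero R j.+1.
  move=> x0 xN0; have [s Ux0] := fam x.
  apply: lt_le_trans (@cos_zero_le R 1 j.+1 isT).
  by apply: (angle_small n_gt0 rho_gt0 aA gK g0 ca s) => //; rewrite Ux0 gt_eqF.
have final_e : final e < cos_zero R j.+1.
  have [s Ue] := fam e; apply: small => //; apply: (low _ _ s); rewrite Ue.
    by rewrite gt_eqF.
  by rewrite gtr0_norm.
have rho1 : 0 < rho + 1 by rewrite addr_gt0.
have final_hi : final (rho + 1) < cos_zero R j.+1.
  have [s Ue] := fam (rho + 1); apply: small => // r rin.
  by rewrite gt_eqF // (lt_le_trans ltr01) // (shot_high s Ue rin).
have final_d : cos_zero R j.+1 < final d.
  have [s Ud] := fam d; have Ud0 : U d 0 != 0 by rewrite Ud gt_eqF.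
  case: alt => x [xin xalt].
  apply: le_lt_trans (@cos_zero_le R j.+1 k.+1 jk) _.
  have H' : cos_zero R k.+1 < angle n rho (weight lam) g (U d) (W d) (x k.+1).
    apply: (angle_alternating n_gt0 rho_gt0 aA gK g0 ca s Ud0) => // i ik.
    - by have [] := xalt i ik.
    - by have [] := xalt i ik.
  have := xin k.+1 (leqnn _); rewrite in_itv/= => /andP[x0].
  rewrite le_eqVlt => /predU1P[xE|xrho]; first by rewrite xE in H'.
  exact (angle_upcrossing n_gt0 rho_gt0 aA gK g0 ca s Ud0 x0 xrho (lexx rho) (ltW H')).
have ed' : e <= d by lra.
have [|ds dsin fs] := final_angle_IVT n_gt0 rho_gt0 aA gK g0 ca fam
    (v := cos_zero R j.+1) e_gt0 ed'.
  by rewrite ge_min le_max (ltW final_e) (ltW final_d) orbT.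
have [|dl dlin fl] := final_angle_IVT n_gt0 rho_gt0 aA gK g0 ca fam
    (v := cos_zero R j.+1) d0 (ltW d1).
  by rewrite ge_min le_max (ltW final_hi) (ltW final_d) orbT.
move: dsin dlin; rewrite !in_itv/= => /andP[eds dsd] /andP[ddl dl1].
exists (U ds), (W ds), (U dl), (W dl).
have [ss Us] := fam ds; have [sl Ul] := fam dl; rewrite Us Ul.
split=> //; split=> //; first exact: lt_le_trans eds.
have ds_lt : ds < d.
  by rewrite lt_neqAle dsd andbT; apply: contraTneq final_d => <-;
    rewrite -leNgt /final fs.
exact: lt_le_trans ds_lt ddl.
Qed.

End many_solutions.

(** * Nodal domains of radial functions *)

Section euclidean.
Variables (R : realType) (N : nat).
Implicit Types x y z : 'rV[R]_N.
Local Notation norm := (@euclidean_norm R N).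

Lemma enorm_ge0 x : 0 <= norm x.
Proof. exact: sqrtr_ge0. Qed.

Lemma enormZ (t : R) x : norm (t *: x) = `|t| * norm x.
Proof.
rewrite /euclidean_norm -sqrtr_sqr -sqrtrM ?sqr_ge0 // mulr_sumr.
by congr Num.sqrt; apply: eq_bigr => i _; rewrite mxE exprMn.
Qed.

Lemma enorm0 : norm 0 = 0.
Proof. by rewrite -[0 in LHS](scale0r 0) enormZ normr0 mul0r. Qed.

Lemma enorm_eq0 x : norm x = 0 -> x = 0.
Proof.
move=> /eqP; rewrite sqrtr_eq0 => x0; apply/rowP => i; rewrite mxE.
have S0 : \sum_(i < N) x ord0 i ^+ 2 == 0.
  by rewrite eq_le x0 sumr_ge0 // => j _; exact: sqr_ge0.
move: S0; rewrite psumr_eq0; last by move=> j _; exact: sqr_ge0.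
by move=> /allP/(_ i (mem_index_enum _))/= ; rewrite sqrf_eq0 => /eqP.
Qed.

Lemma enorm_gt0 x : x != 0 -> 0 < norm x.
Proof.
move=> x0; rewrite lt_neqAle enorm_ge0 andbT eq_sym.
by apply: contra_neq x0; exact: enorm_eq0.
Qed.

Lemma enorm_delta j : norm (delta_mx ord0 j) = 1.
Proof.
rewrite /euclidean_norm (bigD1 j) //= mxE !eqxx expr1n big1 ?addr0 ?sqrtr1 //.
by move=> i ij; rewrite mxE eqxx (negbTE ij) expr0n.
Qed.

Lemma continuous_enorm : continuous norm.
Proof.
have cs : continuous (fun x : 'rV[R]_N => \sum_(i < N) x ord0 i ^+ 2).
  apply: continuous_big; first exact: add_continuous.
  move=> i _ x.
  apply: (@continuous_comp _ _ _ (fun x : 'rV[R]_N => x ord0 i) (fun t : R => t ^+ 2)).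
    exact: coord_continuous.
  exact: exprn_continuous.
by move=> x; exact: continuous_comp (cs x) (@sqrt_continuous R _).
Qed.

(** The path from [x] to [y] that turns along the segment and interpolates
    the norm; it exists as soon as the segment avoids the origin. *)
Lemma radial_path (I : set R) x y :
  is_interval I -> I (norm x) -> I (norm y) ->
  (forall t : R, 0 <= t <= 1 -> (1 - t) *: x + t *: y != 0) ->
  connected_component [set z | I (norm z)] x y.
Proof.
move=> Iitv Ix Iy p0.
pose p (t : R) : 'rV[R]_N := (1 - t) *: x + t *: y.
pose m (t : R) : R := (1 - t) * norm x + t * norm y.
pose f (t : R) : 'rV[R]_N := (m t / norm (p t)) *: p t.
have itv01 (t : R) : t \in `[0, 1] -> 0 <= t <= 1 by rewrite in_itv.
have pn t : t \in `[0, 1] -> 0 < norm (p t) by move=> /itv01/p0/enorm_gt0.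
have m0 t : t \in `[0, 1] -> 0 <= m t.
  by move=> /itv01/andP[t0 t1]; rewrite addr_ge0 // mulr_ge0 ?enorm_ge0 ?subr_ge0.
have fn t : t \in `[0, 1] -> norm (f t) = m t.
  move=> tin; rewrite enormZ normrM normfV (gtr0_norm (pn t tin)).
  by rewrite divfK ?gt_eqF ?pn // ger0_norm ?m0.
have in0 : 0 \in `[0, 1 : R] by rewrite in_itv/= lexx ler01.
have in1 : 1 \in `[0, 1 : R] by rewrite in_itv/= lexx ler01.
have f0 : f 0 = x.
  have e : p 0 = x by rewrite /p subr0 scale1r scale0r addr0.
  have := pn 0 in0; rewrite /f e /m subr0 mul1r mul0r addr0 => xn.
  by rewrite divff ?gt_eqF // scale1r.
have f1 : f 1 = y.
  have e : p 1 = y by rewrite /p subrr scale1r scale0r add0r.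
  have := pn 1 in1; rewrite /f e /m subrr mul1r mul0r add0r => yn.
  by rewrite divff ?gt_eqF // scale1r.
exists (f @` `[0, 1]); last by exists 1 => //=; exact: in1.
split.
- by exists 0 => //=; exact: in0.
- move=> _ [t tin <-] /=; rewrite (fn t tin).
  have /andP[t0 t1] := itv01 t tin.
  have [xy|yx] := leP (norm x) (norm y).
    apply: (Iitv _ _ Ix Iy); rewrite /m; apply/andP; split.
      have : 0 <= t * (norm y - norm x) by rewrite mulr_ge0 ?subr_ge0.
      by lra.
    have : 0 <= (1 - t) * (norm y - norm x) by rewrite mulr_ge0 ?subr_ge0.
    by lra.
  apply: (Iitv _ _ Iy Ix); rewrite /m; apply/andP; split.
    have : 0 <= (1 - t) * (norm x - norm y) by rewrite mulr_ge0 ?subr_ge0 // ltW.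
    by lra.
  have : 0 <= t * (norm x - norm y) by rewrite mulr_ge0 ?subr_ge0 // ltW.
  by lra.
- apply: connected_continuous_connected; first exact: segment_connected.
  apply: continuous_in_subspaceT => t; rewrite inE => tin.
  have c1t : {for t, continuous (fun t : R => 1 - t)}.
    by apply: continuousB; [exact: cst_continuous | exact: cvg_id].
  have cid : {for t, continuous (fun t : R => t)} by exact: cvg_id.
  have cp : {for t, continuous p}.
    by apply: continuousD; apply: continuousZr_tmp.
  have cm : {for t, continuous m}.
    have cc (k : R) : {for t, continuous (fun _ : R => k)} by exact: cst_continuous.
    exact (ctsR_add (ctsR_mul c1t (cc _)) (ctsR_mul cid (cc _))).
  have cn : {for t, continuous (fun t => norm (p t))}.
    by apply: continuous_comp cp _; exact: continuous_enorm.
  apply: continuousZ cp; apply: ctsR_mul cm (ctsR_inv cn _).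
  by rewrite gt_eqF // pn.
Qed.

(** Spheres of dimension at least one are connected: antipodal directions
    are joined through a third one. *)
Lemma radial_connected (I : set R) : (2 <= N)%N -> is_interval I ->
  connected [set z : 'rV[R]_N | I (norm z)].
Proof.
move=> N2 Iitv; set A := [set z | _].
have origin y : A 0 -> A y -> connected_component A 0 y.
  rewrite /A /= enorm0 => I0 Iy.
  exists ((fun t : R => t *: y) @` `[0, 1]); last first.
    by exists 1 => /=; rewrite ?scale1r // in_itv/= lexx ler01.
  split.
  - by exists 0 => /=; rewrite ?scale0r // in_itv/= lexx ler01.
  - move=> _ [t tin <-] /=; rewrite /A /= enormZ.
    move: tin; rewrite /= in_itv/= => /andP[t0 t1].
    apply: (Iitv _ _ I0 Iy); rewrite mulr_ge0 ?enorm_ge0 //= ger0_norm //.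
    by rewrite ler_piMl // enorm_ge0.
  - apply: connected_continuous_connected; first exact: segment_connected.
    apply: continuous_subspaceT => t.
    by apply: continuousZr_tmp; exact: cvg_id.
have joined x y : A x -> A y -> connected_component A x y.
  move=> Ax Ay.
  have [x0|xN0] := eqVneq x 0; first by rewrite x0 in Ax *; exact: origin.
  have [y0|yN0] := eqVneq y 0.
    by rewrite y0 in Ay *; apply: connected_component_sym; exact: origin.
  have [p0|] := pselect (forall t : R, 0 <= t <= 1 -> (1 - t) *: x + t *: y != 0).
    exact: radial_path.
  move=> /existsNP[t0 /not_implyP[t01 /negP]]; rewrite negbK => /eqP pt0.
  have [i xi0] : exists i, x ord0 i != 0.
    apply: contrapT => H; move/negP: xN0; apply; apply/eqP/rowP => i.
    by rewrite mxE; apply/eqP/negPn/negP => xi; apply: H; exists i.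
  have rel k : (1 - t0) * x ord0 k + t0 * y ord0 k = 0.
    by move/rowP: pt0 => /(_ k); rewrite !mxE.
  have yi0 : y ord0 i != 0.
    apply/eqP => yi; have := rel i; rewrite yi mulr0 addr0 => /eqP.
    rewrite mulf_eq0 (negbTE xi0) orbF subr_eq0 => /eqP t0E.
    move/eqP: yN0; apply; apply/rowP => k.
    by have := rel k; rewrite -t0E subrr mul0r add0r mul1r mxE.
  have [j ji] : exists j : 'I_N, j != i.
    have [i0|i0] := eqVneq (val i) 0%N.
      by exists (Ordinal N2); rewrite -val_eqE /= i0.
    by exists (Ordinal (ltnW N2)); rewrite -val_eqE /= eq_sym.
  have xn := enorm_gt0 xN0.
  have [z [zn zi zj]] : exists z : 'rV[R]_N,
      [/\ norm z = norm x, z ord0 i = 0 & z ord0 j = norm x].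
    exists (norm x *: delta_mx ord0 j); rewrite !mxE !eqxx eq_sym (negbTE ji).
    by rewrite enormZ enorm_delta !mulr1 mulr0 gtr0_norm.
  have Az : A z by rewrite /A /= zn.
  apply: (@connected_component_trans _ _ z); apply: radial_path => //.
    move=> t _; apply/eqP => /rowP E.
    have := E i; rewrite !mxE zi mulr0 addr0 => /eqP.
    rewrite mulf_eq0 (negbTE xi0) orbF subr_eq0 => /eqP tE.
    have := E j; rewrite !mxE zj -tE subrr mul0r add0r mul1r => xn0.
    by rewrite xn0 ltxx in xn.
  move=> t _; apply/eqP => /rowP E.
  have := E i; rewrite !mxE zi mulr0 add0r => /eqP.
  rewrite mulf_eq0 (negbTE yi0) orbF => /eqP tE.
  have := E j; rewrite !mxE zj tE subr0 mul1r mul0r addr0 => xn0.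
  by rewrite xn0 ltxx in xn.
have [[x Ax]|A0] := pselect (A !=set0); last first.
  have -> : A = set0 by apply/seteqP; split => // y Ay; apply: A0; exists y.
  exact: connected0.
have -> : A = connected_component A x.
  apply/seteqP; split; last exact: connected_component_sub.
  by move=> y; exact: joined.
exact: component_connected.
Qed.

End euclidean.

Section nodal_domains_of_shot.
Variables (R : realType) (N : nat) (rho : R) (a g : R -> R) (A K : R).
Hypothesis (N_ge2 : (2 <= N)%N) (rho_gt0 : 0 < rho).
Hypothesis (aA : forall r, `|a r| <= A).
Hypothesis (gK : forall x y, `|g x - g y| <= K * `|x - y|) (g0 : g 0 = 0).
Hypothesis ca : continuous a.
Variables (u w : R -> R) (j : nat).
Hypothesis (s : shot N.-1 rho a g u w) (u0 : u 0 != 0).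

Local Notation theta := (angle N.-1 rho a g u w).
Local Notation norm := (@euclidean_norm R N).
Local Notation level := (cos_zero R).

Hypothesis theta_rho : theta rho = level j.+1.

Let n_gt0 : (0 < N.-1)%N.
Proof. by case: N N_ge2 => [|[]]. Qed.

Let eq0P := shot_eq0P n_gt0 rho_gt0 aA gK g0 ca s u0.
Let upcross := @angle_upcrossing _ _ _ _ _ _ _ n_gt0 rho_gt0 aA gK g0 ca _ _ s u0.
Let lo := angle_gt_level0 n_gt0 rho_gt0 aA gK g0 ca s u0.
Let theta_IVT := @angle_IVT _ _ _ _ _ _ _ n_gt0 rho_gt0 aA gK g0 ca _ _ s u0.
Let ctheta := continuous_angle n_gt0 rho_gt0 aA gK g0 ca s u0.

Lemma shot_eq0_final : u rho = 0.
Proof.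
by apply/eqP; rewrite eq0P ?theta_rho ?cos_cos_zero // in_itv/= lexx ltW.
Qed.

Let radii m : set R := [set r | 0 <= r < rho /\ level m < theta r < level m.+1].

Let domain m : set 'rV[R]_N := [set x | radii m (norm x)].

Let radii_interval m : is_interval (radii m).
Proof.
move=> r1 r2 [/andP[r10 r1rho] /andP[lo1 hi1]] [/andP[r20 r2rho] /andP[lo2 hi2]].
move=> r /andP[r1r rr2].
have r0 := le_trans r10 r1r; have rrho := le_lt_trans rr2 r2rho.
split; first by rewrite r0.
apply/andP; split.
  move: r1r; rewrite le_eqVlt => /predU1P[<-//|r1r].
  by apply: (upcross r10 r1r (ltW rrho)); exact: ltW.
rewrite ltNge; apply/negP => H.
move: rr2; rewrite le_eqVlt => /predU1P[rE|rr2].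
  by move: hi2; rewrite -rE ltNge H.
by have := upcross r0 rr2 (ltW r2rho) H; rewrite ltNge (ltW hi2).
Qed.

Let domain_connected m : connected (domain m).
Proof. exact: radial_connected N_ge2 (@radii_interval m). Qed.

Let domain_sub m : domain m `<=` nonzero_set rho u.
Proof.
move=> x [/andP[x0 xrho] xm]; split => //=.
have xin : norm x \in `[0, rho] by rewrite in_itv/= x0 ltW.
by rewrite /radial eq0P // (cos_neq0_between xm).
Qed.

Let domain_cover x : nonzero_set rho u x -> exists2 m, (m < j.+1)%N & domain m x.
Proof.
move=> [xrho ux]; have x0 := enorm_ge0 x.
have xin : norm x \in `[0, rho] by rewrite in_itv/= x0 ltW.
have [|m mI] := between_cos_zero (lo xin).
  by move: ux; rewrite /= /radial eq0P.
exists m; last by split => //; rewrite x0.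
rewrite ltnNge; apply/negP => jm; have /andP[H _] := mI.
have := upcross x0 xrho (lexx rho) (ltW (le_lt_trans (@cos_zero_le R _ _ jm) H)).
by rewrite theta_rho ltxx.
Qed.

Let domain_inj m m' x : domain m x -> domain m' x -> m = m'.
Proof.
move=> [_ /andP[l1 h1]] [_ /andP[l2 h2]]; apply/eqP; rewrite eqn_leq.
apply/andP; split; rewrite leqNgt; apply/negP => mm'.
  by have := lt_le_trans h2 (@cos_zero_le R _ _ mm'); rewrite ltNge (ltW l1).
by have := lt_le_trans h1 (@cos_zero_le R _ _ mm'); rewrite ltNge (ltW l2).
Qed.

Let mid_pi m : level m < m%:R * pi < level m.+1.
Proof.
by rewrite cos_zeroS /cos_zero; have := pi_gt0 R => ?; apply/andP; split; lra.
Qed.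

Lemma angle_mid m : (m <= j)%N ->
  exists x : 'rV[R]_N, norm x < rho /\ theta (norm x) = m%:R * pi.
Proof.
move=> mj; have pi0 := pi_gt0 R.
have [||z zin zE] := @theta_IVT (m%:R * pi) 0 rho (ltW rho_gt0).
- by rewrite angle0 mulr_ge0 // ltW.
- rewrite theta_rho; have /andP[_ H] := mid_pi m.
  by apply: le_trans (ltW H) _; exact: cos_zero_le.
move: zin; rewrite in_itv/= => /andP[z0 zrho].
have i0 : 'I_N by exact: Ordinal (ltnW N_ge2).
exists (z *: delta_mx ord0 i0); rewrite enormZ enorm_delta mulr1 ger0_norm //.
split=> //; rewrite lt_neqAle zrho andbT; apply/eqP => z_rho.
have /andP[_] := mid_pi m; rewrite -zE z_rho theta_rho.
by rewrite ltNge cos_zero_le.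
Qed.

Let domain_neq0 m : (m <= j)%N -> domain m !=set0.
Proof.
move=> /angle_mid[x [xrho xE]]; exists x; split; rewrite ?enorm_ge0 //= xE.
exact: mid_pi.
Qed.

(** On a connected subset of the nonzero set the angle avoids all levels, hence
    stays between the same two. *)
Let domain_component m x : domain m x ->
  connected_component (nonzero_set rho u) x = domain m.
Proof.
move=> mx; apply/seteqP; split; last first.
  exact: connected_component_max mx (@domain_sub m) (@domain_connected m).
move=> y xy; have yN0 := connected_component_sub xy.
have [m' _ m'y] := domain_cover yN0.
suff -> : m = m' by [].
pose C := connected_component (nonzero_set rho u) x.
have Cx : C x by apply: connected_component_refl; exact: domain_sub mx.
have cC : is_interval ((fun z => theta (norm z)) @` C).
  apply/connected_intervalP; apply: connected_continuous_connected.
    exact: component_connected.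
  apply: continuous_subspaceT => z.
  exact: continuous_comp (@continuous_enorm R N z) (@ctheta _).
have no_level i : ~ ((fun z => theta (norm z)) @` C) (level i).
  move=> [z Cz zE]; have [/= zrho /negP] := connected_component_sub Cz; apply.
  rewrite /radial eq0P ?zE ?cos_cos_zero // in_itv/= enorm_ge0.
  exact: ltW.
have Tx : ((fun z => theta (norm z)) @` C) (theta (norm x)) by exists x.
have Ty : ((fun z => theta (norm z)) @` C) (theta (norm y)) by exists y.
have [_ /andP[l1 h1]] := mx; have [_ /andP[l2 h2]] := m'y.
apply/eqP; rewrite eqn_leq.
apply/andP; split; rewrite leqNgt; apply/negP => mm'; exfalso.
  apply: (@no_level m); apply: (cC _ _ Ty Tx); rewrite (ltW l1) andbT.
  by apply/ltW/(lt_le_trans h2); exact: cos_zero_le.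
apply: (@no_level m'); apply: (cC _ _ Tx Ty); rewrite (ltW l2) andbT.
by apply/ltW/(lt_le_trans h1); exact: cos_zero_le.
Qed.

Lemma shot_nodal_domains : (nodal_domains N rho u #= `I_j.+1)%card.
Proof.
have -> : nodal_domains N rho u = domain @` `I_j.+1.
  apply/seteqP; split=> [_ [x xN0 <-]|_ [m /= mj <-]].
    have [m mj mx] := domain_cover xN0.
    by exists m => //; rewrite (domain_component mx).
  have [x mx] := domain_neq0 (mj : (m <= j)%N).
  by exists x; [exact: domain_sub mx | exact: domain_component].
apply: inj_card_eq => m m' mj _ mm'.
rewrite inE /= ltnS in mj; have [x mx] := domain_neq0 mj.
by apply: (domain_inj mx); rewrite -mm'.
Qed.

Lemma shot_sign_changing : (1 <= j)%N -> sign_changing N rho u.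
Proof.
move=> j1; have [y [yrho yE]] := angle_mid j1.
have := shot_angle_pi n_gt0 rho_gt0 aA gK g0 ca s u0 (r := norm y).
rewrite in_itv/= enorm_ge0 (ltW yrho) yE mul1r => /(_ isT erefl) uu.
have B0 : euclidean_ball rho (0 : 'rV[R]_N) by rewrite /euclidean_ball /= enorm0.
have r0 : radial u (0 : 'rV[R]_N) = u 0 by rewrite /radial enorm0.
have [u_lt0|u_gt0|u00] := ltrgt0P (u 0).
- exists y, 0; split => //; rewrite ?r0 // /radial.
  by move: uu; rewrite pmulr_rlt0.
- exists 0, y; split => //; rewrite ?r0 // /radial.
  by move: uu; rewrite nmulr_rlt0.
- by move: u0; rewrite u00 eqxx.
Qed.

End nodal_domains_of_shot.

Lemma nodal_domains_opp (R : realType) (N : nat) (rho : R) (u : R -> R) :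
  nodal_domains N rho (fun r => - u r) = nodal_domains N rho u.
Proof.
rewrite /nodal_domains (_ : nonzero_set rho _ = nonzero_set rho u) //.
by apply/seteqP; split => x [xB xN0]; split => //; move: xN0;
  rewrite /= /radial oppr_eq0.
Qed.

Lemma sign_changing_opp (R : realType) (N : nat) (rho : R) (u : R -> R) :
  sign_changing N rho u -> sign_changing N rho (fun r => - u r).
Proof.
move=> [x [y [Bx By ux uy]]]; exists y, x; split => //; rewrite /radial.
  by rewrite oppr_lt0.
by rewrite oppr_gt0.
Qed.

Lemma C1_with_derive (R : realType) (a b : R) (F f df : R -> R) :
  (forall x, x \in `[a, b] -> f x = F x) ->
  (forall x : R, x \in `[a, b] -> is_derive x 1 F (df x)) ->
  {within `[a, b], continuous df} -> C1_with a b f df.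
Proof.
move=> fF dF cdf; split => // x xin.
have /is_derive1_caratheodory[h [hE ch hx]] := dF x xin.
rewrite -hx.
have H : h y @[y --> within `[a, b] x^'] --> h x.
  apply: cvg_within_filter; apply: cvg_within_filter; exact: ch.
apply: cvg_trans H; apply: near_eq_cvg.
rewrite near_withinE; near=> y => yin.
rewrite (fF y yin) (fF x xin) hE mulfK // subr_eq0.
near: y; exact: nbhs_dnbhs_neq.
Unshelve. all: by end_near. Qed.

Lemma shot_radial_solution (R : realType) (N : nat) (rho lam : R)
    (q g h : R -> R) (u w : R -> R) : (2 <= N)%N -> 0 < rho ->
  continuous (fun r => q (clamp 0 rho r)) -> continuous g ->
  shot N.-1 rho (fun r => lam * q (clamp 0 rho r)) g u w ->
  (forall r, r \in `[0, rho] -> h (u r) = g (u r)) -> u rho = 0 ->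
  radial_solution N rho q h lam u.
Proof.
move=> N2 rho0 cq cg s hg urho; have rho_ge0 := ltW rho0.
have n_gt0 : (0 < N.-1)%N by rewrite -ltnS prednK // ltnW.
pose c := clamp 0 rho.
pose du r := psi (w (c r) / c r ^+ N.-1).
pose dw r := - (c r ^+ N.-1 * (lam * q (c r)) * g (u (c r))).
have zin : 0 \in `[0, rho] by rewrite in_itv/= lexx.
have rhoin : rho \in `[0, rho] by rewrite in_itv/= lexx rho_ge0.
have cid r : r \in `[0, rho] -> c r = r by exact: clamp_id.
have cc := @continuous_clamp R 0 rho.
have cdw : continuous dw.
  move=> r.
  have clam : {for r, continuous (fun _ : R => lam)} by exact: cst_continuous.
  have cu := ctsR_comp (cc r) (is_derive_continuous (driven_du s _)).
  exact (ctsR_opp (ctsR_mul (ctsR_mul (ctsR_exp N.-1 (cc r))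
    (ctsR_mul clam (cq r))) (ctsR_comp cu (cg _)))).
have [t tin tmax] : exists2 t, t \in `[0, rho] &
    forall r, r \in `[0, rho] -> `|lam * q (c r) * g (u r)| <= `|lam * q (c t) * g (u t)|.
  apply: EVT_max => //; apply: continuous_subspaceT => r.
  have clam : {for r, continuous (fun _ : R => lam)} by exact: cst_continuous.
  have cu := is_derive_continuous (driven_du s r).
  exact: ctsR_comp (ctsR_mul (ctsR_mul clam (cq r)) (ctsR_comp cu (cg _)))
    (@norm_continuous _ R _).
have wB := driven_w_le (h := u) (driven_dw s) (driven_w0 s) tmax.
have cv := continuous_velocity n_gt0 rho0
  (in1W (fun x => is_derive_continuous (driven_dw s x))) wB.
exists du, dw; split.
- apply: (@C1_with_derive _ _ _ u) => // [x _|]; first exact: driven_du s x.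
  apply: continuous_subspaceT => x.
  exact (ctsR_comp (cv x) (@continuous_psi R _)).
- by move=> r _; exact: psi_norm_lt1.
- apply: (@C1_with_derive _ _ _ w) => // [x xin|x _|].
  + rewrite /du phi_psi cid //.
    have [->|x0] := eqVneq x 0.
      by rewrite expr0n gtn_eqF // mul0r (driven_w0 s).
    by rewrite mulrC divfK // expf_neq0.
  + exact: driven_dw s x.
  + exact: continuous_subspaceT.
- move=> r rin; rewrite /dw (cid r rin) hg //; ring.
- by rewrite /du cid // (driven_w0 s) mul0r psi0.
Qed.

(** * The four families of solutions *)

Definition lipschitz_between (R : realType) (K a b : R) (f : R -> R) : Prop :=
  forall x y, x \in `[a, b] -> y \in `[a, b] -> `|f x - f y| <= K * `|x - y|.

Lemma locally_lipschitz_ball (R : realType) (f : R -> R) (x : R) :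
  locally_lipschitz f -> exists e K : R, 0 < e /\
    forall y z, `|y - x| < e -> `|z - x| < e -> `|f y - f z| <= K * `|y - z|.
Proof.
move=> /(_ x)[V /nbhs_ballP[e /= e0 eV] fV].
have [K fK] := @filter_ex R (pinfty_nbhs R) _ _ fV.
exists e, K; split=> // y z yx zx.
by apply: (fK (y, z)); split; apply: eV; rewrite /ball /= distrC.
Qed.

Lemma lipschitz_between_glue (R : realType) (K K' a t b : R) (f : R -> R) :
  a <= t -> t <= b -> lipschitz_between K a t f -> lipschitz_between K' t b f ->
  lipschitz_between (`|K| + `|K'|) a b f.
Proof.
move=> at_ tb fK fK'.
have le1 (x : R) : K * `|x| <= (`|K| + `|K'|) * `|x|.
  by rewrite ler_wpM2r // (le_trans (ler_norm K)) // lerDl.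
have le2 (x : R) : K' * `|x| <= (`|K| + `|K'|) * `|x|.
  by rewrite ler_wpM2r // (le_trans (ler_norm K')) // lerDr.
move=> x y; wlog xy : x y / x <= y.
  move=> H xin yin; have [xy|/ltW yx] := leP x y; first exact: H.
  by rewrite distrC [`|x - y|]distrC; exact: H.
rewrite !in_itv/= => /andP[ax xb] /andP[ay yb].
have [yt|ty] := leP y t.
  by apply: le_trans (le1 _); apply: fK; rewrite in_itv/= ?ax ?ay ?(le_trans xy).
have [tx|xt] := leP t x.
  by apply: le_trans (le2 _); apply: fK'; rewrite in_itv/= ?tx ?xb ?(ltW ty).
have -> : f x - f y = (f x - f t) + (f t - f y) by ring.
apply: le_trans (ler_normD _ _) _.
have tin1 : t \in `[a, t] by rewrite in_itv/= at_ lexx.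
have tin2 : t \in `[t, b] by rewrite in_itv/= lexx tb.
have xin : x \in `[a, t] by rewrite in_itv/= ax ltW.
have yin : y \in `[t, b] by rewrite in_itv/= (ltW ty) yb.
have -> : `|x - y| = `|x - t| + `|t - y|.
  rewrite (@ler0_norm _ (x - y)) ?subr_le0 // (@ler0_norm _ (x - t)) ?subr_le0 ?ltW //.
  by rewrite (@ler0_norm _ (t - y)) ?subr_le0 ?ltW //; ring.
rewrite mulrDr.
apply: lerD; first exact: le_trans (fK _ _ xin tin1) (le1 _).
exact: le_trans (fK' _ _ tin2 yin) (le2 _).
Qed.

(** Follow the Lipschitz property from [a] as far as it goes. *)
Lemma locally_lipschitz_segment (R : realType) (f : R -> R) (a b : R) :
  a <= b -> locally_lipschitz f -> exists K, lipschitz_between K a b f.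
Proof.
move=> ab fl.
pose E := [set t | a <= t <= b /\ exists K, lipschitz_between K a t f].
have Ea : E a.
  split; first by rewrite lexx ab.
  exists 0 => x y; rewrite !in_itv/= -!eq_le => /eqP <- /eqP <-.
  by rewrite !subrr !normr0 mulr0.
have supE : has_sup E by split; [exists a | exists b => t [/andP[]]].
have [s sE] : exists s, s = sup E by exists (sup E).
have as_ : a <= s by rewrite sE; apply: ub_le_sup; [case: supE | ].
have sb : s <= b by rewrite sE; apply: ge_sup; [exists a | move=> t [/andP[]]].
have [e [K' [e0 fK']]] := locally_lipschitz_ball s fl.
have [t [[/andP[at_ tb] [K fK]] st]] := sup_adherent e0 supE.
have ts : t <= s.
  by rewrite sE; apply: ub_le_sup; [case: supE | split; [rewrite at_|exists K]].
rewrite -sE in st.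
pose t' : R := Num.min b (s + e / 2).
have t't : t <= t' by rewrite le_min tb /=; lra.
have t's : t' <= s + e / 2 by rewrite ge_min lexx orbT.
have fK2 : lipschitz_between K' t t' f.
  move=> x y; rewrite !in_itv/= => /andP[tx xt'] /andP[ty yt'].
  by apply: fK'; rewrite ltr_norml; apply/andP; split; lra.
have fK3 := lipschitz_between_glue at_ t't fK fK2.
have [b_le|s_lt] := leP b (s + e / 2).
  by exists (`|K| + `|K'|); have <- : t' = b by rewrite /t' min_l.
have t'E : t' = s + e / 2 by rewrite /t' min_r // ltW.
have : t' <= s.
  rewrite sE; apply: ub_le_sup; first by case: supE.
  split; last by exists (`|K| + `|K'|).
  by rewrite (le_trans at_ t't) t'E ltW.
by rewrite t'E leNgt ltrDl divr_gt0.
Qed.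

Lemma nodal_domains_eq (R : realType) (N : nat) (rho : R) (u v : R -> R) :
  {in `[0, rho], u =1 v} -> nodal_domains N rho u = nodal_domains N rho v.
Proof.
move=> uv; rewrite /nodal_domains (_ : nonzero_set rho _ = nonzero_set rho v) //.
by apply/seteqP; split => x [xB xN0]; split => //; move: xN0; move: xB;
  rewrite /= /euclidean_ball /radial /= => xB;
  rewrite uv // in_itv/= enorm_ge0 ltW.
Qed.

Lemma nodal_solution_inj (R : realType) (N : nat) (rho lam : R) (q g u v : R -> R)
    (m m' : nat) :
  nodal_solution N rho q g lam m u -> nodal_solution N rho q g lam m' v ->
  {in `[0, rho], u =1 v} -> m = m'.
Proof.
move=> [_ um] [_ vm] uv; apply/card_eq_II.
by apply: card_eq_trans vm; rewrite card_eq_sym -(nodal_domains_eq N uv).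
Qed.

Lemma shot_opp (R : realType) (n : nat) (rho : R) (a g u w : R -> R) :
  shot n rho a (fun x => - g (- x)) u w ->
  shot n rho a g (fun r => - u r) (fun r => - w r).
Proof.
move=> [w0 du dw]; split; first by rewrite w0 oppr0.
- by move=> r; rewrite mulNr psiN; exact: derR_opp (du r).
- move=> r; apply: (is_derive_eq (derR_opp (dw r))); ring.
Qed.

Section pairs.
Variables (R : realType) (N : nat) (rho : R) (q g gB : R -> R) (Qb K delta : R).
Variables (r1 r2 q0 : R).
Hypothesis (N_ge2 : (2 <= N)%N) (rho_gt0 : 0 < rho).
Hypothesis cQ : continuous (fun r => q (clamp 0 rho r)).
Hypothesis (QQb : forall r, `|q (clamp 0 rho r)| <= Qb).
Hypothesis (gK : forall x y, `|gB x - gB y| <= K * `|x - y|) (g0 : gB 0 = 0).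
Hypothesis (gE : forall x, `|x| <= 2 * rho + 1 -> g x = gB x).
Hypothesis (r1_gt0 : 0 < r1) (r12 : r1 < r2) (r2_rho : r2 <= rho) (q0_gt0 : 0 < q0).
Hypothesis (Qq0 : forall r, r \in `[r1, r2] -> q0 <= q (clamp 0 rho r)).
Hypothesis (delta_gt0 : 0 < delta).
Hypothesis (g_sign : forall x, `|x| < delta -> x != 0 -> 0 < gB x * x).
Hypothesis g_super : superlinear gB.

Let weight (lam r : R) : R := lam * q (clamp 0 rho r).

Let n_gt0 : (0 < N.-1)%N.
Proof. by rewrite -ltnS prednK // ltnW. Qed.

Let weight_le lam r : 0 < lam -> `|weight lam r| <= lam * Qb.
Proof. by move=> lam0; rewrite normrM gtr0_norm // ler_wpM2l // ltW. Qed.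

Let continuous_weight lam : continuous (weight lam).
Proof.
move=> r; have c1 : {for r, continuous (fun _ : R => lam)} by exact: cst_continuous.
exact (ctsR_mul c1 (@cQ r)).
Qed.

Let gN x := - gB (- x).

Let gNK x y : `|gN x - gN y| <= K * `|x - y|.
Proof.
rewrite /gN opprK addrC; apply: le_trans (gK _ _) _.
by rewrite opprK [- y + x]addrC.
Qed.

Let gN0 : gN 0 = 0.
Proof. by rewrite /gN oppr0 g0 oppr0. Qed.

Let cgB : continuous gB.
Proof. by move=> x; apply: (continuous_lip (gK^~ x)). Qed.

Lemma shot_nodal_solution (lam : R) (j : nat) (u w : R -> R) :
  0 < lam -> (1 <= j)%N -> shot N.-1 rho (weight lam) gB u w ->
  0 < u 0 -> u 0 <= rho + 1 ->
  angle N.-1 rho (weight lam) gB u w rho = cos_zero R j.+1 ->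
  nodal_solution N rho q g lam j.+1 u.
Proof.
move=> lam0 j1 s u0 u01 thE; have u0N : u 0 != 0 by rewrite gt_eqF.
have aA r := weight_le r lam0; have ca := @continuous_weight lam.
split; [split|].
- apply: (shot_radial_solution N_ge2 rho_gt0 cQ cgB s).
    move=> r rin; apply: gE; have H := shot_dist s rin.
    have -> : u r = u 0 + (u r - u 0) by ring.
    apply: le_trans (ler_normD _ _) _; rewrite (gtr0_norm u0); lra.
  exact (shot_eq0_final N_ge2 rho_gt0 aA gK g0 ca s u0N thE).
- exact (shot_sign_changing N_ge2 rho_gt0 aA gK g0 ca s u0N thE j1).
- exact (shot_nodal_domains N_ge2 rho_gt0 aA gK g0 ca s u0N thE).
Qed.

Lemma shot_nodal_solution_opp (lam : R) (j : nat) (u w : R -> R) :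
  0 < lam -> (1 <= j)%N -> shot N.-1 rho (weight lam) gN u w ->
  0 < u 0 -> u 0 <= rho + 1 ->
  angle N.-1 rho (weight lam) gN u w rho = cos_zero R j.+1 ->
  nodal_solution N rho q g lam j.+1 (fun r => - u r).
Proof.
move=> lam0 j1 s u0 u01 thE; have u0N : u 0 != 0 by rewrite gt_eqF.
have aA r := weight_le r lam0; have ca := @continuous_weight lam.
split; [split|].
- apply: (shot_radial_solution N_ge2 rho_gt0 cQ cgB (shot_opp s)).
    move=> r rin; apply: gE; rewrite normrN; have H := shot_dist s rin.
    have -> : u r = u 0 + (u r - u 0) by ring.
    apply: le_trans (ler_normD _ _) _; rewrite (gtr0_norm u0); lra.
  by rewrite (shot_eq0_final N_ge2 rho_gt0 aA gNK gN0 ca s u0N thE) oppr0.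
- apply: sign_changing_opp.
  exact (shot_sign_changing N_ge2 rho_gt0 aA gNK gN0 ca s u0N thE j1).
- rewrite nodal_domains_opp.
  exact (shot_nodal_domains N_ge2 rho_gt0 aA gNK gN0 ca s u0N thE).
Qed.

Lemma four_nodal_solutions (k : nat) : exists2 Lam : R, 0 < Lam &
  forall lam, Lam <= lam -> forall j, (1 <= j <= k)%N ->
    exists ulm usm usp ulp : R -> R,
      [/\ nodal_solution N rho q g lam j.+1 ulm,
          nodal_solution N rho q g lam j.+1 usm,
          nodal_solution N rho q g lam j.+1 usp &
          nodal_solution N rho q g lam j.+1 ulp] /\
      [/\ ulm 0 < usm 0, usm 0 < 0, 0 < usp 0 & usp 0 < ulp 0].
Proof.
have gN_sign x : `|x| < delta -> x != 0 -> 0 < gN x * x.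
  by move=> xd x0; rewrite /gN mulNr -mulrN g_sign ?normrN ?oppr_eq0.
have gN_super : superlinear gN.
  move=> e e0; have [tau tau0 H] := g_super e0; exists tau => // x xtau.
  by rewrite /gN normrN -[`|x|]normrN H // normrN.
have [L1 L10 H1] := two_heights n_gt0 rho_gt0 QQb gK g0 cQ r1_gt0 r12 r2_rho
  q0_gt0 Qq0 delta_gt0 g_sign g_super k.
have [L2 L20 H2] := two_heights n_gt0 rho_gt0 QQb gNK gN0 cQ r1_gt0 r12 r2_rho
  q0_gt0 Qq0 delta_gt0 gN_sign gN_super k.
exists (L1 + L2); first exact: addr_gt0.
move=> lam Llam j jk; have j1 : (1 <= j)%N by case/andP: jk.
have L1lam : L1 <= lam by lra.
have L2lam : L2 <= lam by lra.
have lam0 : 0 < lam by exact: lt_le_trans L1lam.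
have [us [ws [ul [wl [[ss sl us0 usl ul1] [ths thl]]]]]] := H1 lam L1lam j jk.
have [us' [ws' [ul' [wl' [[ss' sl' us0' usl' ul1'] [ths' thl']]]]]] :=
  H2 lam L2lam j jk.
exists (fun r => - ul' r), (fun r => - us' r), us, ul; split; split.
- apply: (shot_nodal_solution_opp lam0 j1 sl') => //; exact: lt_trans usl'.
- apply: (shot_nodal_solution_opp lam0 j1 ss') => //.
  exact: le_trans (ltW usl') ul1'.
- by apply: (shot_nodal_solution lam0 j1 ss) => //; exact: le_trans (ltW usl) ul1.
- by apply: (shot_nodal_solution lam0 j1 sl) => //; exact: lt_trans usl.
- by rewrite ltrN2.
- by rewrite oppr_lt0.
- by [].
- by [].
Qed.

End pairs.

(** Listing the [4 k] solutions: across different [j] they have different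
    numbers of nodal domains, and for the same [j] different heights. *)
Lemma distinct_solutions (R : realType) (N : nat) (rho : R) (q g : R -> R)
    (lam : R) (k : nat) : 0 < rho ->
  (forall j, (1 <= j <= k)%N -> exists ulm usm usp ulp : R -> R,
      [/\ nodal_solution N rho q g lam j.+1 ulm,
          nodal_solution N rho q g lam j.+1 usm,
          nodal_solution N rho q g lam j.+1 usp &
          nodal_solution N rho q g lam j.+1 ulp] /\
      [/\ ulm 0 < usm 0, usm 0 < 0, 0 < usp 0 & usp 0 < ulp 0]) ->
  exists U : 'I_(4 * k) -> R -> R,
    (forall i, sign_changing_solution N rho q g lam (U i)) /\
    (forall i j, {in `[0, rho], U i =1 U j} -> i = j).
Proof.
move=> rho_gt0 H.
have /choice[V VP] : forall j, exists V : nat -> R -> R, (1 <= j <= k)%N ->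
    (forall t, (t < 4)%N -> nodal_solution N rho q g lam j.+1 (V t)) /\
    (forall t t', (t < t')%N -> (t' < 4)%N -> V t 0 < V t' 0).
  move=> j; have [jk|jk] := boolP (1 <= j <= k)%N; last first.
    by exists (fun _ _ => 0).
  have [u1 [u2 [u3 [u4 [[n1 n2 n3 n4] [h1 h2 h3 h4]]]]]] := H j jk.
  exists (nth (fun=> 0) [:: u1; u2; u3; u4]) => _; split.
    by move=> [|[|[|[|]]]].
  have h23 := lt_trans h2 h3; have h13 := lt_trans h1 h23.
  have h24 := lt_trans h23 h4; have h14 := lt_trans h1 h24.
  by move=> [|[|[|[|t]]]] [|[|[|[|t']]]].
have idx (i : 'I_(4 * k)) : (1 <= (i %/ 4).+1 <= k)%N.
  by rewrite /= ltn_divLR // (mulnC k 4).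
have m4 (x : nat) : (x %% 4 < 4)%N by exact: ltn_pmod.
exists (fun i => V (i %/ 4).+1 (i %% 4)%N); split=> [i|i i' ii'].
  by have [ns _] := VP _ (idx i); have [] := ns _ (m4 i).
have [ns mono] := VP _ (idx i); have [ns' _] := VP _ (idx i').
have [dE] := nodal_solution_inj (ns _ (m4 i)) (ns' _ (m4 i')) ii'.
have zin : 0 \in `[0, rho] by rewrite in_itv/= lexx ltW.
have := ii' 0 zin; rewrite -dE => V0.
have mE : (i %% 4 = i' %% 4)%N.
  have [lt|gt|//] := ltngtP (i %% 4)%N (i' %% 4)%N.
    by have := mono _ _ lt (m4 _); rewrite V0 ltxx.
  by have := mono _ _ gt (m4 _); rewrite V0 ltxx.
by apply: val_inj; rewrite /= (divn_eq i 4) (divn_eq i' 4) dE mE.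
Qed.

Theorem theorem3p1 (R : realType) (N : nat) (N_ge2 : (2 <= N)%N)
    (rho : R) (rho_gt0 : 0 < rho)
    (q : R -> R) (q_cont : {within `[0, rho], continuous q})
    (q_pos : exists2 r0 : R, r0 \in `[0, rho] & 0 < q r0)
    (g : R -> R) (g_lip : locally_lipschitz g)
    (g_sign : exists2 delta : R, 0 < delta &
       forall s : R, - delta < s < delta -> s != 0 -> 0 < g s * s)
    (g_superlinear : g s / s @[s --> 0^'] --> 0)
    (k : nat) (k_ge1 : (1 <= k)%N) :
  exists2 lambda_star : R, 0 < lambda_star &
  forall lambda : R, lambda_star < lambda ->
    (* at least 4k sign-changing radial solutions, distinct on [0, rho] *)
    (exists U : 'I_(4 * k) -> R -> R,
       (forall i, sign_changing_solution N rho q g lambda (U i)) /\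
       (forall i j, {in `[0, rho], U i =1 U j} -> i = j)) /\
    (forall j : nat, (1 <= j <= k)%N ->
       exists ulm usm usp ulp : R -> R,
         [/\ nodal_solution N rho q g lambda j.+1 ulm,
             nodal_solution N rho q g lambda j.+1 usm,
             nodal_solution N rho q g lambda j.+1 usp &
             nodal_solution N rho q g lambda j.+1 ulp] /\
         [/\ ulm 0 < usm 0, usm 0 < 0, 0 < usp 0 & usp 0 < ulp 0]).
Proof.
have rho_ge0 : 0 <= rho by exact: ltW.
have [delta delta_gt0 g_sgn] := g_sign.
pose b : R := 2 * rho + 1.
have b_gt0 : 0 < b by rewrite /b; lra.
have bb : - b <= b by lra.
(* Trajectories with height in (0, rho + 1] stay in [- b, b], so the force may
   be frozen outside. *)
pose gB x := g (clamp (- b) b x).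
have inb (x : R) : `|x| <= b -> x \in `[- b, b] by rewrite ler_norml in_itv.
have gBE x : `|x| <= b -> gB x = g x by move=> /inb xin; rewrite /gB clamp_id.
have [K0 gK0] := locally_lipschitz_segment bb g_lip.
have gK x y : `|gB x - gB y| <= `|K0| * `|x - y|.
  apply: le_trans (gK0 _ _ (clamp_itv bb x) (clamp_itv bb y)) _.
  apply: le_trans (ler_wpM2r (normr_ge0 _) (ler_norm K0)) _.
  by apply: ler_wpM2l => //; exact: clamp_lip.
have cg : {for 0, continuous gB} by apply: (continuous_lip (gK^~ 0)).
have [d [d_gt0 d_delta d_b]] : exists d : R, [/\ 0 < d, d <= delta & d <= b].
  by exists (Num.min delta b); rewrite lt_min delta_gt0 !ge_min !lexx orbT.
have gB_sign x : `|x| < d -> x != 0 -> 0 < gB x * x.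
  move=> xd x0; rewrite gBE; last by apply/ltW/(lt_le_trans xd).
  by apply: g_sgn => //; rewrite -ltr_norml (lt_le_trans xd).
have g0 : gB 0 = 0.
  have [gp|gm|//] := ltrgt0P (gB 0).
    have [e e0 he] := continuous_near_gt cg gp.
    pose m : R := Num.min e d.
    have m0 : 0 < m by rewrite lt_min e0.
    have [me md] : m <= e /\ m <= d by rewrite !ge_min !lexx orbT.
    have m2 : `|- (m / 2)| = m / 2 by rewrite normrN gtr0_norm ?divr_gt0.
    have h1 : 0 < gB (- (m / 2)) by apply: he; rewrite subr0 m2; lra.
    have := gB_sign (- (m / 2)); rewrite m2 oppr_eq0 gt_eqF ?divr_gt0 //.
    rewrite pmulr_rgt0 // oppr_gt0 => H; have := H ltac:(lra) isT; lra.
  have [e e0 he] := continuous_near_lt cg gm.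
  pose m : R := Num.min e d.
  have m0 : 0 < m by rewrite lt_min e0.
  have [me md] : m <= e /\ m <= d by rewrite !ge_min !lexx orbT.
  have m2 : `|m / 2| = m / 2 by rewrite gtr0_norm ?divr_gt0.
  have h1 : gB (m / 2) < 0 by apply: he; rewrite subr0 m2; lra.
  have := gB_sign (m / 2); rewrite m2 gt_eqF ?divr_gt0 //.
  rewrite nmulr_rgt0 // => H; have := H ltac:(lra) isT; lra.
have gB_super : superlinear gB.
  move=> e e0.
  move/cvgrPdist_lt: (g_superlinear) => /(_ e e0).
  rewrite near_withinE => /nbhs_ballP[t /= t0 ht].
  pose m : R := Num.min (t / 2) b.
  have m0 : 0 < m by rewrite lt_min b_gt0 divr_gt0.
  have [mt mb] : m <= t / 2 /\ m <= b by rewrite !ge_min !lexx orbT.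
  exists m => // x xm.
  have [->|x0] := eqVneq x 0; first by rewrite g0 normr0 mulr0.
  have xt : ball (0 : R) t x by rewrite /ball /= sub0r normrN; lra.
  have := ht x xt x0; rewrite sub0r normrN normrM normfV.
  rewrite ltr_pdivrMr ?normr_gt0 // gBE; first exact: ltW.
  exact: le_trans xm mb.
have cQ := continuous_comp_clamp rho_ge0 q_cont.
have [z zin QQb] : exists2 z, z \in `[0, rho] &
    forall r, r \in `[0, rho] -> `|q (clamp 0 rho r)| <= `|q (clamp 0 rho z)|.
  apply: EVT_max => //; apply: continuous_subspaceT => r.
  exact: ctsR_comp (cQ r) (@norm_continuous _ R _).
have {}QQb r : `|q (clamp 0 rho r)| <= `|q (clamp 0 rho z)|.
  have := QQb _ (clamp_itv rho_ge0 r).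
  by rewrite (clamp_id (clamp_itv rho_ge0 r)).
have [r0 r0in qr0] := q_pos.
have [r1 [r2 [r1_gt0 r12 r2_rho qr12]]] : exists r1 r2, [/\ 0 < r1, r1 < r2,
    r2 <= rho & forall r, r \in `[r1, r2] -> q r0 / 2 <= q (clamp 0 rho r)].
  have qr0c : q r0 / 2 < q (clamp 0 rho r0) by rewrite clamp_id //; lra.
  have [e e0 he] := continuous_near_gt (cQ r0) qr0c.
  move: r0in; rewrite in_itv/= => /andP[r00].
  rewrite le_eqVlt => /predU1P[r0rho|r0rho].
    pose m : R := Num.min e rho.
    have m0 : 0 < m by rewrite lt_min e0.
    have [me mr] : m <= e /\ m <= rho by rewrite !ge_min !lexx orbT.
    exists (rho - m / 2), rho; split; [lra|lra|by []|].
    move=> r; rewrite in_itv/= => /andP[rm rr]; apply/ltW/he.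
    by rewrite r0rho ltr_norml; apply/andP; split; lra.
  pose m : R := Num.min e (rho - r0).
  have m0 : 0 < m by rewrite lt_min e0 subr_gt0.
  have [me mr] : m <= e /\ m <= rho - r0 by rewrite !ge_min !lexx orbT.
  exists (r0 + m / 4), (r0 + m / 2); split; [lra|lra|lra|].
  move=> r; rewrite in_itv/= => /andP[rm rr]; apply/ltW/he.
  by rewrite ltr_norml; apply/andP; split; lra.
have q0_gt0 : 0 < q r0 / 2 by rewrite divr_gt0.
have gE x : `|x| <= 2 * rho + 1 -> g x = gB x by move=> /gBE ->.
have [Lam Lam_gt0 H] := four_nodal_solutions N_ge2 rho_gt0 cQ QQb gK g0 gE
  r1_gt0 r12 r2_rho q0_gt0 qr12 d_gt0 gB_sign gB_super k.
exists Lam => // lam /ltW Llam; split; last exact: H.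
by apply: distinct_solutions => //; exact: H.
Qed.
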